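(* Let $f(\mathbf{x})=\mathbb{E}_{\zeta\sim\mathcal{D}}[F(\mathbf{x};\zeta)]$ on $\mathbb{R}^d$ satisfy the smoothness, boundedness, noise and dispersive-noise assumptions (A1)–(A4) of the context, with parameters $L,\rho,\sigma$, starting point $\tilde{\mathbf{x}}$ and $\Delta=f(\tilde{\mathbf{x}})-\inf f<\infty$. Let the parameters $K_0$, $\eta$ and $B$ be set as in the parameter setting (P) of the context, with $p\in(0,1)$ being the error probability, and set $$T_1=\left\lceil \frac{7\Delta\,\eta K_0}{B^2}\right\rceil+1\asymp\epsilon^{-1.5}.$$ Then, running the ball-controlled SGD algorithm of the context from $\tilde{\mathbf{x}}$ in $$T_0=T_1\cdot K_0\asymp\frac{\Delta\,\rho^{1/2}}{\max(\sigma^2,1)\,\epsilon^{3.5}}\asymp\epsilon^{-3.5}$$ SGD steps, with probability at least $1-(T_1+1)\cdot p$, SGD outputs an $\bar{\mathbf{x}}_{output}$ satisfying $$\|\nabla f(\bar{\mathbf{x}}_{output})\|\le 18\rho B^2\asymp\epsilon,\qquad \lambda_{\min}\big(\nabla^2 f(\bar{\mathbf{x}}_{output})\big)\ge -17\delta\asymp-\sqrt{\rho\epsilon}.$$ Treating $\sigma$, $L$ and $\rho$ as global constants, the stochastic gradient computational cost is $\tilde{\mathcal{O}}(\epsilon^{-3.5})$.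
   Context: $\|\cdot\|$ is the Euclidean norm of vectors or the spectral norm of matrices; $\lambda_{\min}$ is the least eigenvalue. $F(\mathbf{x};\zeta)$ is a family of stochastic functions indexed by a random variable $\zeta\sim\mathcal{D}$, with $\mathbb{E}_\zeta[\nabla F(\mathbf{x};\zeta)]=\nabla f(\mathbf{x})$; $f$ may be nonconvex. $p_n\asymp q_n$ means $p_n=\tilde C q_n$ where $\tilde C$ hides a polylogarithmic factor of $d$ and $\epsilon$; $\tilde{\mathcal{O}}$ is an upper bound up to such a factor. The parameters $L,\rho,\Delta,\sigma$ are treated as global constants. Assumptions. (A1) Smoothness: for all $\mathbf{x},\mathbf{x}'\in\mathbb{R}^d$, $\|\nabla F(\mathbf{x};\zeta)-\nabla F(\mathbf{x}';\zeta)\|\le L\|\mathbf{x}-\mathbf{x}'\|$ and $\|\nabla^2 f(\mathbf{x})-\nabla^2 f(\mathbf{x}')\|\le\rho\|\mathbf{x}-\mathbf{x}'\|$. (A2) Boundedness: $\Delta:=f(\tilde{\mathbf{x}})-f^*<\infty$, where $f^*=\inf_{\mathbf{x}\in\mathbb{R}^d}f(\mathbf{x})$. (A3) Bounded noise: for every $\mathbf{x}\in\mathbb{R}^d$, $\|\nabla F(\mathbf{x};\zeta)-\nabla f(\mathbf{x})\|^2\le\sigma^2$ almost surely; or, as an alternative (slightly weaker) assumption that also works, the norm of the noise is sub-Gaussian, i.e. for every $\mathbf{x}\in\mathbb{R}^d$, $\mathbb{E}_\zeta\big[\exp(\|\nabla F(\mathbf{x};\zeta)-\nabla f(\mathbf{x})\|^2/\sigma^2)\big]\le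 1$. (A4) Dispersive noise: a Borel set $\mathcal{A}\subseteq\mathbb{R}^d$ has the $(q^*,\mathbf{v})$-narrow property (for $q^*>0$ and a unit vector $\mathbf{v}$) if for every $\mathbf{u}\in\mathcal{A}$ and every $q\ge q^*$ one has $\mathbf{u}+q\mathbf{v}\in\mathcal{A}^c$. A random vector $\tilde{\boldsymbol\xi}$ satisfying the noise assumption (A3) has the $\mathbf{v}$-dispersive property if $\mathbb{P}(\tilde{\boldsymbol\xi}\in\mathcal{A})\le\frac14$ for every set $\mathcal{A}$ with the $(\sigma/(4\sqrt d),\mathbf{v})$-narrow property. The assumption is: for every $\mathbf{x}\in\mathbb{R}^d$, $\nabla F(\mathbf{x};\zeta)$ has the $\mathbf{v}$-dispersive property for every unit vector $\mathbf{v}$. Parameter setting (P): $\tilde C_1=2\left\lfloor\frac{\log(3\cdot p^{-1})}{\log(0.7^{-1})}+1\right\rfloor\log\!\left(\frac{24\sqrt d}{\eta}\right)\asymp1$, $\ \delta=\sqrt{\rho\epsilon}\asymp\epsilon^{0.5}$, $\ \delta_2=16\delta\asymp\epsilon^{0.5}$, $\ B=\frac{\delta}{\rho\tilde C_1}\asymp\epsilon^{0.5}$, $\ K_0=\tilde C_1\eta^{-1}\delta_2^{-1}\asymp\epsilon^{-2}$, and the step size $\eta$ satisfies $$\eta\le\frac{B^2\delta}{64\max(\sigma^2,1)\,\tilde C_1\log(48K_0/p)}\cdot\frac{1}{3+\log(K_0)}\asymp\epsilon^{1.5},$$ where the algorithm is run with $\eta\asymp\epsilon^{1.5}$. It is also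 assumed that $B\le\min(1,\sigma/L,1/L)$ and $\delta\le1$ (i.e. the accuracy satisfies $\epsilon\le\mathcal{O}(1)$). Algorithm (ball-controlled SGD). Set $k=0$, $\mathbf{x}^0=\tilde{\mathbf{x}}$. While $k<K_0$: draw an independent $\zeta^{k+1}\sim\mathcal{D}$, set $\mathbf{x}^{k+1}=\mathbf{x}^k-\eta\nabla F(\mathbf{x}^k;\zeta^{k+1})$ (one SGD step), increase $k$ by one; then if $\|\mathbf{x}^k-\mathbf{x}^0\|>B$, replace $\mathbf{x}^0$ by $\mathbf{x}^k$ and reset $k=0$. When the loop ends, output $\bar{\mathbf{x}}_{output}=\frac1{K_0}\sum_{k=0}^{K_0-1}\mathbf{x}^k$. *)

(* Defs.v *)
From HB Require Import structures.
From mathcomp Require Import all_boot all_order all_algebra finmap.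
From mathcomp Require Import all_classical all_reals all_analysis.

Set Implicit Arguments.
Unset Strict Implicit.
Unset Printing Implicit Defensive.

Import Order.TTheory GRing.Theory Num.Theory.
Import numFieldNormedType.Exports.

Local Open Scope classical_set_scope.
Local Open Scope ring_scope.

(* The norm that the library puts on matrices is the sup norm: it is used here
   only through the topology and the differentiability it induces, which are
   those of the Euclidean norm. *)
Definition enorm (R : realType) (d : nat) (x : 'rV[R]_d) : R :=
  Num.sqrt (\sum_(i < d) x 0 i ^+ 2).

(* Vectors are rows, so a matrix acts by v |-> v *m M. *)
Definition spectral_norm (R : realType) (d : nat) (M : 'M[R]_d) : R :=
  sup [set enorm (v *m M) | v in [set v : 'rV[R]_d | enorm v = 1]].

(* For a symmetric M of positive size the set is finite and nonempty, and the
   infimum is a minimum. *)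
Definition lambda_min (R : realType) (d : nat) (M : 'M[R]_d) : R :=
  inf [set a : R | eigenvalue M a].

Definition grad (R : realType) (d : nat) (f : 'rV[R]_d -> R) (x : 'rV[R]_d) :
    'rV[R]_d :=
  \row_(i < d) 'D_(delta_mx 0 i) f x.

Definition hessian (R : realType) (d : nat) (f : 'rV[R]_d -> R)
    (x : 'rV[R]_d) : 'M[R]_d :=
  jacobian (grad f) x.

Definition sgrad (R : realType) (d : nat) (Z : Type) (F : 'rV[R]_d -> Z -> R)
    (x : 'rV[R]_d) (z : Z) : 'rV[R]_d :=
  grad (F ^~ z) x.

Section assumptions.
Context (R : realType) (d : nat) (dZ : measure_display) (Z : measurableType dZ).
Implicit Types (D : probability Z R) (F : 'rV[R]_d -> Z -> R).
Implicit Types (f : 'rV[R]_d -> R).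

Definition is_mean D F f : Prop :=
  forall x, D.-integrable setT (EFin \o F x) /\ 'E_D[F x]%E = (f x)%:E.

Definition differentiability F f : Prop :=
  [/\ forall z x, differentiable (F ^~ z) x,
      forall x, differentiable f x
    & forall x, differentiable (grad f) x].

Definition unbiased_gradient D F f : Prop :=
  forall x (i : 'I_d),
    D.-integrable setT (EFin \o (fun z => sgrad F x z 0 i)) /\
    'E_D[fun z => (sgrad F x z 0 i)%R]%E = (grad f x 0 i)%:E.

Definition smoothness (L rho : R) F f : Prop :=
  (forall z x x', enorm (sgrad F x z - sgrad F x' z) <= L * enorm (x - x')) /\
  (forall x x',
     spectral_norm (hessian f x - hessian f x') <= rho * enorm (x - x')).

(* Since expR is at least 1 on nonnegative reals, the second alternative makes
   the noise vanish almost surely. *)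
Definition bounded_noise (sigma : R) D F f : Prop :=
  (forall x, {ae D, forall z,
     enorm (sgrad F x z - grad f x) ^+ 2 <= sigma ^+ 2}) \/
  (forall x,
     ('E_D[fun z => (expR (enorm (sgrad F x z - grad f x) ^+ 2 / sigma ^+ 2))%R]
        <= 1)%E).

Definition narrow (qstar : R) (v : 'rV[R]_d) (A : set 'rV[R]_d) : Prop :=
  forall u q, A u -> qstar <= q -> (~` A) (u + q *: v).

Definition dispersive (sigma : R) D (v : 'rV[R]_d) (xi : Z -> 'rV[R]_d) : Prop :=
  forall A : set 'rV[R]_d, <<s open >> A ->
    narrow (sigma / (4 * Num.sqrt d%:R)) v A ->
    (D (xi @^-1` A) <= (1 / 4)%:E)%E.

Definition dispersive_noise (sigma : R) D F : Prop :=
  forall x v, enorm v = 1 -> dispersive sigma D v (sgrad F x).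

End assumptions.

Definition mutually_independent (R : realType) (dO dZ : measure_display)
    (Omega : measurableType dO) (Z : measurableType dZ)
    (P : probability Omega R) (zeta : nat -> {RV P >-> Z}) : Prop :=
  forall (I : {fset nat}) (A : nat -> set Z),
    (forall n, measurable (A n)) ->
    P (\big[setI/setT]_(n <- I) (zeta n @^-1` A n)) =
    (\prod_(n <- I) P (zeta n @^-1` A n))%E.

Definition iid (R : realType) (dO dZ : measure_display)
    (Omega : measurableType dO) (Z : measurableType dZ)
    (P : probability Omega R) (D : probability Z R)
    (zeta : nat -> {RV P >-> Z}) : Prop :=
  (forall n A, measurable A -> distribution P (zeta n) A = D A) /\
  mutually_independent zeta.

Section parameters.
Context (R : realType).
Implicit Types (d : nat) (rho sigma L Delta eps eta p : R).

Definition sgd_C1 d eta p : R :=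
  2 * (Num.floor (ln (3 * p^-1) / ln ((7 / 10)^-1) + 1))%:~R *
  ln (24 * Num.sqrt d%:R / eta).

Definition sgd_delta rho eps : R := Num.sqrt (rho * eps).

Definition sgd_delta2 rho eps : R := 16 * sgd_delta rho eps.

Definition sgd_radius d rho eps eta p : R := sgd_delta rho eps / (rho * sgd_C1 d eta p).

Definition epoch_length d rho eps eta p : R :=
  sgd_C1 d eta p * eta^-1 * (sgd_delta2 rho eps)^-1.

(* The number of iterations of a loop guarded by k < epoch_length. *)
Definition sgd_K0 d rho eps eta p : nat :=
  `|Num.ceil (epoch_length d rho eps eta p)|%N.

Definition step_size_bound d rho sigma eps eta p : R :=
  sgd_radius d rho eps eta p ^+ 2 * sgd_delta rho eps /
  (64 * Num.max (sigma ^+ 2) 1 * sgd_C1 d eta p *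
   ln (48 * (sgd_K0 d rho eps eta p)%:R / p)) *
  (1 / (3 + ln (sgd_K0 d rho eps eta p)%:R)).

(* [1 <= epoch_length] says that an epoch is a genuine loop; for very large
   step sizes the logarithms in [step_size_bound] could both be negative, or
   [epoch_length] could be rounded up from a number close to zero. *)
Definition parameter_setting d L rho sigma eps eta p : Prop :=
  [/\ 0 < eps, 0 < eta,
      1 <= epoch_length d rho eps eta p
    & eta <= step_size_bound d rho sigma eps eta p] /\
  sgd_radius d rho eps eta p <= Num.min 1 (Num.min (sigma / L) (1 / L)) /\
  sgd_delta rho eps <= 1.

Definition sgd_T1 d rho eps eta p Delta : nat :=
  (`|Num.ceil (7 * Delta * eta * (sgd_K0 d rho eps eta p)%:R /
               sgd_radius d rho eps eta p ^+ 2)|.+1)%N.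

Definition sgd_T0 d rho eps eta p Delta : nat :=
  (sgd_T1 d rho eps eta p Delta * sgd_K0 d rho eps eta p)%N.

Definition polylog d eps : R := 1 + ln d%:R + `|ln eps|.

(* a is at most b, respectively of the order of b, up to the factor
   C * polylog ^+ m; asymptotic statements quantify C and m before d and eps. *)
Definition bigO_polylog (C : R) (m : nat) d eps (a b : R) : Prop :=
  a <= C * polylog d eps ^+ m * b.

Definition asymp_polylog (C : R) (m : nat) d eps (a b : R) : Prop :=
  bigO_polylog C m d eps a b /\ bigO_polylog C m d eps b a.

End parameters.

Section ball_controlled_sgd.
Context (R : realType) (d : nat) (Z : Type).

(* [acc] is the sum of the iterates x^0, ..., x^(counter - 1) of the current
   epoch, [anchor] its starting point x^0 and [current] its latest iterate. *)
Record sgd_state := SgdState {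
  counter : nat;
  anchor : 'rV[R]_d;
  current : 'rV[R]_d;
  acc : 'rV[R]_d }.

Definition sgd_step (G : 'rV[R]_d -> Z -> 'rV[R]_d) (eta B : R) (K : nat)
    (s : sgd_state) (z : Z) : sgd_state :=
  if (counter s < K)%N then
    let x := current s - eta *: G (current s) z in
    if B < enorm (x - anchor s) then SgdState 0 x x 0
    else SgdState (counter s).+1 (anchor s) x (acc s + current s)
  else s.

(* State after t steps; it is frozen once the loop has ended. *)
Fixpoint sgd_run (G : 'rV[R]_d -> Z -> 'rV[R]_d) (eta B : R) (K : nat)
    (x0 : 'rV[R]_d) (z : nat -> Z) (t : nat) : sgd_state :=
  if t is t'.+1 then
    sgd_step G eta B K (sgd_run G eta B K x0 z t') (z t')
  else SgdState 0 x0 x0 0.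

Definition sgd_ended (K : nat) (s : sgd_state) : Prop := (K <= counter s)%N.

Definition sgd_output (K : nat) (s : sgd_state) : 'rV[R]_d :=
  K%:R^-1 *: acc s.

End ball_controlled_sgd.

(* Main.v *)
(** Call epoch the stretch of iterations that follows a choice of the anchor x^0.
    With probability at least 1 - p an epoch either leaves the ball of radius B
    after decreasing f by at least B^2 / (7 eta K0), or ends after K0 steps with
    an average that is approximately stationary of second order.  The first
    alternative occurs fewer than T1 times, which leaves T1 epochs to control.

    This is carried out for the Markov chain of the states of the algorithm: the
    probability of ending badly from a given state is bounded by induction on the
    number of remaining steps, the bound being a sum of supermartingales.

    - Descent.  Diagonalize the Hessian H at the anchor.  In the directions of
      positive curvature, replace the displacement by what gradient descent with
      half the step size would make of it in the remaining time, and evaluate on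
      the result the quadratic model of f plus a slowly decreasing multiple of the
      squared norm.  An exponential of this quantity is a supermartingale, so it
      is likely to stay below 0.35 rho B^3 at all times; upon leaving the ball the
      quadratic penalty exceeds 3.9 rho B^3, and f must have decreased.
    - Average.  The gradient at the average is, up to O(rho B^2), equal to
      (x^0 - x^K0) / (eta K0) minus the mean noise, and the squared norm of the
      sum of the noise has an exponential moment.
    - Escape.  If H has an eigenvalue below -16 delta with eigenvector v, two runs
      driven by the same noise from points that differ along v separate
      exponentially fast and cannot both stay in the ball.  Hence the first
      gradients after which staying is likely form a narrow set in the direction
      v, which the noise avoids with probability 3/4; this is repeated over
      O(log (1/p)) blocks of iterations. *)
Require Import Defs.
From HB Require Import structures.
From mathcomp Require Import all_boot all_order all_algebra finmap.
From mathcomp Require Import all_classical all_reals all_analysis.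
From mathcomp Require Import measurable_realfun lebesgue_measure.
From mathcomp Require Import ring lra.
Set Implicit Arguments.
Unset Strict Implicit.
Unset Printing Implicit Defensive.
Import Order.TTheory GRing.Theory Num.Theory.
Import numFieldNormedType.Exports.
Local Open Scope classical_set_scope.
Local Open Scope ring_scope.

(** * Euclidean norm and spectral norm *)

(** The obstacle to descent is the size of the noise. Estimated through the curvature bound L, its
    second-order effect is [eta ^+ 2 * L * sigma ^+ 2] per step; over an epoch this is of order eps
    up to logarithms, while the tolerated error [rho * B ^+ 3] is of order eps^(3/2). Propagating
    the displacement to the end of the horizon damps noise in a direction of curvature lam > 0 by
    [(1 - eta / 2 * lam) ^+ n] when n steps remain, and lam times the square of this factor is at
    most of order 1 / (eta * n), whatever lam is. The total becomes [eta * sigma ^+ 2] times a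
    harmonic sum, whence the factor [3 + ln K] in the step size bound. A prediction with the full
    step size would have no drift left to absorb cross terms; half of it leaves enough.

    The one-step estimates are pathwise: the new value is at most the old one plus [dot c xi], where
    c does not depend on the noise xi. Taking expectations then only has to remove a linear term of
    mean zero, and no conditional expectation is formed. *)

Section euclidean.
Context (R : realType) (d : nat).
Implicit Types (x y z : 'rV[R]_d) (a c : R) (M : 'M[R]_d).

Definition dot x y : R := \sum_(i < d) x 0 i * y 0 i.

Lemma dotC x y : dot x y = dot y x.
Proof. by apply: eq_bigr => i _; rewrite mulrC. Qed.

Lemma dotDl x y z : dot (x + y) z = dot x z + dot y z.
Proof. by rewrite -big_split; apply: eq_bigr => i _; rewrite mxE mulrDl. Qed.

Lemma dotDr x y z : dot z (x + y) = dot z x + dot z y.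
Proof. by rewrite dotC dotDl !(dotC z). Qed.

Lemma dotZl a x y : dot (a *: x) y = a * dot x y.
Proof. by rewrite mulr_sumr; apply: eq_bigr => i _; rewrite mxE mulrA. Qed.

Lemma dotZr a x y : dot x (a *: y) = a * dot x y.
Proof. by rewrite dotC dotZl dotC. Qed.

Lemma dotNl x y : dot (- x) y = - dot x y.
Proof. by rewrite -scaleN1r dotZl mulN1r. Qed.

Lemma dotNr x y : dot x (- y) = - dot x y.
Proof. by rewrite dotC dotNl dotC. Qed.

Lemma dotBl x y z : dot (x - y) z = dot x z - dot y z.
Proof. by rewrite dotDl dotNl. Qed.

Lemma dotBr x y z : dot z (x - y) = dot z x - dot z y.
Proof. by rewrite dotDr dotNr. Qed.

Lemma dot0l x : dot 0 x = 0.
Proof. by rewrite -(scale0r 0) dotZl mul0r. Qed.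

Lemma dot0r x : dot x 0 = 0.
Proof. by rewrite dotC dot0l. Qed.

Lemma dot_ge0 x : 0 <= dot x x.
Proof. by apply: sumr_ge0 => i _; rewrite -expr2 sqr_ge0. Qed.

Lemma dot_eq0 x : dot x x = 0 -> x = 0.
Proof.
move=> /eqP; rewrite psumr_eq0 => [/allP x0|i _]; last by rewrite -expr2 sqr_ge0.
apply/rowP => i; rewrite mxE; apply/eqP.
by have := x0 i (mem_index_enum _); rewrite -expr2 sqrf_eq0.
Qed.

Lemma dot_delta x i : dot x (delta_mx 0 i) = x 0 i.
Proof.
rewrite /dot (bigD1 i) //= mxE !eqxx mulr1 big1 ?addr0 // => j ji.
by rewrite mxE (negbTE ji) andbF mulr0.
Qed.

Lemma dot_mxE x y : dot x y = (x *m y^T) 0 0.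
Proof. by rewrite mxE; apply: eq_bigr => i _; rewrite mxE. Qed.

Lemma dot_mulmx x y M : dot (x *m M) y = dot x (y *m M^T).
Proof. by rewrite !dot_mxE trmx_mul trmxK mulmxA. Qed.

Lemma enormE x : enorm x = Num.sqrt (dot x x).
Proof. by congr Num.sqrt; apply: eq_bigr => i _; rewrite expr2. Qed.

Lemma enorm_ge0 x : 0 <= enorm x.
Proof. exact: sqrtr_ge0. Qed.

Lemma enorm_sqr x : enorm x ^+ 2 = dot x x.
Proof. by rewrite enormE sqr_sqrtr ?dot_ge0. Qed.

Lemma enorm0 : enorm (0 : 'rV[R]_d) = 0.
Proof. by rewrite enormE dot0l sqrtr0. Qed.

Lemma enorm_eq0 x : enorm x = 0 -> x = 0.
Proof. by move=> x0; apply: dot_eq0; rewrite -enorm_sqr x0 expr0n. Qed.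

Lemma enormZ a x : enorm (a *: x) = `|a| * enorm x.
Proof.
by rewrite !enormE dotZl dotZr mulrA -expr2 sqrtrM ?sqr_ge0 // sqrtr_sqr.
Qed.

Lemma enormN x : enorm (- x) = enorm x.
Proof. by rewrite -scaleN1r enormZ normrN1 mul1r. Qed.

Lemma enorm_sub x y : enorm (x - y) = enorm (y - x).
Proof. by rewrite -enormN opprB. Qed.

Lemma enormD_sqr x y :
  enorm (x + y) ^+ 2 = enorm x ^+ 2 + 2 * dot x y + enorm y ^+ 2.
Proof. by rewrite !enorm_sqr dotDl !dotDr (dotC y x); ring. Qed.

Lemma dot_le_enorm x y : dot x y <= enorm x * enorm y.
Proof.
have [y0|y0] := eqVneq (enorm y) 0.
  by rewrite (enorm_eq0 y0) dot0r enorm0 mulr0.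
have [x0|x0] := eqVneq (enorm x) 0.
  by rewrite (enorm_eq0 x0) dot0l enorm0 mul0r.
have {}x0 : 0 < enorm x by rewrite lt_neqAle eq_sym x0 enorm_ge0.
have {}y0 : 0 < enorm y by rewrite lt_neqAle eq_sym y0 enorm_ge0.
have := dot_ge0 (enorm y *: x - enorm x *: y).
rewrite dotBl !dotBr !dotZl !dotZr (dotC y x) -!enorm_sqr => h.
have {}h : 0 <= 2 * (enorm x * enorm y) * (enorm x * enorm y - dot x y).
  by apply: le_trans h _; rewrite le_eqVlt; apply/orP; left; apply/eqP; ring.
by rewrite -subr_ge0 -(pmulr_rge0 (x := 2 * (enorm x * enorm y))) // !mulr_gt0.
Qed.

Lemma normr_dot x y : `|dot x y| <= enorm x * enorm y.
Proof.
rewrite ler_norml dot_le_enorm andbT lerNl -dotNl -(enormN x).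
exact: dot_le_enorm.
Qed.

Lemma enormD x y : enorm (x + y) <= enorm x + enorm y.
Proof.
rewrite -(@ler_pXn2r _ 2) ?nnegrE ?addr_ge0 ?enorm_ge0 //.
rewrite enormD_sqr sqrrD lerD2r lerD2l.
by have := dot_le_enorm x y; lra.
Qed.

Lemma enormB x y : enorm (x - y) <= enorm x + enorm y.
Proof. by rewrite -(enormN y) enormD. Qed.

(** Reduces norm estimates of vector-valued expansions to scalar functions, to which the mean value
    theorem applies. The sign of [c] settles [x = 0], in particular in dimension 0, where there is
    no unit vector. *)
Lemma enorm_dual x c : 0 <= c ->
  (forall e, enorm e = 1 -> dot e x <= c) -> enorm x <= c.
Proof.
move=> c0 h; have [x0|x0] := eqVneq (enorm x) 0; first by rewrite x0.
have := h ((enorm x)^-1 *: x); rewrite enormZ ger0_norm ?invr_ge0 ?enorm_ge0 //.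
rewrite mulVf // => /(_ erefl); rewrite dotZl -enorm_sqr expr2 mulKf //.
Qed.

Lemma normr_coord x i : `|x 0 i| <= enorm x.
Proof.
rewrite -dot_delta (le_trans (normr_dot _ _)) // ler_piMr ?enorm_ge0 //.
by rewrite enormE dot_delta mxE !eqxx sqrtr1.
Qed.

Lemma enorm_le_sum x : enorm x <= \sum_(i < d) `|x 0 i|.
Proof.
rewrite -(@ler_pXn2r _ 2) ?nnegrE ?enorm_ge0 ?sumr_ge0 // enorm_sqr expr2.
rewrite big_distrl /=; apply: ler_sum => i _.
rewrite -expr2 -real_normK ?num_real // expr2 ler_wpM2l //.
by rewrite (bigD1 i) //= lerDl sumr_ge0.
Qed.

Lemma enorm_le_norm x : enorm x <= d%:R * `|x|.
Proof.
apply: le_trans (enorm_le_sum x) _.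
rewrite -[d in d%:R]card_ord mulr_natl -sumr_const; apply: ler_sum => i _.
rewrite [leRHS]mx_normrE.
exact: (le_bigmax _ (fun i : 'I_1 * 'I_d => `|x i.1 i.2|) (0, i)).
Qed.

Lemma norm_le_enorm x : `|x| <= enorm x.
Proof.
rewrite [leLHS]mx_normrE.
by apply: bigmax_le => [|[i j] _]; rewrite ?enorm_ge0 //= ord1 normr_coord.
Qed.

End euclidean.

(** * Continuity and compactness for the Euclidean norm *)

Section topology.
Context (R : realType) (d : nat).
Implicit Types (x y h e u v : 'rV[R]_d) (M : 'M[R]_d).

(** Continuity refers to the sup norm, which the Euclidean norm exceeds at most by the factor [d].
    The absolute value and the added 1 keep the radius positive for every [C] and [d]. *)
Lemma lipschitz_cts (g : 'rV[R]_d -> R) (C : R) :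
  (forall x y, `|g x - g y| <= C * enorm (x - y)) -> continuous g.
Proof.
move=> gC x A /nbhs_ballP[eps /= eps0 epsA].
have C1 : 0 < `|C| * d%:R + 1 by rewrite ltr_wpDl // mulr_ge0.
apply/nbhs_ballP; exists (eps / (`|C| * d%:R + 1)); first exact: divr_gt0.
move=> y; rewrite -ball_normE /= ltr_pdivlMr // mulrC => xy.
apply: epsA; rewrite -ball_normE /=; apply: le_lt_trans (gC x y) _.
apply: le_lt_trans xy; rewrite mulrDl mul1r ler_wpDr // -mulrA.
apply: le_trans (_ : `|C| * enorm (x - y) <= _).
  by rewrite ler_wpM2r ?enorm_ge0 ?ler_norm.
by rewrite ler_wpM2l ?enorm_le_norm.
Qed.

Lemma enorm_cts : continuous (@enorm R d).
Proof.
apply: (lipschitz_cts (C := 1)) => x y; rewrite mul1r ler_norml.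
have := enormD (x - y) y; have := enormD (y - x) x.
by rewrite !subrK (enorm_sub y) => xy yx; apply/andP; split; lra.
Qed.

Lemma dot_cts e : continuous (dot e).
Proof.
apply: (lipschitz_cts (C := enorm e)) => x y.
by rewrite -dotBr normr_dot.
Qed.

Lemma quadratic_cts M : continuous (fun v => dot (v *m M) v).
Proof.
move=> v; rewrite /dot.
have /(_ v) : continuous (\sum_(i < d) (fun v : 'rV[R]_d => (v *m M) 0 i * v 0 i)).
  apply: (@big_ind _ (fun g : 'rV[R]_d -> R => continuous g)).
  - by move=> ?; exact: cst_continuous.
  - by move=> f g cf cg x; apply: continuousD; [exact: cf|exact: cg].
  - move=> i _ x; apply: continuousM; last exact: coord_continuous.
    have -> : (fun v : 'rV[R]_d => (v *m M) 0 i) = dot (col i M)^T.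
      apply/funext => w; rewrite mxE; apply: eq_bigr => j _.
      by rewrite !mxE mulrC.
    exact: dot_cts.
by congr continuous_at; apply/funext => w; rewrite fct_sumE.
Qed.

Lemma unit_sphere_compact : compact [set v : 'rV[R]_d | enorm v = 1].
Proof.
apply: bounded_closed_compact.
  exists 1; split => // M M1 v /= v1.
  by rewrite (le_trans (norm_le_enorm v)) // v1 ltW.
apply: (@preimage_closed _ _ (@enorm R d) [set a | a = 1]).
  by move=> x _; exact: enorm_cts.
exact: closed_eq.
Qed.

End topology.

Section spectral_norm.
Context (R : realType) (d : nat).
Implicit Types (x y h e u v : 'rV[R]_d) (M : 'M[R]_d).

(** The supremum in [spectral_norm] dominates the elements of its set only once that set is known to
    be bounded above. *)
Lemma mulmx_enorm_bounded M :
  exists C, forall v, enorm v = 1 -> enorm (v *m M) <= C.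
Proof.
exists (\sum_(i < d) enorm (col i M)^T) => v v1.
apply: le_trans (enorm_le_sum _) _; apply: ler_sum => i _.
have -> : (v *m M) 0 i = dot v (col i M)^T.
  by rewrite mxE; apply: eq_bigr => j _; rewrite !mxE.
by rewrite (le_trans (normr_dot _ _)) // v1 mul1r.
Qed.

Lemma spectral_norm_bound M v : enorm (v *m M) <= spectral_norm M * enorm v.
Proof.
have [v0|v0] := eqVneq (enorm v) 0.
  by rewrite (enorm_eq0 v0) mul0mx enorm0 mulr0.
have vp : 0 < enorm v by rewrite lt_neqAle eq_sym v0 enorm_ge0.
rewrite -ler_pdivrMr // mulrC.
have -> : (enorm v)^-1 * enorm (v *m M) = enorm (((enorm v)^-1 *: v) *m M).
  by rewrite -scalemxAl enormZ ger0_norm ?invr_ge0 ?enorm_ge0.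
have u1 : enorm ((enorm v)^-1 *: v) = 1.
  by rewrite enormZ ger0_norm ?invr_ge0 ?enorm_ge0 // mulVf.
apply: ub_le_sup; last by exists ((enorm v)^-1 *: v).
have [C CM] := mulmx_enorm_bounded M.
by exists C => _ [w /= w1 <-]; exact: CM.
Qed.

End spectral_norm.

(** * Taylor expansions *)

Section line_derivative.
Context (R : realType) (d : nat).
Implicit Types (x y h e u v : 'rV[R]_d).

Lemma is_derive_pow (n : nat) (t : R) :
  is_derive t 1 (fun t : R => t ^+ n) (n%:R * t ^+ n.-1).
Proof.
have := @is_deriveX _ _ id n t 1 1 (is_derive_id _ _).
by rewrite exprfctE /GRing.scale/= mulr1.
Qed.

Lemma is_derive_mull (a t : R) : is_derive t 1 (fun t : R => a * t) a.
Proof.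
have := @is_deriveZ _ _ _ id a t 1 1 (is_derive_id _ _).
by rewrite /GRing.scale/= mulr1.
Qed.

(** By the mean value theorem applied to [phi] minus the monomial whose derivative is the given
    bound. The cases n = 0, 1, 2 yield all Taylor estimates below. *)
Lemma derive_comparison (phi dphi : R -> R) (c : R) (n : nat) :
  (forall t : R, is_derive t 1 phi (dphi t)) ->
  (forall t : R, 0 <= t <= 1 -> dphi t <= c * t ^+ n) ->
  phi 1 <= phi 0 + c / n.+1%:R.
Proof.
move=> dphiP dphi_le.
pose chi := phi - (c / n.+1%:R) *: (fun t : R => t ^+ n.+1).
have dchi (t : R) : is_derive t 1 chi (dphi t - (c / n.+1%:R) *: (n.+1%:R * t ^+ n)).
  apply: is_deriveB; apply: is_deriveZ.
  exact: (is_derive_pow n.+1 t).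
have chi_cts : {within `[0, 1], continuous chi}.
  apply: continuous_subspaceT => t; apply: differentiable_continuous.
  by apply/derivable1_diffP; exact: ex_derive.
have [t t01] := MVT ltr01 (fun t _ => dchi t) chi_cts.
have n0 : n.+1%:R != 0 :> R by rewrite pnatr_eq0.
rewrite subr0 mulr1 {1 2}/chi /= => chiE.
have : dphi t <= c * t ^+ n.
  by apply: dphi_le; move: t01; rewrite in_itv/= => /andP[/ltW -> /ltW ->].
have -> : c * t ^+ n = c / n.+1%:R *: (n.+1%:R * t ^+ n).
  by rewrite /GRing.scale/= mulrA divfK.
rewrite -subr_le0 -chiE !fctE expr1n expr0n /= !scaler0 subr0 => le0.
by rewrite -subr_le0 opprD addrA addrAC; move: le0; rewrite /GRing.scale/= mulr1.
Qed.

Lemma is_derive_line (W : normedModType R) (f : 'rV[R]_d -> W) x h (t : R) :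
  differentiable f (x + t *: h) ->
  is_derive t 1 (fun s => f (x + s *: h)) ('D_h f (x + t *: h)).
Proof.
move=> dfx; have fh : derivable f (x + t *: h) h by exact: diff_derivable.
have E : (fun s : R => s^-1 *: (f (s *: h + (x + t *: h)) - f (x + t *: h))) =
  (fun s => s^-1 *: (f (x + (s *: 1 + t) *: h) - f (x + t *: h))).
  apply/funext => s; congr (_ *: (f _ - _)).
  by rewrite [_%:A]mulr1 scalerDl addrCA.
apply: DeriveDef; rewrite /derivable /derive /=.
  by rewrite -E; exact: fh.
by rewrite -E.
Qed.

Lemma derive_grad (f : 'rV[R]_d -> R) x h : differentiable f x ->
  'D_h f x = dot h (grad f x).
Proof.
move=> df; rewrite deriveE // {1}[h]row_sum_delta raddf_sum /=.
by apply: eq_bigr => i _; rewrite linearZ /= mxE deriveE.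
Qed.

Lemma is_derive_grad (f : 'rV[R]_d -> R) x h (t : R) :
  (forall y, differentiable f y) ->
  is_derive t 1 (fun s => f (x + s *: h)) (dot h (grad f (x + t *: h))).
Proof. by move=> df; rewrite -derive_grad //; exact: is_derive_line. Qed.

Lemma is_derive_dot (g : R -> 'rV[R]_d) e (t : R) (dg : 'rV[R]_d) :
  is_derive t 1 g dg -> is_derive t 1 (fun s => dot e (g s)) (dot e dg).
Proof.
move=> [gt <-].
have E : (fun s : R => s^-1 *: (dot e (g (s *: 1 + t)) - dot e (g t))) =
  dot e \o (fun s => s^-1 *: (g (s *: 1 + t) - g t)).
  by apply/funext => s /=; rewrite dotZr dotBr.
have C : (dot e \o (fun s => s^-1 *: (g (s *: 1 + t) - g t))) @ 0^' -->
    dot e ('D_1 g t).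
  by apply: continuous_cvg => //; exact: dot_cts.
apply: DeriveDef; rewrite /derivable /derive /= E.
  by apply/cvg_ex; exists (dot e ('D_1 g t)).
exact: cvg_lim C.
Qed.

Lemma is_derive_hessian (f : 'rV[R]_d -> R) e x h (t : R) :
  (forall y, differentiable (grad f) y) ->
  is_derive t 1 (fun s => dot e (grad f (x + s *: h)))
    (dot e (h *m hessian f (x + t *: h))).
Proof.
move=> dg; apply: is_derive_dot.
by have := is_derive_line (dg (x + t *: h)); rewrite deriveEjacobian.
Qed.

End line_derivative.

Section taylor.
Context (R : realType) (d : nat) (rho : R) (f : 'rV[R]_d -> R).
Hypothesis df : forall x, differentiable f x.
Hypothesis dg : forall x, differentiable (grad f) x.
Hypothesis hess_lip : forall x x',
  spectral_norm (hessian f x - hessian f x') <= rho * enorm (x - x').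
Hypothesis rho_ge0 : 0 <= rho.
Implicit Types (x y h e u v : 'rV[R]_d).

Lemma hessian_dot_le e h x y :
  dot e (h *m (hessian f x - hessian f y)) <=
  rho * enorm (x - y) * enorm h * enorm e.
Proof.
apply: le_trans (dot_le_enorm _ _) _; rewrite mulrC ler_wpM2r ?enorm_ge0 //.
apply: le_trans (spectral_norm_bound _ _) _.
by rewrite ler_wpM2r ?enorm_ge0.
Qed.

(** The segment from [y] to [y'] stays within [r] of [x], so the Hessian along it differs from that
    at [x] by at most [rho * r]. Unlike an expansion at [y], this compares two points with the
    Hessian at a third one, as coupled runs require. *)
Lemma grad_secant x y y' (r : R) :
  enorm (y - x) <= r -> enorm (y' - x) <= r ->
  enorm (grad f y' - grad f y - (y' - y) *m hessian f x) <=
    rho * r * enorm (y' - y).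
Proof.
move=> yr y'r; have r0 : 0 <= r by exact: le_trans (enorm_ge0 _) yr.
apply: enorm_dual => [|e e1]; first by rewrite !mulr_ge0 ?enorm_ge0.
pose phi (t : R) := dot e (grad f (y + t *: (y' - y))) +
  (- dot e ((y' - y) *m hessian f x)) * t.
pose dphi (t : R) := dot e ((y' - y) *m hessian f (y + t *: (y' - y))) +
  (- dot e ((y' - y) *m hessian f x)).
have := @derive_comparison _ phi dphi (rho * r * enorm (y' - y)) 0.
have dphiP (t : R) : is_derive t 1 phi (dphi t).
  apply: is_deriveD; first exact: is_derive_hessian.
  exact: is_derive_mull.
move=> /(_ dphiP) H.
have {H} : phi 1 <= phi 0 + rho * r * enorm (y' - y) / 1.
  apply: H => t /andP[t0 t1]; rewrite expr0 mulr1 /dphi -dotBr -mulmxBr.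
  apply: le_trans (hessian_dot_le _ _ _ _) _.
  rewrite e1 mulr1 ler_wpM2r ?enorm_ge0 // ler_wpM2l //.
  have -> : y + t *: (y' - y) - x = (1 - t) *: (y - x) + t *: (y' - x).
    by apply/rowP => i; rewrite !mxE; ring.
  apply: le_trans (enormD _ _) _; rewrite !enormZ (ger0_norm t0).
  rewrite ger0_norm ?subr_ge0 //.
  have : (1 - t) * enorm (y - x) <= (1 - t) * r by rewrite ler_wpM2l // subr_ge0.
  have : t * enorm (y' - x) <= t * r by rewrite ler_wpM2l.
  by lra.
rewrite /phi scale1r scale0r addr0 (addrC y (y' - y)) subrK mulr0 addr0 mulr1 divr1.
by rewrite !dotBr; lra.
Qed.

Lemma grad_taylor x h :
  enorm (grad f (x + h) - grad f x - h *m hessian f x) <= rho / 2 * enorm h ^+ 2.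
Proof.
apply: enorm_dual => [|e e1]; first by rewrite !mulr_ge0 ?enorm_ge0.
pose phi (t : R) := dot e (grad f (x + t *: h)) +
  (- dot e (h *m hessian f x)) * t.
pose dphi (t : R) := dot e (h *m hessian f (x + t *: h)) +
  (- dot e (h *m hessian f x)).
have dphiP (t : R) : is_derive t 1 phi (dphi t).
  apply: is_deriveD; first exact: is_derive_hessian.
  exact: is_derive_mull.
have : phi 1 <= phi 0 + rho * enorm h ^+ 2 / 2.
  apply: (derive_comparison (n := 1) dphiP) => t /andP[t0 t1].
  rewrite /dphi -dotBr -mulmxBr.
  apply: le_trans (hessian_dot_le _ _ _ _) _.
  by rewrite e1 mulr1 addrAC subrr add0r enormZ ger0_norm //; lra.
rewrite /phi scale1r scale0r addr0 mulr0 addr0 mulr1.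
by rewrite !dotBr; lra.
Qed.

Lemma taylor x h :
  f (x + h) <= f x + dot (grad f x) h + 1 / 2 * dot (h *m hessian f x) h +
    rho / 6 * enorm h ^+ 3.
Proof.
pose phi (t : R) := f (x + t *: h) + (- dot (grad f x) h) * t +
   (- (1 / 2) * dot (h *m hessian f x) h) * t ^+ 2.
pose dphi (t : R) := dot h (grad f (x + t *: h)) - dot (grad f x) h -
   t * dot (h *m hessian f x) h.
have dphiP (t : R) : is_derive t 1 phi (dphi t).
  rewrite /dphi; apply: is_deriveD.
    apply: is_deriveD; first exact: is_derive_grad.
    exact: is_derive_mull.
  have := is_deriveZ (- (1 / 2) * dot (h *m hessian f x) h) (is_derive_pow 2 t).
  by move/is_derive_eq; apply; rewrite /GRing.scale/= expr1; lra.
have : phi 1 <= phi 0 + rho / 2 * enorm h ^+ 3 / 3.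
  apply: (derive_comparison (n := 2) dphiP) => t /andP[t0 t1].
  have := grad_taylor x (t *: h).
  rewrite enormZ ger0_norm // => G.
  have -> : dphi t = dot h (grad f (x + t *: h) - grad f x - (t *: h) *m hessian f x).
    by rewrite /dphi !dotBr -scalemxAl dotZr (dotC _ h) (dotC _ h).
  apply: le_trans (dot_le_enorm _ _) _.
  by have := ler_wpM2l (enorm_ge0 h) G; lra.
rewrite /phi scale1r scale0r addr0 mulr0 expr0n /= mulr0 !addr0 expr1n !mulr1.
by lra.
Qed.

(** Schwarz's theorem by second differences: [Df s u v] is symmetric in [u] and [v], and the
    Lipschitz Hessian makes it equal to [s ^+ 2] times the bilinear form up to an error of order
    [s ^+ 3]. *)
Lemma hessian_sym x : (hessian f x)^T = hessian f x.
Proof.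
have key u v : dot u (v *m hessian f x) <= dot v (u *m hessian f x).
  pose r := enorm u + enorm v.
  have r0 : 0 <= r by rewrite addr_ge0 ?enorm_ge0.
  pose Df (s : R) u v :=
    f (x + s *: u + s *: v) - f (x + s *: u) - f (x + s *: v) + f x.
  have approx (s : R) u' v' : 0 <= s -> enorm u' + enorm v' = r ->
      `|Df s u' v' - s ^+ 2 * dot u' (v' *m hessian f x)| <= rho * r ^+ 3 * s ^+ 3.
    move=> s0 uv.
    have bnd (t : R) : 0 <= t <= 1 ->
        `|dot (s *: u') (grad f (x + s *: v' + t *: (s *: u')) -
             grad f (x + t *: (s *: u'))) - s ^+ 2 * dot u' (v' *m hessian f x)|
          <= rho * r ^+ 3 * s ^+ 3.
      move=> /andP[t0 t1].
      have ru : enorm u' <= r by rewrite -uv lerDl enorm_ge0.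
      have rv : enorm v' <= r by rewrite -uv lerDr enorm_ge0.
      have tu : enorm (t *: (s *: u')) <= s * enorm u'.
        rewrite !enormZ !ger0_norm // mulrA ler_wpM2r ?enorm_ge0 //.
        by rewrite ler_piMl.
      have E1 : x + t *: (s *: u') - x = t *: (s *: u') by rewrite addrAC subrr add0r.
      have E2 : x + s *: v' + t *: (s *: u') - x = s *: v' + t *: (s *: u').
        by apply/rowP => i; rewrite !mxE; ring.
      have E3 : x + s *: v' + t *: (s *: u') - (x + t *: (s *: u')) = s *: v'.
        by apply/rowP => i; rewrite !mxE; ring.
      have := @grad_secant x (x + t *: (s *: u')) (x + s *: v' + t *: (s *: u')) (s * r).
      rewrite E1 E2 E3 => /(_ (le_trans tu (ler_wpM2l s0 ru))) G.
      have {}G : enorm (grad f (x + s *: v' + t *: (s *: u')) -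
           grad f (x + t *: (s *: u')) - (s *: v') *m hessian f x) <=
           rho * (s * r) * enorm (s *: v').
        apply: G; rewrite -uv mulrDr addrC (le_trans (enormD _ _)) // lerD //.
        by rewrite enormZ ger0_norm.
      have -> : s ^+ 2 * dot u' (v' *m hessian f x) =
          dot (s *: u') ((s *: v') *m hessian f x).
        by rewrite dotZl -scalemxAl dotZr; ring.
      rewrite -dotBr; apply: le_trans (normr_dot _ _) _.
      apply: le_trans (ler_wpM2l (enorm_ge0 _) G) _.
      rewrite !enormZ ger0_norm //.
      have -> : rho * r ^+ 3 * s ^+ 3 = s * r * (rho * (s * r) * (s * r)) by ring.
      rewrite ler_pM ?mulr_ge0 ?enorm_ge0 // ?ler_wpM2l ?mulr_ge0 //.
    pose phi (t : R) := f (x + s *: v' + t *: (s *: u')) - f (x + t *: (s *: u')).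
    have dphiP (t : R) : is_derive t 1 phi (dot (s *: u') (grad f (x + s *: v' + t *: (s *: u')) -
             grad f (x + t *: (s *: u')))).
      rewrite dotBr; apply: is_deriveB; exact: is_derive_grad.
    have DfE : Df s u' v' = phi 1 - phi 0.
      by rewrite /Df /phi !scale1r !scale0r !addr0 (addrAC x (s *: v')); ring.
    rewrite DfE ler_norml; apply/andP; split.
      have := @derive_comparison _ (- phi) _ (rho * r ^+ 3 * s ^+ 3 - s ^+ 2 * dot u' (v' *m hessian f x)) 0
       (fun t => is_deriveN (dphiP t)).
      rewrite divr1 !fctE => H.
      suff : - phi 1 <= - phi 0 + (rho * r ^+ 3 * s ^+ 3 - s ^+ 2 * dot u' (v' *m hessian f x)) by lra.
      apply: H => t /bnd; rewrite ler_norml expr0 mulr1 => /andP[+ _]; lra.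
    have := @derive_comparison _ phi _ (rho * r ^+ 3 * s ^+ 3 + s ^+ 2 * dot u' (v' *m hessian f x)) 0 dphiP.
    rewrite divr1 => H.
    suff : phi 1 <= phi 0 + (rho * r ^+ 3 * s ^+ 3 + s ^+ 2 * dot u' (v' *m hessian f x)) by lra.
    apply: H => t /bnd; rewrite ler_norml expr0 mulr1 => /andP[_ +]; lra.
  apply/ler_addgt0Pr => e e0.
  pose s := e / (2 * (rho * r ^+ 3) + 1).
  have q0 : 0 <= 2 * (rho * r ^+ 3) by rewrite !mulr_ge0 ?exprn_ge0.
  have s0 : 0 < s by rewrite divr_gt0 // ltr_wpDl.
  have se : 2 * (rho * r ^+ 3) * s <= e.
    by rewrite /s [leLHS]mulrA ler_pdivrMr ?ltr_wpDl // mulrC ler_wpM2l ?lerDl // ltW.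
  have A1 := approx s u v (ltW s0) erefl.
  have := approx s v u (ltW s0) (addrC _ _).
  have -> : Df s v u = Df s u v by rewrite /Df (addrAC x (s *: v)); ring.
  move: A1; rewrite !ler_norml => /andP[A1 A2] /andP[A3 A4].
  have s20 : 0 < s ^+ 2 by rewrite exprn_gt0.
  rewrite -(ler_pM2l s20).
  have := ler_wpM2l (ltW s20) se.
  by lra.
apply/matrixP => i j; rewrite mxE.
have E k l : dot (delta_mx 0 k) (delta_mx 0 l *m hessian f x) = hessian f x l k.
  by rewrite dotC dot_delta -rowE mxE.
by apply/eqP; rewrite eq_le -!E !key.
Qed.

End taylor.

(** * Spectral theorem and least eigenvalue *)

Section spectral_theorem.
Context (R : realType) (d : nat) (M : 'M[R]_d).
Hypothesis symM : M^T = M.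
Implicit Types (x y e u v w : 'rV[R]_d).

Lemma linear_term_eq0 (a b : R) : (forall t, 0 <= t * a + t ^+ 2 * b) -> a = 0.
Proof.
move=> h; apply/eqP; rewrite -sqrf_eq0 -[_ == 0]negbK; apply/negP => a0.
have a2 : 0 < a ^+ 2 by rewrite lt_neqAle eq_sym a0 sqr_ge0.
have b0 : 0 < `|b| + 1 by rewrite ltr_wpDl.
have := h (- a / (`|b| + 1)).
have -> : - a / (`|b| + 1) * a + (- a / (`|b| + 1)) ^+ 2 * b =
   a ^+ 2 / (`|b| + 1) ^+ 2 * (b - (`|b| + 1)).
  by field; rewrite gt_eqF.
rewrite leNgt pmulr_rlt0; last by rewrite divr_gt0 // exprn_gt0.
by have := ler_norm b; rewrite subr_lt0 => bb; rewrite ltr_pwDr.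
Qed.

(** The Rayleigh quotient attains its minimum on the unit sphere of the orthogonal complement of the
    eigenvectors found so far. This complement is stable under the symmetric [M], so the minimizer
    may be varied along its own residual, which is thereby forced to vanish. *)
Lemma rayleigh_minimizer k (e : nat -> 'rV[R]_d) (l : nat -> R) :
  (k < d)%N -> (forall i, (i < k)%N -> e i *m M = l i *: e i) ->
  exists v, [/\ enorm v = 1, forall i, (i < k)%N -> dot (e i) v = 0,
    v *m M = dot (v *m M) v *: v &
    forall w, (forall i, (i < k)%N -> dot (e i) w = 0) ->
      dot (v *m M) v * dot w w <= dot (w *m M) w].
Proof.
move=> kd eM.
pose V := [set v : 'rV[R]_d | forall i, (i < k)%N -> dot (e i) v = 0].
pose S := [set v : 'rV[R]_d | enorm v = 1] `&` V.
have VZ a v : V v -> V (a *: v) by move=> Vv i ik; rewrite dotZr Vv ?mulr0.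
have norm1 v : v != 0 -> enorm ((enorm v)^-1 *: v) = 1.
  move=> v0; rewrite enormZ ger0_norm ?invr_ge0 ?enorm_ge0 // mulVf //.
  by apply: contraNneq v0 => /enorm_eq0 ->.
(* Fewer than [d] linear conditions have a nonzero solution. *)
have S0 : S !=set0.
  pose A := \matrix_(i < d, j < k) e j 0 i.
  have : kermx A != 0.
    rewrite -mxrank_eq0 mxrank_ker -lt0n subn_gt0.
    exact: leq_ltn_trans (rank_leq_col _) kd.
  have [/eqP A0|[i Ai] _] : kermx A = 0 \/ exists i, row i (kermx A) != 0.
  - have [h|/existsNP[i /eqP h]] := pselect (forall i, row i (kermx A) = 0).
      by left; apply/row_matrixP => i; rewrite h row0.
    by right; exists i.
  - by rewrite A0.
  have vV : V (row i (kermx A)).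
    move=> j jk; have := mulmx_ker A => /matrixP/(_ i (Ordinal jk)).
    rewrite [RHS]mxE => <-; rewrite mxE; apply: eq_bigr => m _.
    by rewrite !mxE mulrC.
  exists ((enorm (row i (kermx A)))^-1 *: row i (kermx A)); split; last exact: VZ.
  exact: norm1.
have cS : compact S.
  apply: subclosed_compact (@unit_sphere_compact R d) _; last by move=> v [].
  apply: closedI; first by apply: compact_closed; [exact: norm_hausdorff|exact: unit_sphere_compact].
  have -> : V = \bigcap_(i in [set i | (i < k)%N]) (dot (e i) @^-1` [set a | a = 0]).
    by apply/seteqP; split => v.
  apply: closed_bigI => i _; apply: preimage_closed; last exact: closed_eq.
  by move=> v _; exact: dot_cts.
have [v vS vmin] := EVT_min_rV S0 cS (continuous_subspaceT (@quadratic_cts R d M)).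
move: vS; rewrite inE => -[/= v1 vV].
have min w : V w -> dot (v *m M) v * dot w w <= dot (w *m M) w.
  move=> wV; have [->|w0] := eqVneq w 0; first by rewrite mul0mx !dot0l mulr0.
  have := vmin ((enorm w)^-1 *: w).
  rewrite inE => /(_ (conj (norm1 _ w0) (VZ _ _ wV))).
  rewrite -scalemxAl dotZl dotZr mulrA -invfM -expr2 enorm_sqr.
  rewrite mulrC -ler_pdivrMr ?invr_gt0 ?invrK // lt_neqAle dot_ge0 andbT eq_sym.
  by apply: contraNneq w0 => /dot_eq0 ->.
exists v; split => //.
have [r rE] : exists r, r = v *m M - dot (v *m M) v *: v by eexists.
have vv : dot v v = 1 by rewrite -enorm_sqr v1 expr1n.
have rV' : V r.
  move=> i ik; rewrite rE dotBr dotZr vV // mulr0 subr0 dotC dot_mulmx symM.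
  by rewrite eM // dotZr dotC vV // mulr0.
(* This is the first variation of the quotient at [v] in the direction [r]. *)
have : 2 * dot r r = 0.
  apply: (@linear_term_eq0 _ (dot (r *m M) r - dot (v *m M) v * dot r r)) => t.
  have Vr : V (v + t *: r) by move=> i ik; rewrite dotDr dotZr vV // rV' // mulr0 addr0.
  have := min _ Vr.
  have rv : dot (r *m M) v = dot (v *m M) r by rewrite dot_mulmx symM dotC.
  have vr : dot v r = 0 by rewrite rE dotBr dotZr vv mulr1 dotC subrr.
  have rr : dot r r = dot (v *m M) r by rewrite {1}rE dotBl dotZl vr mulr0 subr0.
  rewrite mulmxDl -scalemxAl !dotDl !dotDr !dotZl !dotZr rv (dotC r v) vr vv -rr.
  by lra.
move/eqP; rewrite mulf_eq0 pnatr_eq0 /= => /eqP/dot_eq0 r0.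
by move: rE; rewrite r0 => /eqP; rewrite eq_sym subr_eq0 => /eqP.
Qed.

(** Eigenvectors are collected one at a time by minimizing on the complement of the previous ones.
    With row vectors, the coordinates of [x] in the eigenbasis are those of [x *m Q]. *)
Lemma spectral_theorem : exists (Q : 'M[R]_d) (l : 'I_d -> R),
  Q *m Q^T = 1%:M /\ forall x i, (x *m M *m Q) 0 i = l i * (x *m Q) 0 i.
Proof.
have H k : (k <= d)%N -> exists (e : nat -> 'rV[R]_d) (l : nat -> R),
    (forall i j, (i < k)%N -> (j < k)%N -> dot (e i) (e j) = (i == j)%:R) /\
    forall i, (i < k)%N -> e i *m M = l i *: e i.
  elim: k => [_|k IH kd]; first by exists (fun=> 0), (fun=> 0).
  have [e [l [eo eM]]] := IH (ltnW kd).
  have lt_k i : (i < k.+1)%N -> i != k -> (i < k)%N.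
    by rewrite ltnS leq_eqVlt => /orP[->|].
  have [v [v1 ve vM _]] := rayleigh_minimizer kd eM.
  exists (fun i => if i == k then v else e i).
  exists (fun i => if i == k then dot (v *m M) v else l i); split.
    move=> i j ik jk; have [->|ni] := eqVneq i k; have [Ej|nj] := eqVneq j k.
    - by rewrite -enorm_sqr v1 expr1n ?Ej ?eqxx.
    - by rewrite dotC (ve _ (lt_k _ jk nj)) ?(negbTE nj) // eq_sym (negbTE nj).
    - by rewrite (ve _ (lt_k _ ik ni)) // Ej (negbTE ni).
    - by rewrite (eo _ _ (lt_k _ ik ni) (lt_k _ jk nj)).
  move=> i ik; have [//|ni] := eqVneq i k.
  by rewrite (eM _ (lt_k _ ik ni)).
have [e [l [eo eM]]] := H d (leqnn d).
pose Q := \matrix_(i < d, j < d) e j 0 i.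
exists Q, (fun i => l i); split.
  apply: mulmx1C; apply/matrixP => i j; rewrite !mxE.
  transitivity (dot (e i) (e j)); last by rewrite eo.
  by apply: eq_bigr => k _; rewrite !mxE.
have xQ x (i : 'I_d) : (x *m Q) 0 i = dot x (e i).
  by rewrite mxE; apply: eq_bigr => j _; rewrite mxE.
by move=> x i; rewrite !xQ dot_mulmx symM eM // dotZr.
Qed.

Hypothesis d_gt0 : (0 < d)%N.

(** Minimization over the whole sphere: the minimum of the Rayleigh quotient is an eigenvalue and
    bounds every other eigenvalue from below. *)
Lemma lambda_min_attained : exists v, [/\ enorm v = 1, v *m M = lambda_min M *: v &
  forall w, lambda_min M * dot w w <= dot (w *m M) w].
Proof.
have [//|v [v1 _ vM vmin]] := @rayleigh_minimizer 0 (fun=> 0) (fun=> 0) d_gt0.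
suff -> : lambda_min M = dot (v *m M) v.
  by exists v; split => // w; exact: vmin.
have v0 : v != 0 by apply/eqP => v0; move: v1; rewrite v0 enorm0 => /eqP; rewrite eq_sym oner_eq0.
have ev : eigenvalue M (dot (v *m M) v) by apply/eigenvalueP; exists v.
have lb : lbound [set a | eigenvalue M a] (dot (v *m M) v).
  move=> a /= /eigenvalueP[w wM w0]; have := vmin w (fun _ => fun h => False_ind _ (notF h)).
  rewrite wM dotZl ler_pM2r // lt_neqAle dot_ge0 andbT eq_sym.
  by apply: contraNneq w0 => /dot_eq0 ->.
apply/eqP; rewrite eq_le; apply/andP; split.
  by apply: ge_inf => //; exists (dot (v *m M) v).
by apply: lb_le_inf => //; exists (dot (v *m M) v).
Qed.

Lemma lambda_min_geP (c : R) :
  c <= lambda_min M <-> forall v, c * dot v v <= dot (v *m M) v.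
Proof.
have [v [v1 vM vmin]] := lambda_min_attained; split => [cl w|/(_ v)].
  by apply: le_trans (vmin w); rewrite ler_wpM2r ?dot_ge0.
by rewrite vM dotZl -enorm_sqr v1 expr1n !mulr1.
Qed.

End spectral_theorem.

(** * Consequences of a Lipschitz gradient *)

Section gradient_descent_lemma.
Context (R : realType) (d : nat) (L : R) (f : 'rV[R]_d -> R).
Hypothesis df : forall x, differentiable f x.
Hypothesis g_lip : forall x x', enorm (grad f x - grad f x') <= L * enorm (x - x').

Lemma descent_lemma x h :
  f (x + h) <= f x + dot (grad f x) h + L / 2 * enorm h ^+ 2.
Proof.
pose phi (t : R) := f (x + t *: h) + (- dot (grad f x) h) * t.
have dphiP (t : R) : is_derive t 1 phi (dot h (grad f (x + t *: h)) - dot (grad f x) h).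
  apply: is_deriveD; first exact: is_derive_grad.
  exact: is_derive_mull.
have : phi 1 <= phi 0 + L * enorm h ^+ 2 / 2.
  apply: (derive_comparison (n := 1) dphiP) => t /andP[t0 t1].
  rewrite (dotC _ h) -dotBr; apply: le_trans (dot_le_enorm _ _) _.
  have := ler_wpM2l (enorm_ge0 h) (g_lip (x + t *: h) x).
  by rewrite addrAC subrr add0r enormZ ger0_norm //; lra.
rewrite /phi scale1r scale0r addr0 mulr0 addr0 mulr1.
by lra.
Qed.

(** The Hessian is a limit of difference quotients of the gradient, each bounded by L; the length
    [t] makes the Taylor remainder at most [t * e]. *)
Lemma hessian_enorm_le (rho : R) x h : 0 <= rho ->
  (forall x, differentiable (grad f) x) ->
  (forall x x',
    spectral_norm (hessian f x - hessian f x') <= rho * enorm (x - x')) ->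
  enorm (h *m hessian f x) <= L * enorm h.
Proof.
move=> rho0 dg hess_lip.
have [->|h0] := eqVneq h 0; first by rewrite mul0mx enorm0 mulr0.
have L0 : 0 <= L.
  have := g_lip h 0; rewrite subr0 => /(le_trans (enorm_ge0 _)).
  rewrite pmulr_lge0 // lt_neqAle enorm_ge0 andbT eq_sym.
  by apply: contraNneq h0 => /enorm_eq0 ->.
apply/ler_addgt0Pr => e e0.
pose c := rho / 2 * enorm h ^+ 2.
have c0 : 0 <= c by rewrite mulr_ge0 ?divr_ge0 ?exprn_ge0 ?enorm_ge0.
have c1 : 0 < c + 1 by rewrite ltr_wpDl.
pose t := e / (c + 1).
have t0 : 0 < t by rewrite divr_gt0.
have tc : t * c <= e by rewrite /t mulrAC ler_pdivrMr // ler_wpM2l ?lerDl // ltW.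
have := grad_taylor dg hess_lip rho0 x (t *: h).
set r := _ - _ => rle.
have E : t *: (h *m hessian f x) = grad f (x + t *: h) - grad f x - r.
  by rewrite /r opprB addrC subrK scalemxAl.
have := g_lip (x + t *: h) x; rewrite addrAC subrr add0r => gle.
have : t * enorm (h *m hessian f x) <= t * (L * enorm h + e).
  rewrite -[leLHS](_ : enorm (t *: (h *m hessian f x)) = _); last first.
    by rewrite enormZ gtr0_norm.
  rewrite E; apply: le_trans (enormB _ _) _; apply: le_trans (lerD gle rle) _.
  rewrite enormZ gtr0_norm // mulrDr exprMn mulrCA lerD2l.
  have -> : rho / 2 * (t ^+ 2 * enorm h ^+ 2) = t * (t * c) by rewrite /c; ring.
  by rewrite ler_pM2l.
by rewrite ler_pM2l.
Qed.

End gradient_descent_lemma.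

(** * Potential of the quadratic model *)

Section scalar_potential.
Context (R : realType).
Implicit Types (eta lam b x r s xi y : R).

Definition smoothing eta lam (n : nat) : R :=
  if 0 < lam then (1 - eta / 2 * lam) ^+ n else 1.

Definition shift_coef eta lam (n : nat) : R :=
  if 0 < lam then eta / 2 * \sum_(i < n) (1 - eta / 2 * lam) ^+ i else 0.

(* Where gradient descent with step size [eta / 2] on [b * y + lam / 2 * y ^+ 2]
   would bring [x] in [n] steps if the quadratic is convex; [x] itself otherwise. *)
Definition predicted eta lam b (n : nat) x : R :=
  smoothing eta lam n * x - shift_coef eta lam n * b.

Definition energy lam b s y : R := b * y + lam / 2 * y ^+ 2 + s * y ^+ 2.

(** A geometric sum without division. It makes the gradient of the model at the predicted point
    equal to the smoothing factor times the gradient at the current point. *)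
Lemma geometric_shift h lam (N : nat) :
  lam * (h * \sum_(i < N) (1 - h * lam) ^+ i) = 1 - (1 - h * lam) ^+ N.
Proof.
elim: N => [|N IH]; first by rewrite big_ord0 !mulr0 expr0 subrr.
by rewrite big_ord_recr /= !mulrDr IH exprSr; ring.
Qed.

(** From the Bernoulli-type bound [(1 - y) ^+ N * (1 + N%:R * y) <= 1]. *)
Lemma pow_decay y (N : nat) : 0 <= y <= 1 -> y * (1 - y) ^+ N <= N.+1%:R^-1.
Proof.
move=> /andP[y0 y1].
have bern : (1 - y) ^+ N * (1 + N%:R * y) <= 1.
  elim: N => [|N IH]; first by rewrite expr0 mul0r addr0 mulr1.
  apply: le_trans IH; rewrite exprSr -mulrA ler_wpM2l ?exprn_ge0 ?subr_ge0 //.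
  rewrite -natr1; have : 0 <= (N%:R + 1) * y ^+ 2 by rewrite mulr_ge0 ?addr_ge0 ?sqr_ge0.
  by lra.
rewrite -[leRHS]mul1r ler_pdivlMr //.
apply: le_trans bern; rewrite mulrC mulrA [leRHS]mulrC ler_wpM2r ?exprn_ge0 ?subr_ge0 //.
by rewrite -natr1; lra.
Qed.

Lemma smoothing_bounds eta lam n :
  0 < eta -> eta * lam <= 1 -> 0 <= smoothing eta lam n <= 1.
Proof.
move=> eta0 le1; rewrite /smoothing; case: ifP => [lam0|_]; last by rewrite ler01 lexx.
have : 0 < eta * lam by rewrite mulr_gt0.
move=> el0; rewrite exprn_ge0 ?exprn_ile1 //; lra.
Qed.

(** The curvature-free noise estimate: a strong curvature amplifies the noise but also damps it
    faster. For [lam <= 0] the left side is nonpositive. Summed over n, the right side produces the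
    logarithm of the step size bound. *)
Lemma smoothing_noise eta lam n : 0 < eta -> eta * lam <= 1 ->
  lam / 2 * smoothing eta lam n ^+ 2 <= (eta * n.+1%:R)^-1.
Proof.
move=> eta0 le1; rewrite /smoothing; case: ifPn => [lam0|]; last first.
  rewrite -leNgt => lam0; rewrite expr1n mulr1; apply: le_trans (_ : 0 <= _).
    by lra.
  by rewrite invr_ge0 mulr_ge0 // ltW.
have el0 : 0 < eta * lam by rewrite mulr_gt0.
have := @pow_decay (eta / 2 * lam) (n * 2); rewrite exprM => H.
have {}H : eta / 2 * lam * ((1 - eta / 2 * lam) ^+ n) ^+ 2 <= n.+1%:R^-1.
  apply: le_trans (H _) _; first by lra.
  by rewrite lef_pV2 ?posrE // ler_nat ltnS leq_pmulr.
rewrite invfM ler_pdivlMl //; apply: le_trans H.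
by rewrite !mulrA (mulrAC eta).
Qed.

(** Drift of the energy along one noiseless step, divided by eta: [om] is eta * lam, [ta] is eta
    times the new penalty weight, [P] the smoothed gradient, [S] the weight times the predicted
    point, [u] the smoothed Taylor remainder. The prediction has used half of the step, so the
    displacement is [P / 2 + u]. The main part, minus (P^2 / 2 + P * S + 2 * S^2), is negative
    definite and pays for the perturbations and for the squared term kept for exponential
    moments. *)
Lemma dissipation_convex (om ta P S u : R) :
  0 <= om <= 1 / 64 -> 0 <= ta <= 1 / 64 ->
  forall y, y = P / 2 + u ->
  - ((1 - om / 2) * P) * y + om / 2 * y ^+ 2 - 2 * S * y + ta * y ^+ 2 -
    2 * S ^+ 2 +
  ((1 - om / 2) * P - om * y + 2 * S - 2 * ta * y) ^+ 2 / 64 <= 10 * u ^+ 2.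
Proof.
move=> /andP[om0 om1] /andP[ta0 ta1] y yE.
have y2 : y ^+ 2 <= P ^+ 2 / 2 + 2 * u ^+ 2.
  by rewrite -subr_ge0 [leRHS](_ : _ = (P / 2 - u) ^+ 2) ?sqr_ge0 // yE; field.
have y0 := sqr_ge0 y.
have H1 : (om / 2 + ta) * y ^+ 2 <= 3 / 128 * y ^+ 2.
  by rewrite ler_wpM2r //; lra.
have H2 : ((1 - om / 2) * P - om * y + 2 * S - 2 * ta * y) ^+ 2 <=
    3 * (P ^+ 2 + 4 * S ^+ 2 + (om + 2 * ta) ^+ 2 * y ^+ 2).
  apply: le_trans (_ : 3 * (((1 - om / 2) * P) ^+ 2 + (2 * S) ^+ 2 + ((om + 2 * ta) * y) ^+ 2) <= _).
    set a := (1 - om / 2) * P; set c := 2 * S; set e := (om + 2 * ta) * y.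
    have -> : a - om * y + c - 2 * ta * y = a + c - e by rewrite /e; ring.
    have := sqr_ge0 (a - c); have := sqr_ge0 (a + e); have := sqr_ge0 (c + e).
    by lra.
  have : ((1 - om / 2) * P) ^+ 2 <= P ^+ 2.
    rewrite exprMn ler_piMl ?sqr_ge0 // exprn_ile1; lra.
  by rewrite !exprMn; lra.
have H3 : (om + 2 * ta) ^+ 2 * y ^+ 2 <= 1 / 64 * y ^+ 2.
  rewrite ler_wpM2r //.
  have -> : 1 / 64 = (1 / 8) ^+ 2 :> R by field.
  by rewrite ler_pXn2r ?nnegrE //; lra.
have H4 : - ((1 - om / 2) * P) * u <= P ^+ 2 / 16 + 4 * u ^+ 2.
  have a1 : `|1 - om / 2| <= 1 by rewrite ler_norml; apply/andP; split; lra.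
  apply: le_trans (ler_norm _) _; rewrite normrM normrN normrM.
  apply: le_trans (_ : `|P| * `|u| <= _).
    by rewrite ler_wpM2r // ler_piMl.
  have := sqr_ge0 (`|P| / 4 - 2 * `|u|).
  have := real_normK (num_real P); have := real_normK (num_real u).
  by lra.
have H5 : - 2 * S * u <= S ^+ 2 / 4 + 4 * u ^+ 2.
  by have := sqr_ge0 (S / 2 + 2 * u); lra.
have H6 : om * P ^+ 2 <= 1 / 64 * P ^+ 2 by rewrite ler_wpM2r ?sqr_ge0.
have H7 := sqr_ge0 (P / 2 + S); have H8 := sqr_ge0 P; have H9 := sqr_ge0 S.
have H10 := sqr_ge0 u.
have E : - ((1 - om / 2) * P) * y = - (P ^+ 2 / 2) + om * P ^+ 2 / 4 +
   - ((1 - om / 2) * P) * u by rewrite yE; field.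
have E2 : 2 * S * y = P * S + 2 * S * u by rewrite yE; field.
rewrite E E2; lra.
Qed.

(** Same computation without prediction: the displacement is the full [P + u], and the main part is
    minus ((P + S)^2 + S^2). *)
Lemma dissipation_concave (om ta P S u : R) :
  - (1 / 64) <= om <= 0 -> 0 <= ta <= 1 / 64 ->
  forall y, y = P + u ->
  - P * y + om / 2 * y ^+ 2 - 2 * S * y + ta * y ^+ 2 -
    2 * S ^+ 2 +
  (P - om * y + 2 * S - 2 * ta * y) ^+ 2 / 64 <= 10 * u ^+ 2.
Proof.
move=> /andP[om0 om1] /andP[ta0 ta1] y yE.
have y2 : y ^+ 2 <= 2 * P ^+ 2 + 2 * u ^+ 2.
  by rewrite -subr_ge0 [leRHS](_ : _ = (P - u) ^+ 2) ?sqr_ge0 // yE; field.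
have y0 := sqr_ge0 y.
have H1 : (om / 2 + ta) * y ^+ 2 <= 1 / 64 * y ^+ 2.
  by rewrite ler_wpM2r //; lra.
have H2 : (P - om * y + 2 * S - 2 * ta * y) ^+ 2 <=
    3 * (P ^+ 2 + 4 * S ^+ 2 + (om + 2 * ta) ^+ 2 * y ^+ 2).
  apply: le_trans (_ : 3 * (P ^+ 2 + (2 * S) ^+ 2 + ((om + 2 * ta) * y) ^+ 2) <= _).
    set c := 2 * S; set e := (om + 2 * ta) * y.
    have -> : P - om * y + c - 2 * ta * y = P + c - e by rewrite /e; ring.
    have := sqr_ge0 (P - c); have := sqr_ge0 (P + e); have := sqr_ge0 (c + e).
    by lra.
  by rewrite !exprMn; lra.
have H3 : (om + 2 * ta) ^+ 2 * y ^+ 2 <= 1 / 64 * y ^+ 2.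
  rewrite ler_wpM2r //.
  have -> : 1 / 64 = (1 / 8) ^+ 2 :> R by field.
  by rewrite -ler_sqrt ?exprn_gt0 // !sqrtr_sqr ler_norml ger0_norm; lra.
have H4 : - P * u <= P ^+ 2 / 16 + 4 * u ^+ 2.
  by have := sqr_ge0 (P / 4 + 2 * u); lra.
have H5 : - 2 * S * u <= S ^+ 2 / 4 + 4 * u ^+ 2.
  by have := sqr_ge0 (S / 2 + 2 * u); lra.
have H7 := sqr_ge0 (P + S); have H8 := sqr_ge0 P; have H9 := sqr_ge0 S.
have H10 := sqr_ge0 u.
have H11 := sqr_ge0 (3 / 4 * P + 4 / 3 * S).
have E : - P * y = - P ^+ 2 + - P * u by rewrite yE; ring.
have E2 : 2 * S * y = 2 * (P * S) + 2 * S * u by rewrite yE; field.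
rewrite E E2; lra.
Qed.

(** The number [q] is the smoothed derivative of the energy at the new predicted point without
    noise. The term in [q ^+ 2] is a reserve: it later absorbs the quadratic cost of exponentiating
    the linear noise term. The decrease from [s] to [s'] supplies the term [2 * S ^+ 2] of the
    dissipation inequalities. *)
Lemma energy_step eta lam b x r s s' (n : nat) :
  0 < eta -> - (1 / 64) <= eta * lam <= 1 / 64 -> 0 <= eta * s' <= 1 / 64 ->
  s' + 2 * eta * s' ^+ 2 <= s ->
  exists q : R, forall xi,
    energy lam b s' (predicted eta lam b n (x - eta * (lam * x + b + r + xi))) <=
    energy lam b s (predicted eta lam b n.+1 x) + 10 * eta * r ^+ 2 -
    eta / 64 * q ^+ 2 - eta * (q * xi) +
    eta ^+ 2 * ((eta * n.+1%:R)^-1 + s') * xi ^+ 2.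
Proof.
move=> eta0 /andP[el0 el1] es s_le.
have s'0 : 0 <= s' by rewrite -(pmulr_rge0 _ eta0); case/andP: es.
set m := smoothing eta lam n.
have m01 : 0 <= m <= 1 by apply: smoothing_bounds => //; lra.
have mnoise : lam / 2 * m ^+ 2 <= (eta * n.+1%:R)^-1.
  by apply: smoothing_noise => //; lra.
pose u := m * r.
have u2 : u ^+ 2 <= r ^+ 2.
  by rewrite exprMn ler_piMl ?sqr_ge0 // exprn_ile1; case/andP: m01.
have noise_le xi : (lam / 2 + s') * (m * xi) ^+ 2 <=
    ((eta * n.+1%:R)^-1 + s') * xi ^+ 2.
  rewrite exprMn mulrA ler_wpM2r ?sqr_ge0 // mulrDl lerD // ler_piMr //.
  by rewrite exprn_ile1; case/andP: m01.
(* Exact expansion around the predicted point [W], shared by both signs of the curvature: [D] is the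
   noiseless displacement and [q0] the derivative of the energy at [W + D]. *)
have finish W p D q0 : lam * W + b = p -> q0 = p + lam * D + 2 * s' * (W + D) ->
   p * D + lam / 2 * D ^+ 2 + 2 * s' * W * D + s' * D ^+ 2 -
     2 * eta * s' ^+ 2 * W ^+ 2 + eta / 64 * q0 ^+ 2 <= 10 * eta * u ^+ 2 ->
   forall xi, energy lam b s' (W + D - eta * (m * xi)) <=
     energy lam b s W + 10 * eta * r ^+ 2 -
    eta / 64 * (m * q0) ^+ 2 - eta * (m * q0 * xi) +
    eta ^+ 2 * ((eta * n.+1%:R)^-1 + s') * xi ^+ 2.
  move=> pE qE diss xi.
  have H1 : (m * q0) ^+ 2 <= q0 ^+ 2.
    by rewrite exprMn ler_piMl ?sqr_ge0 // exprn_ile1; case/andP: m01.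
  have H2 := ler_wpM2l (ltW eta0) H1.
  have H3 := ler_wpM2l (ltW eta0) u2.
  have H4 := ler_wpM2l (sqr_ge0 eta) (noise_le xi).
  have H5 := ler_wpM2r (sqr_ge0 W) s_le.
  have -> : energy lam b s' (W + D - eta * (m * xi)) = energy lam b s W +
      (p * D + lam / 2 * D ^+ 2 + 2 * s' * W * D + s' * D ^+ 2 + (s' - s) * W ^+ 2)
      - eta * (m * q0 * xi) + eta ^+ 2 * ((lam / 2 + s') * (m * xi) ^+ 2).
    by rewrite /energy qE -pE; field.
  rewrite -[eta ^+ 2 * (_ + s') * _]mulrA lerD //.
  rewrite -!addrA lerD2l !addrA lerD2r.
  by move: diss H2 H3 H5; lra.
have [lam0|lam0] := ltP 0 lam.
  pose P := m * (lam * x + b).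
  pose W := predicted eta lam b n.+1 x.
  have lP : lam * W + b = (1 - eta / 2 * lam) * P.
    rewrite /W /P /m /predicted /smoothing /shift_coef lam0.
    by rewrite mulrBr mulrA [lam * (_ * b)]mulrA geometric_shift exprS; ring.
  pose D := - (eta * (P / 2 + u)).
  exists (m * ((1 - eta / 2 * lam) * P + lam * D + 2 * s' * (W + D))) => xi.
  have -> : predicted eta lam b n (x - eta * (lam * x + b + r + xi)) =
     W + D - eta * (m * xi).
    rewrite /D /W /P /u /m /predicted /smoothing /shift_coef lam0 big_ord_recr /= exprSr.
    by field.
  apply: (finish W _ D _ lP) => //.
  have el01 : 0 <= eta * lam <= 1 / 64 by rewrite el1 mulr_ge0 // ltW.
  have := @dissipation_convex (eta * lam) (eta * s') P (s' * W) u.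
  rewrite el01 es.
  move=> /(_ isT isT _ erefl) /(ler_wpM2l (ltW eta0)) H.
  apply: le_trans (_ : eta * (10 * u ^+ 2) <= _); last by lra.
  apply: le_trans H; rewrite le_eqVlt; apply/orP; left; apply/eqP.
  by rewrite /D; field.
pose P := lam * x + b.
have mE : m = 1 by rewrite /m /smoothing ltNge lam0.
have WE : predicted eta lam b n.+1 x = x.
  by rewrite /predicted /smoothing /shift_coef ltNge lam0 /= mul1r mul0r subr0.
pose D := - (eta * (P + u)).
exists (m * (P + lam * D + 2 * s' * (x + D))) => xi; rewrite WE.
have -> : predicted eta lam b n (x - eta * (lam * x + b + r + xi)) =
   x + D - eta * (m * xi).
  rewrite /D /u mE /predicted /smoothing /shift_coef ltNge lam0 /= /P; ring.
apply: (finish x P D) => //.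
have := @dissipation_concave (eta * lam) (eta * s') P (s' * x) u.
have el_le0 : eta * lam <= 0 by rewrite pmulr_rle0.
rewrite el0 el_le0 es => /(_ isT isT _ erefl) /(ler_wpM2l (ltW eta0)) H.
apply: le_trans (_ : eta * (10 * u ^+ 2) <= _); last by lra.
apply: le_trans H; rewrite le_eqVlt; apply/orP; left; apply/eqP.
by rewrite /D; field.
Qed.

(** The prediction from 0 is [- nu * b], where gradient descent gains [nu * b ^+ 2] to first order;
    curvature and penalty take back at most half of it each. *)
Lemma energy_start eta lam b s (n : nat) :
  0 < eta -> eta * lam <= 1 / 64 -> 0 <= s -> s * eta * n%:R <= 1 ->
  energy lam b s (predicted eta lam b n 0) <= 0.
Proof.
move=> eta0 el s0 sn; rewrite /predicted mulr0 sub0r /energy /shift_coef.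
case: ifPn => [lam0|_]; last by rewrite mul0r oppr0 expr0n /= !mulr0 !addr0.
have el0 : 0 < eta * lam by rewrite mulr_gt0.
set nu := eta / 2 * _.
have nu0 : 0 <= nu.
  rewrite mulr_ge0 ?divr_ge0 ?(ltW eta0) // sumr_ge0 // => i _.
  by rewrite exprn_ge0 //; lra.
have nun : nu <= eta / 2 * n%:R.
  rewrite ler_wpM2l ?divr_ge0 ?(ltW eta0) //.
  rewrite -[in leRHS](card_ord n) -sumr_const ler_sum // => i _.
  by rewrite exprn_ile1 //; lra.
have lnu : lam * nu <= 1.
  by rewrite geometric_shift lerBlDr lerDl exprn_ge0 //; lra.
have snu : s * nu <= 1 / 2.
  by have := ler_wpM2l s0 nun; lra.
move: nu nu0 lnu snu {nun} => nu nu0 lnu snu.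
have : nu * b ^+ 2 * (lam * nu / 2 + s * nu - 1) <= 0.
  apply: mulr_ge0_le0; first by rewrite mulr_ge0 ?sqr_ge0.
  by lra.
by rewrite (_ : nu * b ^+ 2 * _ = b * - (nu * b) + lam / 2 * (- (nu * b)) ^+ 2 + s * (- (nu * b)) ^+ 2) //; field.
Qed.

End scalar_potential.

(** * Exponential moments of bounded centered vectors *)

Section exponential.
Context (R : realType) (d : nat).
Implicit Types (S xi : 'rV[R]_d).

(** Turns an exponential moment of a centered variable into a sub-Gaussian bound, the linear term
    having mean zero. *)
Lemma expR_le_linear_sqr (y : R) : expR y <= y + expR (2 * y ^+ 2).
Proof.
have y2 : 1 + 2 * y ^+ 2 <= expR (2 * y ^+ 2) by exact: expR_ge1Dx.
have sq := sqr_ge0 y.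
have [y_small|y_big] := lerP y (1 / 2); last first.
  have : 1 / 2 * y <= y * y by rewrite ler_wpM2r // ltW // (lt_trans _ y_big).
  have : expR y <= expR (2 * y ^+ 2) by rewrite ler_expR expr2; nra.
  by lra.
have [y_neg|y_pos] := lerP y (- (1 / 2)).
  have : 0 <= (y + 1 / 2) * y by nra.
  have : expR y <= 1 by rewrite -expR0 ler_expR; lra.
  by lra.
have E : expR y * expR (- y) = 1 by rewrite expRN mulfV // gt_eqF ?expR_gt0.
have := expR_ge1Dx (- y); have := expR_gt0 y => e0 e1.
have : expR y * (1 - y) <= 1 by rewrite -[leRHS]E ler_pM2l.
have : 1 <= (1 + y + 2 * y ^+ 2) * (1 - y).
  have : 0 <= y ^+ 2 * (1 - 2 * y) by rewrite mulr_ge0 //; lra.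
  by lra.
move=> h1 h2; have {h2}h1 := le_trans h2 h1.
have : expR y <= 1 + y + 2 * y ^+ 2 by rewrite -(ler_pM2r (x := 1 - y)) //; lra.
by lra.
Qed.

Lemma expR_le_linear_bound (y B : R) : `|y| <= B -> expR y <= y + expR (2 * B ^+ 2).
Proof.
move=> yB; apply: le_trans (expR_le_linear_sqr y) _.
have y2 : y ^+ 2 <= B ^+ 2.
  rewrite -(real_normK (num_real y)) ler_pXn2r ?nnegrE //.
  exact: le_trans yB.
by rewrite lerD2l ler_expR; lra.
Qed.

(** The cross term of the expanded square costs [8 * sigma ^+ 2 * al' ^+ 2 * enorm S ^+ 2] in the
    exponent, which is what the decrease of the coefficient from [al] to [al'] pays for. *)
Lemma sqnorm_exp_step (al al' sigma : R) S : 0 <= al' -> 0 <= sigma ->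
  al' + 8 * sigma ^+ 2 * al' ^+ 2 <= al ->
  exists c, forall xi, enorm xi <= sigma ->
    expR (al' * enorm (S + xi) ^+ 2) <=
    expR (al * enorm S ^+ 2 + al' * sigma ^+ 2) + dot c xi.
Proof.
move=> al0 s0 al_le.
pose W := expR (al' * enorm S ^+ 2 + al' * sigma ^+ 2).
exists ((W * (2 * al')) *: S) => xi xis.
have W0 : 0 < W by exact: expR_gt0.
have : expR (2 * al' * dot S xi) <=
    2 * al' * dot S xi + expR (2 * (2 * al' * enorm S * sigma) ^+ 2).
  apply: expR_le_linear_bound.
  rewrite normrM ger0_norm ?mulr_ge0 // -mulrA ler_wpM2l ?mulr_ge0 //.
  by apply: le_trans (normr_dot _ _) _; rewrite ler_wpM2l ?enorm_ge0.
rewrite -(ler_pM2l W0) mulrDr -expRD -expRD => H.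
apply: le_trans (_ : _ <= expR (al' * enorm S ^+ 2 + al' * sigma ^+ 2 + 2 * al' * dot S xi)) _.
  rewrite ler_expR enormD_sqr.
  have : al' * enorm xi ^+ 2 <= al' * sigma ^+ 2.
    by rewrite ler_wpM2l // ler_pXn2r // nnegrE enorm_ge0.
  by lra.
apply: le_trans H _; rewrite addrC dotZl -!mulrA lerD // ler_expR.
have := ler_wpM2r (sqr_ge0 (enorm S)) al_le.
by lra.
Qed.

End exponential.

(** * Potential in the eigenbasis of the Hessian *)

Section potential.
Context (R : realType) (d : nat) (Q H : 'M[R]_d) (lam : 'I_d -> R).
Hypothesis QQ : Q *m Q^T = 1%:M.
Hypothesis HQ : forall (x : 'rV[R]_d) i, (x *m H *m Q) 0 i = lam i * (x *m Q) 0 i.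
Implicit Types (b h r q xi : 'rV[R]_d) (eta s : R).

Lemma dot_orthogonal h q : dot (h *m Q) (q *m Q) = dot h q.
Proof. by rewrite dot_mulmx -mulmxA QQ mulmx1. Qed.

Lemma enorm_orthogonal h : enorm (h *m Q) = enorm h.
Proof. by rewrite !enormE dot_orthogonal. Qed.

Definition potential eta b s (n : nat) h : R :=
  \sum_(i < d) energy (lam i) ((b *m Q) 0 i) s
     (predicted eta (lam i) ((b *m Q) 0 i) n ((h *m Q) 0 i)).

Lemma potential_end eta b s h :
  potential eta b s 0 h = dot b h + 1 / 2 * dot (h *m H) h + s * enorm h ^+ 2.
Proof.
rewrite enorm_sqr -(dot_orthogonal b) -(dot_orthogonal (h *m H)) -(dot_orthogonal h).
rewrite /dot !mulr_sumr -!big_split /=; apply: eq_bigr => i _.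
rewrite /energy /predicted /smoothing /shift_coef big_ord0 !mulr0 HQ expr0.
by case: ifP => _; rewrite mul1r mul0r subr0; field.
Qed.

Lemma potential_start eta b s n : 0 < eta ->
  (forall i, eta * lam i <= 1 / 64) -> 0 <= s -> s * eta * n%:R <= 1 ->
  potential eta b s n 0 <= 0.
Proof.
move=> eta0 el s0 sn; rewrite -oppr_ge0 -sumrN sumr_ge0 // => i _.
have -> : ((0 : 'rV[R]_d) *m Q) 0 i = 0 by rewrite mul0mx mxE.
by rewrite oppr_ge0; exact: energy_start.
Qed.

Lemma potential_step eta b h r s s' (n : nat) :
  0 < eta -> (forall i, - (1 / 64) <= eta * lam i <= 1 / 64) ->
  0 <= eta * s' <= 1 / 64 -> s' + 2 * eta * s' ^+ 2 <= s ->
  exists q, forall xi,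
    potential eta b s' n (h - eta *: (h *m H + b + r + xi)) <=
    potential eta b s n.+1 h + 10 * eta * enorm r ^+ 2 -
    eta / 64 * enorm q ^+ 2 - eta * dot q xi +
    eta ^+ 2 * ((eta * n.+1%:R)^-1 + s') * enorm xi ^+ 2.
Proof.
move=> eta0 el es ss.
have [q qP] := fin_all_exists (fun i => energy_step ((b *m Q) 0 i)
  ((h *m Q) 0 i) ((r *m Q) 0 i) n eta0 (el i) es ss).
exists ((\row_i q i) *m Q^T) => xi.
have Q'Q : Q^T *m Q = 1%:M by exact: mulmx1C.
have qQ : (\row_i q i) *m Q^T *m Q = \row_i q i by rewrite -mulmxA Q'Q mulmx1.
rewrite -(dot_orthogonal _ xi) !enorm_sqr -(dot_orthogonal r) -(dot_orthogonal xi).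
rewrite -(dot_orthogonal (_ *m Q^T)) qQ /dot !mulr_sumr -!sumrN -!big_split /=.
apply: ler_sum => i _; have := qP i ((xi *m Q) 0 i).
have -> : ((h - eta *: (h *m H + b + r + xi)) *m Q) 0 i =
    (h *m Q) 0 i - eta * (lam i * (h *m Q) 0 i + (b *m Q) 0 i + (r *m Q) 0 i + (xi *m Q) 0 i).
  rewrite -HQ mulmxBl -scalemxAl !mulmxDl.
  by move: (h *m Q) (h *m H *m Q) (b *m Q) (r *m Q) (xi *m Q) => *; rewrite !mxE.
move=> le1; apply: le_trans le1 _; rewrite [(\row_i q i) 0 i]mxE !expr2.
by rewrite le_eqVlt; apply/orP; left; apply/eqP; ring.
Qed.

(** The rate [th] balances the two quadratic terms in [q]: exponentiating the noise term costs
    [2 * (th * eta * enorm q * sigma) ^+ 2], exactly [th] times the reserve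
    [eta / 64 * enorm q ^+ 2]. *)
Lemma potential_exp_step eta b h r s s' sigma Rr (n : nat) :
  let th := (128 * eta * sigma ^+ 2)^-1 in
  0 < eta -> 0 < sigma -> (forall i, - (1 / 64) <= eta * lam i <= 1 / 64) ->
  0 <= eta * s' <= 1 / 64 -> s' + 2 * eta * s' ^+ 2 <= s ->
  enorm r <= Rr ->
  exists c, forall xi, enorm xi <= sigma ->
    expR (th * potential eta b s' n (h - eta *: (h *m H + b + r + xi))) <=
    expR (th * (potential eta b s n.+1 h + 10 * eta * Rr ^+ 2 +
       eta * sigma ^+ 2 * (n.+1%:R^-1 + eta * s'))) + dot c xi.
Proof.
move=> th eta0 sigma0 el es ss rR.
have th0 : 0 < th by rewrite invr_gt0 !mulr_gt0 ?exprn_gt0.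
have s'0 : 0 <= s' by rewrite -(pmulr_rge0 _ eta0); case/andP: es.
have [q qP] := potential_step b h r n eta0 el es ss.
pose E := potential eta b s n.+1 h + 10 * eta * Rr ^+ 2 +
       eta * sigma ^+ 2 * (n.+1%:R^-1 + eta * s').
pose W := expR (th * (E - eta / 64 * enorm q ^+ 2)).
have W0 : 0 < W by exact: expR_gt0.
exists ((W * (- (th * eta))) *: q) => xi xis.
have : expR (- (th * eta) * dot q xi) <=
    - (th * eta) * dot q xi + expR (2 * (th * eta * (enorm q * sigma)) ^+ 2).
  apply: expR_le_linear_bound.
  have te0 : 0 <= th * eta by rewrite mulr_ge0 ?ltW.
  rewrite normrM normrN (ger0_norm te0) (ler_wpM2l te0) //.
  by apply: le_trans (normr_dot _ _) _; rewrite ler_wpM2l ?enorm_ge0.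
rewrite -(ler_pM2l W0) mulrDr -expRD -expRD => Hexp.
have r2 : enorm r ^+ 2 <= Rr ^+ 2.
  by rewrite ler_pXn2r // nnegrE ?enorm_ge0 // (le_trans (enorm_ge0 r)).
have xi2 : enorm xi ^+ 2 <= sigma ^+ 2.
  by rewrite ler_pXn2r // nnegrE ?enorm_ge0 // ltW.
apply: le_trans (_ : _ <= expR (th * (E - eta / 64 * enorm q ^+ 2) + - (th * eta) * dot q xi)) _.
  have -> : th * (E - eta / 64 * enorm q ^+ 2) + - (th * eta) * dot q xi =
      th * (E - eta / 64 * enorm q ^+ 2 - eta * dot q xi) by ring.
  rewrite ler_expR ler_pM2l //.
  apply: le_trans (qP xi) _.
  have kap0 : 0 <= eta ^+ 2 * ((eta * n.+1%:R)^-1 + s').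
    by rewrite mulr_ge0 ?sqr_ge0 // addr_ge0 // invr_ge0 mulr_ge0 // ltW.
  have := ler_wpM2l kap0 xi2; have := ler_wpM2l (ltW eta0) r2.
  have -> : eta ^+ 2 * ((eta * n.+1%:R)^-1 + s') * sigma ^+ 2 =
     eta * sigma ^+ 2 * (n.+1%:R^-1 + eta * s').
    by rewrite invfM; move: (n.+1%:R^-1) => k; field; rewrite gt_eqF.
  rewrite /E; set k1 := (_^-1 + s'); set k2 := (n.+1%:R^-1 + _); clearbody k1 k2.
  by lra.
apply: le_trans Hexp _.
rewrite addrC [dot (_ *: q) xi]dotZl -[W * _ * dot q xi]mulrA.
rewrite lerD // ler_expR mulrBr.
have -> : 2 * (th * eta * (enorm q * sigma)) ^+ 2 = th * (eta / 64 * enorm q ^+ 2).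
  by rewrite /th; field; rewrite !gt_eqF.
by rewrite subrK.
Qed.

End potential.

(** * Finite-horizon probabilities of a Markov chain *)

Section markov_chain.
Local Open Scope ereal_scope.
Context (R : realType) (dS dZ dO : measure_display).
Context (S : measurableType dS) (Z : measurableType dZ) (Omega : measurableType dO).
Context (P : probability Omega R) (D : probability Z R).
Variable step : S * Z -> S.
Hypothesis mstep : measurable_fun setT step.

Fixpoint chain (s0 : S) (z : nat -> Z) (t : nat) : S :=
  if t is t'.+1 then step (chain s0 z t', z t') else s0.

(** Probability of being in [A] at time [n], not before it, when starting from [s]. The first step
    is the outermost integral, so induction on [n] is conditioning on the first sample. *)
Fixpoint hitting (A : set S) (n : nat) (s : S) : \bar R :=
  if n is n'.+1 then \int[D]_z hitting A n' (step (s, z)) else (\1_A s)%:E.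

Lemma hitting_ge0 A n s : 0 <= hitting A n s.
Proof.
case: n s => [|n] s /=; first by rewrite lee_fin.
by apply: integral_ge0 => z _; elim: n {s} (step _) => [|n IH] s /=;
  [rewrite lee_fin|apply: integral_ge0].
Qed.

Lemma measurable_hitting A n : measurable A -> measurable_fun [set: S] (hitting A n : S -> \bar R).
Proof.
move=> mA; elim: n => [|n IH] /=.
  by apply/measurable_EFinP; exact: measurable_indic.
apply: (@measurable_fun_fubini_tonelli_F _ _ _ _ _ D (hitting A n \o step)).
  exact: measurableT_comp.
by move=> s /=; exact: hitting_ge0.
Qed.

Lemma measurable_hitting_step A n s : measurable A ->
  measurable_fun [set: Z] (fun z => hitting A n (step (s, z)) : \bar R).
Proof.
move=> mA; apply: (measurableT_comp (measurable_hitting n mA)).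
by apply: (measurableT_comp mstep).
Qed.

Lemma hitting_le1 A n s : measurable A -> hitting A n s <= 1.
Proof.
move=> mA; elim: n s => [|n IH] s /=; first by rewrite lee_fin indicE lern1 leq_b1.
rewrite -[leRHS](probability_setT D) -[leRHS]mul1e -integral_cst //.
apply: ge0_le_integral => //.
- by move=> z _; exact: hitting_ge0.
- exact: measurable_hitting_step.
Qed.

Variable zeta : nat -> {RV P >-> Z}.
Hypothesis zeta_iid : iid D zeta.
Variable s0 : S.

Let run t (w : Omega) := chain s0 (fun n => zeta n w) t.

Lemma measurable_chain t : measurable_fun setT (run t).
Proof.
elim: t => [|t IH]; first exact: measurable_cst.
apply: (measurableT_comp mstep); apply: measurable_fun_pair => //.
Qed.

(** Cylinder events of the samples from time [t] on; together with the state at time [t] they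
    express the independence of past and future. *)
Fixpoint future t (As : seq (set Z)) : set Omega :=
  if As is A :: As' then (zeta t @^-1` A) `&` future t.+1 As' else setT.

Definition future_prob (As : seq (set Z)) : \bar R := \prod_(A <- As) D A.

Let measurable_all (As : seq (set Z)) := forall i, measurable (nth setT As i).

Lemma measurable_future t As : measurable_all As -> measurable (future t As).
Proof.
elim: As t => [|A As IH] t mAs //=; apply: measurableI.
  rewrite -[X in measurable X]setTI.
  by apply: (measurable_funP (zeta t)) => //; exact: (mAs 0%N).
by apply: IH => i; exact: (mAs i.+1).
Qed.

Lemma future_probE As : measurable_all As -> P (future 0 As) = future_prob As.
Proof.
move=> mAs; have [distr indep] := zeta_iid.
pose I := [fset n in iota 0 (size As)]%fset.
have perm_I : perm_eq I (iota 0 (size As)).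
  apply: uniq_perm; rewrite ?fset_uniq ?iota_uniq // => n.
  by rewrite in_fset /=.
have futE t : future t As = \big[setI/setT]_(n <- iota t (size As))
    (zeta n @^-1` nth setT As (n - t)).
  elim: As t {mAs I perm_I} => [|A As IH] t; first by rewrite big_nil.
  rewrite /= big_cons subnn IH; congr (_ `&` _).
  apply: eq_big_seq => n; rewrite mem_iota => /andP[tn _].
  by rewrite -[in RHS](subnSK tn).
rewrite futE; under eq_bigr do rewrite subn0.
rewrite -(perm_big _ perm_I) /= (indep I (nth setT As) mAs).
rewrite (perm_big _ perm_I) /= /future_prob (big_nth setT) /index_iota subn0.
by apply: eq_bigr => n _; rewrite -(distr n).
Qed.

(** The hypothesis gives the factorization on rectangles, by treating the set for the sample at [t]
    as the head of a longer list; Dynkin's lemma extends it to the product sigma-algebra. *)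
Lemma pair_law t :
  (forall A, measurable A -> forall As, measurable_all As ->
     P (run t @^-1` A `&` future t As) = P (run t @^-1` A) * future_prob As) ->
  forall As, measurable_all As -> forall W, measurable W ->
  P ((fun w => (run t w, zeta t w)) @^-1` W `&` future t.+1 As) =
  P ((fun w => (run t w, zeta t w)) @^-1` W) * future_prob As.
Proof.
move=> IH As mAs W mW.
pose X w := (run t w, zeta t w).
have mX : measurable_fun setT X.
  by apply: measurable_fun_pair => //; exact: measurable_chain.
have mXW V : measurable V -> measurable (X @^-1` V).
  by move=> mV; rewrite -[X in measurable X]setTI; exact: mX.
have mF := measurable_future t.+1 mAs.
pose G : set (set (S * Z)) := [set A `*` B | A in measurable & B in measurable].
suff : forall V, <<s G >> V ->
    P (X @^-1` V `&` future t.+1 As) = P (X @^-1` V) * future_prob As.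
  by apply; rewrite /G -measurable_prod_measurableType.
have fp : future_prob As = P (future t.+1 As).
  have := IH setT measurableT (setT :: As).
  rewrite preimage_setT probability_setT !setTI mul1e /= preimage_setT setTI => ->.
    by rewrite /future_prob big_cons probability_setT mul1e.
  by case => [|i] //=; exact: mAs.
have fin_fp : future_prob As \is a fin_num by rewrite fp fin_num_measure.
apply: dynkin_induction.
- by rewrite measurable_prod_measurableType.
- move=> _ _ [A1 mA1 [B1 mB1 <-]] [A2 mA2 [B2 mB2 <-]]; rewrite -setXI.
  by exists (A1 `&` A2); [exact: measurableI|exists (B1 `&` B2) => //; exact: measurableI].
- by rewrite preimage_setT setTI probability_setT mul1e.
- move=> _ [A mA [B mB <-]].
  have -> : X @^-1` (A `*` B) = run t @^-1` A `&` zeta t @^-1` B by [].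
  rewrite -setIA (IH A mA (B :: As)); last by case => [|i] //=; exact: mAs.
  have := IH A mA [:: B]; rewrite /= setIT => ->; last by case => [|[|i]] /=.
  by rewrite /future_prob !big_cons big_nil mule1 muleA.
- move=> V mV PV; have -> : X @^-1` (~` V) = ~` (X @^-1` V) by [].
  rewrite (_ : ~` (X @^-1` V) `&` _ = future t.+1 As `\` (X @^-1` V)); last first.
    by rewrite setDE setIC.
  rewrite measureD //; [|exact: mXW|].
    2: by apply: le_lt_trans (probability_le1 P mF) _; rewrite ltry.
  transitivity (P (future t.+1 As) - P (X @^-1` V) * future_prob As).
    by congr (_ - _); rewrite setIC; exact: PV.
  have PC : P (~` (X @^-1` V)) = 1 - P (X @^-1` V).
    by apply: probability_setC; exact: mXW.
  transitivity ((1 - P (X @^-1` V)) * future_prob As); last by rewrite -PC.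
  rewrite -fp.
  have fq : P (X @^-1` V) \is a fin_num by apply: fin_num_measure; exact: mXW.
  move: (P _) (future_prob As) fq fin_fp => [q||] [c||] // _ _.
  by rewrite -EFinM -EFinD -EFinD -EFinM mulrBl mul1r.
- move=> F mFn tF PF.
  have tX : trivIset setT (fun i => X @^-1` F i).
    apply/trivIsetP => i j _ _ ij; rewrite -preimage_setI.
    by move/trivIsetP : tF => /(_ _ _ _ _ ij) -> //; rewrite preimage_set0.
  rewrite preimage_bigcup setI_bigcupl.
  rewrite measure_bigcup //; last 2 first.
  + by move=> i _; apply: measurableI => //; exact: mXW.
  + exact: trivIset_setIr.
  rewrite measure_bigcup //; last by move=> i _; exact: mXW.
  rewrite muleC -(fineK fin_fp) -nneseriesZl //.
  by apply: eq_eseriesr => i _; rewrite fineK // muleC; exact: PF.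
Qed.

(** Lists of arbitrary length keep the induction going, since each step of the chain consumes the
    first future sample. *)
Lemma chain_future_indep t : forall A, measurable A -> forall As, measurable_all As ->
  P (run t @^-1` A `&` future t As) = P (run t @^-1` A) * future_prob As.
Proof.
elim: t => [A mA As mAs|t IH A mA As mAs].
  rewrite -future_probE //.
  have [As0|As0] := pselect (A s0).
    have -> : run 0 @^-1` A = setT by apply/seteqP; split.
    by rewrite setTI probability_setT mul1e.
  have -> : run 0 @^-1` A = set0 by apply/seteqP; split.
  by rewrite set0I measure0 mul0e.
have mstepA : measurable (step @^-1` A) by rewrite -[X in measurable X]setTI; exact: mstep.
exact: (pair_law IH mAs mstepA).
Qed.

(** The joint law of the state and the next sample is a product measure, so Tonelli applies. *)
Lemma integral_chain_step t (g : S -> \bar R) :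
  measurable_fun [set: S] g -> (forall s, 0 <= g s) ->
  \int[P]_w g (run t.+1 w) = \int[P]_w \int[D]_z g (step (run t w, z)).
Proof.
move=> mg g0.
have mrun := measurable_chain t.
pose Xmix := isMeasurableFun.Build _ _ _ _ _ mrun.
pose X : {RV P >-> S} := HB.pack (run t) Xmix.
have mpair : measurable_fun setT (fun w => (run t w, zeta t w)).
  exact: measurable_fun_pair.
pose Ymix := isMeasurableFun.Build _ _ _ _ _ mpair.
pose Y : {RV P >-> (S * Z)%type} := HB.pack (fun w => (run t w, zeta t w)) Ymix.
have lawE W : measurable W -> (distribution P X \x D)%E W = distribution P Y W.
  apply: product_measure_unique => A B mA mB.
  rewrite /distribution /pushforward /=.
  have := @chain_future_indep t A mA [:: B].
  rewrite /= setIT /future_prob big_cons big_nil mule1 => <- //.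
  by case => [|[|i]] /=.
have mgs : measurable_fun setT (g \o step) by exact: measurableT_comp.
transitivity (\int[distribution P Y]_v (g \o step) v).
  by rewrite ge0_integral_distribution // => v; exact: g0.
transitivity (\int[(distribution P X \x D)%E]_v (g \o step) v).
  by apply: eq_measure_integral => W mW _; apply/esym; exact: lawE.
have gs0 v : 0 <= (g \o step) v by exact: g0.
rewrite fubini_tonelli1 // ge0_integral_distribution //.
  exact: measurable_fun_fubini_tonelli_F.
by move=> s; exact: integral_ge0.
Qed.

(** The mean of [hitting A (T - t)] at the state of time [t] does not depend on [t]; the two sides
    are its values at [T] and 0. *)
Lemma chain_hitting A T : measurable A -> P (run T @^-1` A) = hitting A T s0.
Proof.
move=> mA.
have E n t : (t + n = T)%N -> \int[P]_w hitting A n (run t w) = P (run T @^-1` A).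
  elim: n t => [|n IH] t.
    rewrite addn0 => -> /=.
    rewrite -(setIT (run T @^-1` A)) -integral_indic //.
    by rewrite -[X in measurable X]setTI; exact: measurable_chain.
  rewrite addnS -addSn => /IH <-; rewrite integral_chain_step //.
    exact: measurable_hitting.
  by move=> s; exact: hitting_ge0.
rewrite -(E T 0%N) // -[in RHS](mule1 (hitting _ _ _)) -(probability_setT P).
by rewrite -integral_cst //.
Qed.

End markov_chain.

(** * Borel measurability on row vectors *)

Section borel_rV.
Context (R : realType) (d : nat).
Implicit Types (x y : 'rV[R]_d).

(** The same sigma-algebra as the one over which [dispersive] quantifies. *)
Definition borel_rV := g_sigma_algebraType (@open 'rV[R]_d).

Definition rat_point (q : 'rV[rat]_d) : 'rV[R]_d := map_mx ratr q.

Lemma rat_point_dense x (e : R) : 0 < e ->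
  exists q, forall i, `|x 0 i - rat_point q 0 i| < e.
Proof.
move=> e0.
have H i : exists q : rat, `|x 0 i - ratr q| < e.
  have /rat_in_itvoo[q] : x 0 i - e < x 0 i + e by lra.
  rewrite in_itv /= => /andP[q1 q2]; exists q.
  by rewrite ltr_norml; apply/andP; split; lra.
have [q qP] := fin_all_exists H.
by exists (\row_i q i) => i; rewrite /rat_point !mxE.
Qed.

Lemma rat_point_dense_enorm x (e : R) : 0 < e ->
  exists q, enorm (x - rat_point q) < e.
Proof.
move=> e0; have d0 : 0 < d%:R + 1 :> R by rewrite ltr_wpDl.
have [q qP] := rat_point_dense x (divr_gt0 e0 d0).
exists q; apply: le_lt_trans (enorm_le_sum _) _.
apply: le_lt_trans (_ : \sum_(i < d) e / (d%:R + 1) < e).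
  by apply: ler_sum => i _; have /ltW := qP i; rewrite !mxE.
rewrite sumr_const card_ord -[ltLHS]mulr_natl mulrA ltr_pdivrMr // mulrC.
by rewrite ltr_pM2l // ltrDl.
Qed.

Lemma exists_invS_lt (e : R) : 0 < e -> exists n : nat, n.+1%:R^-1 < e.
Proof.
move=> e0; exists (Num.bound e^-1); rewrite invf_plt ?posrE //.
apply: lt_trans (archi_boundP _) _; first by rewrite invr_ge0 ltW.
by rewrite ltr_nat.
Qed.

Lemma open_boxP (U : set 'rV[R]_d) x : open U -> U x ->
  exists2 n : nat, True & forall y, (forall i, `|x 0 i - y 0 i| < n.+1%:R^-1) -> U y.
Proof.
move=> /[apply] /nbhs_ballP[e /= e0 eU].
have [n ne] := exists_invS_lt e0.
exists n => // y xy; apply: eU; split => // i j.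
by rewrite ord1; apply: lt_trans ne; exact: xy.
Qed.

Lemma measurable_forall_ord dT (T : measurableType dT) (A : 'I_d -> set T) :
  (forall i, measurable (A i)) -> measurable [set t | forall i, A i t].
Proof.
move=> mA; have -> : [set t | forall i, A i t] = ~` (\bigcup_i ~` A i).
  apply/seteqP; split => [t At [i _ nA]|t nA i]; first exact: nA.
  by apply: contrapT => nAi; apply: nA; exists i.
apply: measurableC; apply: countable_bigcupT_measurable; first exact: countableP.
by move=> i; exact: measurableC.
Qed.

(** An open set is a countable union of boxes with rational centers, and a box is a finite
    intersection of conditions on coordinates. *)
Lemma measurable_rVP dT (T : measurableType dT) (f : T -> 'rV[R]_d) :
  (forall i, measurable_fun setT (fun t => f t 0 i)) ->
  measurable_fun setT (f : T -> borel_rV).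
Proof.
move=> mf.
apply: (@measurability _ _ _ borel_rV setT f (@open 'rV[R]_d)) => //.
move=> _ [U oU <-]; rewrite setTI.
pose good (qn : 'rV[rat]_d * nat) := forall y,
  (forall i, `|y 0 i - rat_point qn.1 0 i| < qn.2.+1%:R^-1) -> U y.
pose B (qn : 'rV[rat]_d * nat) : set T :=
  [set t | forall i, `|f t 0 i - rat_point qn.1 0 i| < qn.2.+1%:R^-1].
have -> : f @^-1` U = \bigcup_qn (if `[< good qn >] then B qn else set0).
  apply/seteqP; split => [t Ut|t [qn _]]; last first.
    by case: asboolP => // gqn Bt; exact: gqn.
  have [n _ nU] := open_boxP oU Ut.
  (* This is half of [n.+1%:R^-1]: a box of this size around a nearby rational point stays in the
     box around [f t]. *)
  have e0 : 0 < (n.*2.+1).+1%:R^-1 :> R by rewrite invr_gt0.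
  have [q qt] := rat_point_dense (f t) e0.
  exists (q, n.*2.+1) => //; case: asboolP => // -[] /= y yq; apply: nU => i.
  rewrite -(subrK (rat_point q 0 i) (f t 0 i)) -addrA.
  apply: le_lt_trans (ler_normD _ _) _.
  have -> : n.+1%:R^-1 = (n.*2.+1).+1%:R^-1 + (n.*2.+1).+1%:R^-1 :> R.
    by rewrite -[n.*2.+2]doubleS -mul2n natrM invfM; move: (n.+1%:R^-1) => k; field.
  by rewrite ltrD // ?qt // distrC yq.
apply: countable_bigcupT_measurable; first exact: countableP.
move=> qn; case: asboolP => // _; apply: measurable_forall_ord => i.
have mI : measurable [set a : R | `|a - rat_point qn.1 0 i| < qn.2.+1%:R^-1].
  have -> : [set a | `|a - rat_point qn.1 0 i| < qn.2.+1%:R^-1] =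
     `]rat_point qn.1 0 i - qn.2.+1%:R^-1, rat_point qn.1 0 i + qn.2.+1%:R^-1[%classic.
    move: (rat_point _ _ _) (_^-1) => c k.
    by apply/seteqP; split => a /=; rewrite in_itv /= ltr_norml => /andP[a1 a2];
      apply/andP; split; lra.
  exact: measurable_itv.
by have := mf i measurableT _ mI; rewrite setTI.
Qed.

Lemma open_measurable_rV (U : set borel_rV) : open (U : set 'rV[R]_d) -> measurable U.
Proof. by move=> oU; exact: sub_sigma_algebra. Qed.

Lemma closed_measurable_rV (U : set borel_rV) : closed (U : set 'rV[R]_d) -> measurable U.
Proof.
move=> cU; rewrite -[U]setCK; apply: measurableC; apply: open_measurable_rV.
exact: closed_openC.
Qed.

Lemma measurable_cts_rV (g : 'rV[R]_d -> R) : continuous g ->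
  measurable_fun setT (g : borel_rV -> R).
Proof.
move=> cg; apply: (measurability _ (RGenOpens.measurableE R)).
move=> _ [_ [a [b ->] <-]]; rewrite setTI; apply: open_measurable_rV.
by apply: open_comp; [move=> x _; exact: cg|exact: interval_open].
Qed.

Lemma measurable_coord dT (T : measurableType dT) (f : T -> borel_rV) i :
  measurable_fun setT f -> measurable_fun setT (fun t => (f t : 'rV[R]_d) 0 i).
Proof.
move=> mf; apply: (measurableT_comp (f := fun x : borel_rV => (x : 'rV[R]_d) 0 i)) => //.
by apply: measurable_cts_rV; exact: coord_continuous.
Qed.

(** Joint measurability of a function that is uniformly Lipschitz in one variable and measurable in
    the other. *)
Lemma measurable_caratheodory dZ (Z : measurableType dZ) (G : 'rV[R]_d -> Z -> 'rV[R]_d)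
    (L : R) :
  (forall z x x', enorm (G x z - G x' z) <= L * enorm (x - x')) -> 0 < L ->
  (forall x i, measurable_fun setT (fun z => G x z 0 i)) ->
  measurable_fun setT (fun p : borel_rV * Z => G p.1 p.2 : borel_rV).
Proof.
move=> GL L0 mG; apply: measurable_rVP => i.
apply: (measurability _ (RGenInftyO.measurableE R)).
move=> _ [_ [a ->] <-]; rewrite setTI.
(* On such a rectangle the margin [L * n.+1%:R^-1] forces [G x z 0 i < a]. Conversely a rectangle
   contains (x, z) once twice the margin is below [a - G x z 0 i]. *)
pose V (q : 'rV[rat]_d) (n : nat) : set (borel_rV * Z) :=
  [set x : borel_rV | enorm ((x : 'rV[R]_d) - rat_point q) < n.+1%:R^-1] `*`
  [set z | G (rat_point q) z 0 i < a - L * n.+1%:R^-1].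
have -> : (fun p : borel_rV * Z => G p.1 p.2 0 i) @^-1` `]-oo, a[%classic =
    \bigcup_(qn : 'rV[rat]_d * nat) V qn.1 qn.2.
  have lip x q z : `|G x z 0 i - G q z 0 i| <= L * enorm (x - q).
    apply: le_trans (GL z x q); apply: le_trans (normr_coord _ i).
    by rewrite !mxE.
  apply/seteqP; split => [[x z] /=|[x z] [[q n] _ [/= xq Gq]]]; rewrite in_itv /=; last first.
    have := lip x (rat_point q) z; rewrite ler_norml => /andP[_].
    have : L * enorm (x - rat_point q) < L * n.+1%:R^-1 by rewrite ltr_pM2l.
    by move: Gq; move: (n.+1%:R^-1) => k; lra.
  move=> Ga; have e1 : 0 < (a - G x z 0 i) / (2 * L) by rewrite divr_gt0 ?mulr_gt0 ?subr_gt0.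
  have [n nn] := exists_invS_lt e1.
  have n0 : 0 < n.+1%:R^-1 :> R by rewrite invr_gt0.
  have [q xq] := rat_point_dense_enorm x n0.
  exists (q, n) => //; split => //=.
  have := lip x (rat_point q) z; rewrite ler_norml => /andP[+ _].
  have : L * enorm (x - rat_point q) < L * n.+1%:R^-1 by rewrite ltr_pM2l.
  move: nn; rewrite ltr_pdivlMr ?mulr_gt0 //.
  by move: (n.+1%:R^-1) => k; lra.
apply: countable_bigcupT_measurable; first exact: countableP.
move=> [q n] /=; apply: measurableX.
  apply: open_measurable_rV.
  apply: (@open_comp _ _ (fun x => enorm (x - rat_point q)) [set a | a < n.+1%:R^-1]).
    move=> x _; apply: (lipschitz_cts (C := 1)) => {}x y; rewrite mul1r.
    have := enormD (x - y) (y - rat_point q); have := enormD (y - x) (x - rat_point q).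
    rewrite !addrA !subrK (enorm_sub y x) => *.
    by rewrite ler_norml; apply/andP; split; lra.
  exact: open_lt.
have -> : [set z | G (rat_point q) z 0 i < a - L * n.+1%:R^-1] =
   (fun z => G (rat_point q) z 0 i) @^-1` `]-oo, (a - L * n.+1%:R^-1)[%classic.
  by apply/seteqP; split => z /=; rewrite in_itv.
by rewrite -[X in measurable X]setTI; apply: mG => //; exact: measurable_itv.
Qed.

End borel_rV.

(** * Stochastic gradients *)

Section oracle.
Context (R : realType) (d : nat) (dZ : measure_display) (Z : measurableType dZ).
Context (D : probability Z R) (G : 'rV[R]_d -> Z -> 'rV[R]_d) (g : 'rV[R]_d -> 'rV[R]_d).
Context (L sigma : R).
Hypothesis L_gt0 : 0 < L.
Hypothesis sigma_gt0 : 0 < sigma.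
Hypothesis G_lip : forall z x x', enorm (G x z - G x' z) <= L * enorm (x - x').
Hypothesis G_mean : forall x (i : 'I_d),
    D.-integrable setT (EFin \o (fun z => G x z 0 i)) /\
    'E_D[fun z => (G x z 0 i)%R]%E = (g x 0 i)%:E.
Implicit Types (x c : 'rV[R]_d).

Lemma oracle_measurable_coord x i : measurable_fun setT (fun z => G x z 0 i).
Proof. by have [/integrableP[/measurable_EFinP]] := G_mean x i. Qed.

Lemma oracle_measurable :
  measurable_fun setT (fun p : borel_rV R d * Z => G p.1 p.2 : borel_rV R d).
Proof. exact: measurable_caratheodory G_lip L_gt0 oracle_measurable_coord. Qed.

Lemma integral_prob_cst (a : R) : (\int[D]_z (cst a z)%:E = a%:E)%E.
Proof. by rewrite -[RHS]mule1 -(probability_setT D) -integral_cst. Qed.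

Lemma dot_mean c x :
  D.-integrable setT (EFin \o (fun z => dot c (G x z - g x))) /\
  (\int[D]_z (dot c (G x z - g x))%:E = 0)%E.
Proof.
have Ii i : D.-integrable setT (fun z => (G x z 0 i - g x 0 i)%:E).
  have [Gi _] := G_mean x i.
  exact: (integrableB measurableT Gi
    (finite_measure_integrable_cst D (g x 0 i) measurableT)).
have I i : D.-integrable setT (fun z => (c 0 i * (G x z 0 i - g x 0 i))%:E).
  exact: (integrableZl measurableT (c 0 i) (Ii i)).
have E : (fun z => (dot c (G x z - g x))%:E) =
    (fun z => \sum_(i < d) (c 0%R i * (G x z 0%R i - g x 0%R i))%:E)%E.
  apply/funext => z; rewrite sumEFin; congr EFin; apply: eq_bigr => i _.
  by rewrite !mxE.
split.
  have -> : EFin \o (fun z => dot c (G x z - g x)) =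
     (fun z => \sum_(i < d) (c 0%R i * (G x z 0%R i - g x 0%R i))%:E)%E by rewrite -E.
  exact: integrable_sum.
rewrite E integral_sum // big1 // => i _.
have [Gi Ei] := G_mean x i.
under eq_integral do rewrite EFinM.
rewrite integralZl //.
under eq_integral do rewrite EFinB.
rewrite integralB_EFin //; last exact: finite_measure_integrable_cst.
move: Ei; rewrite unlock => ->.
by rewrite (integral_prob_cst (g x 0 i)) subee // mule0.
Qed.

Lemma bounded_integrable (phi : Z -> \bar R) : measurable_fun setT phi ->
  (forall z, 0 <= phi z <= 1)%E -> D.-integrable setT phi.
Proof.
move=> mphi phi01; apply: (le_integrable _ mphi (g := EFin \o cst 1)) => //; last first.
  exact: finite_measure_integrable_cst.
by move=> z _; have /andP[p0 p1] := phi01 z; rewrite gee0_abs //= normr1.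
Qed.

(** Where pathwise supermartingale estimates become inequalities between probabilities: the linear
    term integrates to 0, and [N] collects the samples violating the noise bound. *)
Lemma integral_affine_le (phi chi : Z -> \bar R) (N : set Z) (c0 : R) c x :
  measurable_fun setT phi -> measurable_fun setT chi ->
  (forall z, 0 <= phi z <= 1)%E -> (forall z, 0 <= chi z <= 1)%E ->
  measurable N -> D N = 0%E ->
  (forall z, ~ N z -> phi z <= (c0 + dot c (G x z - g x))%:E + chi z)%E ->
  (\int[D]_z phi z <= c0%:E + \int[D]_z chi z)%E.
Proof.
move=> mphi mchi phi01 chi01 mN DN0 le_phi.
have [I0 E0] := dot_mean c x.
have Ipsi : D.-integrable setT (fun z => (c0 + dot c (G x z - g x))%:E).
  have -> : (fun z => (c0 + dot c (G x z - g x))%:E) =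
    ((EFin \o cst c0) \+ (EFin \o (fun z => dot c (G x z - g x))))%E.
    by apply/funext => z /=; rewrite EFinD.
  by apply: integrableD => //; exact: finite_measure_integrable_cst.
have Iphi := bounded_integrable mphi phi01.
have Ichi := bounded_integrable mchi chi01.
have Isum : D.-integrable setT (fun z => (c0 + dot c (G x z - g x))%:E + chi z)%E.
  exact: integrableD.
have -> : (c0%:E + \int[D]_z chi z =
    \int[D]_z ((c0 + dot c (G x z - g x))%:E + chi z))%E.
  rewrite integralD //; congr (_ + _)%E.
  under eq_integral do rewrite EFinD.
  rewrite integralD //; last exact: finite_measure_integrable_cst.
  by rewrite E0 adde0 integral_prob_cst.
rewrite (negligible_integral mN _ Iphi) // [leRHS](negligible_integral mN _ Isum) //.
apply: le_integral.
- exact: measurableD.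
- exact: (integrableS measurableT (measurableD measurableT mN) (@subsetT _ _) Iphi).
- exact: (integrableS measurableT (measurableD measurableT mN) (@subsetT _ _) Isum).
- by move=> z; rewrite inE => -[_ Nz]; exact: le_phi.
Qed.

(** The mean gradient inherits the Lipschitz constant, by averaging along each unit direction. *)
Lemma mean_lip x x' : enorm (g x - g x') <= L * enorm (x - x').
Proof.
have L0 := ltW L_gt0.
apply: enorm_dual => [|e e1]; first by rewrite mulr_ge0 ?enorm_ge0.
have [I1 E1] := dot_mean e x; have [I2 E2] := dot_mean (- e) x'.
have : (\int[D]_z ((dot e (G x z - g x))%:E + (dot (- e) (G x' z - g x'))%:E) <=
   \int[D]_z (cst (L * enorm (x - x') - dot e (g x - g x')) z)%:E)%E.
  apply: le_integral => //; [exact: integrableD|exact: finite_measure_integrable_cst|].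
  move=> z _; rewrite /= -EFinD lee_fin dotNl !dotBr.
  have := le_trans (dot_le_enorm e (G x z - G x' z))
    (ler_wpM2l (enorm_ge0 e) (G_lip z x x')).
  by rewrite e1 dotBr; lra.
rewrite integralD // E1 E2 adde0 integral_prob_cst lee_fin.
by rewrite subr_ge0.
Qed.

(** One null set for all points: the countably many null sets of the rational points suffice, both
    gradients being Lipschitz in the point. *)
Lemma noise_null_set :
  (forall x, {ae D, forall z, enorm (G x z - g x) ^+ 2 <= sigma ^+ 2}) ->
  exists N, [/\ measurable N, D N = 0%E &
    forall z x, ~ N z -> enorm (G x z - g x) <= sigma].
Proof.
move=> noise.
pose Pn (n : nat) (z : Z) : Prop := if (choice.unpickle n : option 'rV[rat]_d) is Some q
  then enorm (G (rat_point R q) z - g (rat_point R q)) ^+ 2 <= sigma ^+ 2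
  else True.
have [N [mN N0 NP]] : {ae D, forall z, forall n, Pn n z}.
  apply: ae_foralln => n; rewrite /Pn; case: (choice.unpickle n) => [q|].
    exact: noise.
  by apply: aeW => z.
exists N; split => // z x Nz.
have Pz n : Pn n z by apply: contrapT => nP; apply: Nz; apply: NP => /(_ n).
apply/ler_addgt0Pr => e e0.
have [q xq] := rat_point_dense_enorm x (divr_gt0 e0 (mulr_gt0 (ltr0n _ 2) L_gt0)).
have := Pz (choice.pickle q); rewrite /Pn choice.pickleK => /=.
rewrite ler_pXn2r ?nnegrE ?enorm_ge0 ?(ltW sigma_gt0) // => le_s.
have -> : G x z - g x = (G (rat_point R q) z - g (rat_point R q)) +
   ((G x z - G (rat_point R q) z) - (g x - g (rat_point R q))).
  by apply/rowP => i; rewrite !mxE; ring.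
apply: le_trans (enormD _ _) (lerD le_s _).
apply: le_trans (enormB _ _) _.
apply: le_trans (lerD (G_lip _ _ _) (mean_lip _ _)) _.
move: xq; rewrite ltr_pdivlMr ?mulr_gt0 // => xq.
by lra.
Qed.

Lemma bounded_noise_ae :
  (forall x, {ae D, forall z, enorm (G x z - g x) ^+ 2 <= sigma ^+ 2}) \/
  (forall x, ('E_D[fun z => (expR (enorm (G x z - g x) ^+ 2 / sigma ^+ 2))%R] <= 1)%E) ->
  forall x, {ae D, forall z, enorm (G x z - g x) ^+ 2 <= sigma ^+ 2}.
Proof.
move=> [//|exp_noise] x.
have := exp_noise x; rewrite unlock => le1.
have mdot : measurable_fun setT (fun z => enorm (G x z - g x) ^+ 2).
  have -> : (fun z => enorm (G x z - g x) ^+ 2) =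
     fun z => \sum_(i < d) (G x z 0 i - g x 0 i) ^+ 2.
    apply/funext => z; rewrite enorm_sqr; apply: eq_bigr => i _.
    by rewrite !mxE expr2.
  apply: measurable_sum => i; apply: measurable_funX.
  by apply: measurable_funB => //; exact: oracle_measurable_coord.
have mexp : measurable_fun setT (fun z => expR (enorm (G x z - g x) ^+ 2 / sigma ^+ 2)).
  apply: measurableT_comp => //; apply: measurable_funM => //.
pose h z := (expR (enorm (G x z - g x) ^+ 2 / sigma ^+ 2) - 1)%:E.
have h0 z : (0 <= h z)%E.
  rewrite lee_fin subr_ge0 -expR0 ler_expR divr_ge0 ?sqr_ge0 //.
have mh : measurable_fun setT h.
  by apply/measurable_EFinP; apply: measurable_funB.
(* The function [h] is nonnegative with nonpositive integral, hence vanishes almost everywhere. *)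
have : (\int[D]_z `|h z| = 0)%E.
  apply/eqP; rewrite eq_le integral_ge0 ?andbT //.
  rewrite -(@leeD2rE _ 1%E) // add0e; apply: le_trans le1.
  rewrite -{1}(probability_setT D) -(mul1e (D setT)) -integral_cst //.
  rewrite -ge0_integralD //; last first.
    by apply: measurableT_comp.
  rewrite le_eqVlt; apply/orP; left; apply/eqP; apply: eq_integral => z _.
  by rewrite gee0_abs // -EFinD subrK.
move/(ae_eq_integral_abs _ measurableT mh) => [N [mN N0 NP]].
exists N; split => // z /= nz; apply: NP => /= H; apply: nz.
have /eqP := H I; rewrite eqe subr_eq0 -expR0 (inj_eq (@expR_inj R)) mulf_eq0.
rewrite sqrf_eq0 invr_eq0 sqrf_eq0 (gt_eqF sigma_gt0) orbF => /eqP ->.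
by rewrite expr0n sqr_ge0.
Qed.

End oracle.

(** * Escape from saddle points *)

Section coupling.
Context (R : realType) (d : nat) (H : 'M[R]_d) (v : 'rV[R]_d).
Context (eta rho L B lamb mu : R).
Hypotheses (eta_gt0 : 0 < eta) (rho_gt0 : 0 < rho) (L_gt0 : 0 < L) (B_gt0 : 0 < B).
Hypotheses (lamb_ge0 : 0 <= lamb) (mu_gt0 : 0 < mu).
Hypothesis symH : H^T = H.
Hypothesis v1 : enorm v = 1.
Hypothesis vH : v *m H = - lamb *: v.
Hypothesis H_ge : forall w : 'rV[R]_d, - lamb * dot w w <= dot (w *m H) w.
Implicit Types (z m zeta : 'rV[R]_d).

Let growth := 1 + eta * lamb.
(** Relative errors of one step: [eps] bounds the variation of the Hessian over the ball, [iota] the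
    squared noise. Since both runs share the noise, what remains of it is proportional to their
    distance. *)
Let eps := eta * (rho * B).
Let iota := (2 * eta * L) ^+ 2.
Let kap := 1 + 16 * eps + iota.
Let om := eps / 16 + eps ^+ 2 + iota.

(* [n] is the number of steps still to come: the first term measures how far
   the component of the difference along [v] is from its expected final size
   [mu], the second one controls the size of the difference. *)
Definition coupling_potential (n : nat) z : R :=
  kap ^+ n * (1 - growth ^+ n * dot v z / mu) ^+ 2 +
  n%:R * kap ^+ n * om * (growth ^+ n * enorm z / mu) ^+ 2.

Lemma coupling_potential_ge0 n z : 0 <= coupling_potential n z.
Proof.
have e0 : 0 <= eps by rewrite !mulr_ge0 // ltW.
have i0 : 0 <= iota by exact: sqr_ge0.
have k0 : 0 <= kap by rewrite /kap; lra.
have o0 : 0 <= om by rewrite !addr_ge0 ?sqr_ge0 ?divr_ge0.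
rewrite /coupling_potential addr_ge0 // mulr_ge0 ?sqr_ge0 ?exprn_ge0 //.
by rewrite mulr_ge0 // mulr_ge0 ?exprn_ge0.
Qed.

(** Here [m] is the mean difference of the gradients and [zeta] its fluctuation. As [- lamb] is the
    least eigenvalue, the norm of the difference grows on average hardly faster than its component
    along [v]; errors proportional to the norm therefore stay small relative to [mu]. *)
Lemma coupling_step n z m : enorm m <= L * enorm z ->
  enorm (m - z *m H) <= rho * B * enorm z ->
  exists c, forall zeta, enorm (m + zeta) <= L * enorm z ->
    coupling_potential n (z - eta *: (m + zeta)) <=
    coupling_potential n.+1 z + dot c zeta.
Proof.
move=> mL mH.
pose r := m - z *m H.
pose s := growth ^+ n / mu.
have g1 : 1 <= growth by rewrite lerDl mulr_ge0 // ltW.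
have s0 : 0 < s by rewrite divr_gt0 // exprn_gt0 // (lt_le_trans ltr01).
have se0 : 0 < s * eta by rewrite mulr_gt0.
have e0 : 0 <= eps by rewrite !mulr_ge0 // ltW.
have i0 : 0 <= iota by exact: sqr_ge0.
have k1 : 1 <= kap by rewrite /kap; lra.
have kn0 : 0 <= kap ^+ n by rewrite exprn_ge0 // (le_trans ler01).
have o0 : 0 <= om by rewrite !addr_ge0 ?sqr_ge0 ?divr_ge0.
pose a := dot v z.
pose De := 1 - growth * s * a.
pose Nz := growth * s * enorm z.
have sz0 : 0 <= s * enorm z by rewrite mulr_ge0 ?enorm_ge0 // ltW.
have szN : s * enorm z <= Nz.
  by rewrite /Nz -mulrA ler_peMl.
have N0 : 0 <= Nz by exact: le_trans szN.
pose e := s * eta * dot v r.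
have eN : `|e| <= eps * Nz.
  rewrite normrM (gtr0_norm se0).
  have := normr_dot v r; rewrite v1 mul1r => /le_trans/(_ mH) vr.
  apply: le_trans (_ : s * eta * (rho * B * enorm z) <= _).
    by rewrite ler_wpM2l // ltW.
  have -> : s * eta * (rho * B * enorm z) = eps * (s * enorm z) by rewrite /eps; ring.
  by rewrite ler_wpM2l.
exists ((kap ^+ n * (2 * (De + e) * s * eta)) *: v -
  (n%:R * kap ^+ n * om * (2 * eta * s ^+ 2)) *: z) => zeta mzL.
have zetaL : enorm zeta <= 2 * L * enorm z.
  by have := enormB (m + zeta) m; rewrite addrC addKr; lra.
pose y := s * eta * dot v zeta.
have yN : y ^+ 2 <= iota * Nz ^+ 2.
  have yle : `|y| <= 2 * eta * L * (s * enorm z).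
    rewrite normrM (gtr0_norm se0).
    have := normr_dot v zeta; rewrite v1 mul1r => /le_trans/(_ zetaL) vz.
    apply: le_trans (ler_wpM2l (ltW se0) vz) _.
    by rewrite le_eqVlt; apply/orP; left; apply/eqP; ring.
  have eL0 : 0 <= 2 * eta * L by rewrite !mulr_ge0 // ltW.
  rewrite -real_normK ?num_real // /iota -exprMn ler_pXn2r ?nnegrE ?(mulr_ge0 eL0 N0) //.
  by apply: le_trans yle _; rewrite ler_wpM2l.
have mE : m = z *m H + r by rewrite /r addrC subrK.
have vzH : dot v (z *m H) = - lamb * a.
  by rewrite dotC dot_mulmx symH vH dotZr dotC.
have DE : 1 - growth ^+ n * dot v (z - eta *: (m + zeta)) / mu = De + e + y.
  rewrite mulrAC -/s /De /e /y mE dotBr dotZr !dotDr vzH /growth -/a; ring.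
have D1E : 1 - growth ^+ n.+1 * dot v z / mu = De.
  by rewrite /De /s exprS -/a; ring.
have NE : growth ^+ n.+1 * enorm z / mu = Nz by rewrite /Nz /s exprS; ring.
have zHz : - (eta * dot z m) <= eta * (lamb + rho * B) * enorm z ^+ 2.
  have h1 := H_ge z.
  have h2 : - dot z r <= rho * B * enorm z ^+ 2.
    rewrite -dotNr; apply: le_trans (dot_le_enorm _ _) _; rewrite enormN.
    by rewrite expr2 mulrA mulrC ler_wpM2r ?enorm_ge0.
  have h3 : - dot z m <= (lamb + rho * B) * enorm z ^+ 2.
    rewrite mE dotDr (dotC z (z *m H)) enorm_sqr.
    by move: h1 h2; rewrite enorm_sqr; lra.
  by have := ler_wpM2l (ltW eta_gt0) h3; lra.
have ZE : (growth ^+ n * enorm (z - eta *: (m + zeta)) / mu) ^+ 2 <=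
    (1 + 2 * eps + iota) * Nz ^+ 2 - 2 * eta * s ^+ 2 * dot z zeta.
  have -> : (growth ^+ n * enorm (z - eta *: (m + zeta)) / mu) ^+ 2 =
     s ^+ 2 * enorm (z - eta *: (m + zeta)) ^+ 2 by rewrite /s; ring.
  have E : enorm (z - eta *: (m + zeta)) ^+ 2 =
      enorm z ^+ 2 + 2 * - (eta * (dot z m + dot z zeta)) +
      eta ^+ 2 * enorm (m + zeta) ^+ 2.
    by rewrite enormD_sqr enormN enormZ gtr0_norm // dotNr dotZr dotDr; ring.
  rewrite E; have mz2 : enorm (m + zeta) ^+ 2 <= L ^+ 2 * enorm z ^+ 2.
    by rewrite -exprMn ler_pXn2r ?nnegrE ?enorm_ge0 // mulr_ge0 ?enorm_ge0 // ltW.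
  have h1 : enorm z ^+ 2 + 2 * - (eta * (dot z m + dot z zeta)) +
      eta ^+ 2 * enorm (m + zeta) ^+ 2 <=
      (1 + 2 * eta * lamb + 2 * eps + iota) * enorm z ^+ 2 - 2 * eta * dot z zeta.
    have := ler_wpM2l (sqr_ge0 eta) mz2.
    have : 0 <= (eta * L) ^+ 2 * enorm z ^+ 2 by rewrite mulr_ge0 ?sqr_ge0.
    by move: zHz; rewrite /eps /iota; lra.
  apply: le_trans (ler_wpM2l (sqr_ge0 s) h1) _.
  have g2 : 1 + 2 * eta * lamb <= growth ^+ 2.
    by have := sqr_ge0 (eta * lamb); rewrite /growth; lra.
  have sN : s ^+ 2 * enorm z ^+ 2 <= Nz ^+ 2.
    by rewrite -exprMn ler_pXn2r ?nnegrE.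
  have gN : (1 + 2 * eta * lamb) * (s ^+ 2 * enorm z ^+ 2) <= Nz ^+ 2.
    have -> : Nz ^+ 2 = growth ^+ 2 * (s ^+ 2 * enorm z ^+ 2) by rewrite /Nz; ring.
    by rewrite ler_wpM2r // mulr_ge0 ?sqr_ge0.
  have := ler_wpM2l (addr_ge0 (mulr_ge0 (ler0n _ 2) e0) i0) sN.
  by lra.
have DD : (De + e + y) ^+ 2 <= kap * De ^+ 2 + om * Nz ^+ 2 + 2 * (De + e) * y.
  have e2 : e ^+ 2 <= eps ^+ 2 * Nz ^+ 2.
    rewrite -exprMn -real_normK ?num_real // ler_pXn2r ?nnegrE //.
    by rewrite mulr_ge0.
  (* The unequal weights suit the epoch: over n steps with [n%:R * eps <= 1 / 16], the factor 16
     only costs a bounded constant in [kap ^+ n], while 1 / 16 makes [n%:R * om] small. *)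
  have De2 : 2 * De * e <= 16 * eps * De ^+ 2 + eps / 16 * Nz ^+ 2.
    apply: le_trans (_ : 2 * `|De| * (eps * Nz) <= _).
      apply: le_trans (ler_norm _) _; rewrite normrM normrM ger0_norm //.
      by rewrite ler_wpM2l // mulr_ge0.
    have := mulr_ge0 e0 (sqr_ge0 (4 * `|De| - Nz / 4)).
    have := real_normK (num_real De) => <-.
    by lra.
  have : 0 <= iota * De ^+ 2 by rewrite mulr_ge0 ?sqr_ge0.
  by move: yN; rewrite /kap /om; lra.
rewrite /coupling_potential DE D1E NE.
have knn0 : 0 <= n%:R * kap ^+ n * om by rewrite !mulr_ge0.
apply: le_trans (lerD (ler_wpM2l kn0 DD) (ler_wpM2l knn0 ZE)) _.
rewrite dotBl !dotZl.
have kapN : (1 + 2 * eps + iota) * Nz ^+ 2 <= kap * Nz ^+ 2.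
  by rewrite ler_wpM2r ?sqr_ge0 // /kap; lra.
have := ler_wpM2l knn0 kapN.
have : kap ^+ n * (om * Nz ^+ 2) <= kap ^+ n.+1 * (om * Nz ^+ 2).
  have oN : 0 <= om * Nz ^+ 2 by rewrite mulr_ge0 // sqr_ge0.
  by rewrite (exprS kap) -[kap * _ * _]mulrA ler_peMl // mulr_ge0.
rewrite (exprS kap) -(@natr1 _ n) /y; move: (kap ^+ n) (n%:R : R) (dot v zeta) (dot z zeta) => K k t1 t2.
by lra.
Qed.

End coupling.

(** * Survival in the ball around a strict saddle point *)

Section escape.
Context (R : realType) (d : nat) (dZ : measure_display) (Z : measurableType dZ).
Context (D : probability Z R) (G : 'rV[R]_d -> Z -> 'rV[R]_d) (f : 'rV[R]_d -> R).
Context (L sigma rho eta B : R) (x0 : 'rV[R]_d).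
Hypotheses (L_gt0 : 0 < L) (sigma_gt0 : 0 < sigma) (rho_gt0 : 0 < rho).
Hypotheses (eta_gt0 : 0 < eta) (B_gt0 : 0 < B) (d_gt0 : (0 < d)%N).
Hypothesis df : forall x, differentiable f x.
Hypothesis dg : forall x, differentiable (grad f) x.
Hypothesis hess_lip : forall x x',
  spectral_norm (hessian f x - hessian f x') <= rho * enorm (x - x').
Hypothesis G_lip : forall z x x', enorm (G x z - G x' z) <= L * enorm (x - x').
Hypothesis G_mean : forall x (i : 'I_d),
    D.-integrable setT (EFin \o (fun z => G x z 0 i)) /\
    'E_D[fun z => (G x z 0 i)%R]%E = (grad f x 0 i)%:E.
Implicit Types (x u v : 'rV[R]_d).

Definition in_ball x : bool := enorm (x - x0) <= B.

(** Freezing the iterate outside the ball turns staying inside during n steps into an event about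
    the state at time n. *)
Definition stopped_step (p : borel_rV R d * Z) : borel_rV R d :=
  if in_ball p.1 then (p.1 : 'rV[R]_d) - eta *: G p.1 p.2 else p.1.

Lemma measurable_in_ball : measurable_fun setT (in_ball : borel_rV R d -> bool).
Proof.
apply: (@measurable_fun_ler _ _ R setT (fun x : borel_rV R d => enorm ((x : 'rV[R]_d) - x0)) (cst B)) => //.
apply: measurable_cts_rV; apply: (lipschitz_cts (C := 1)) => x y; rewrite mul1r.
have := enormD (x - y) (y - x0); have := enormD (y - x) (x - x0).
rewrite !addrA !subrK (enorm_sub y x) => *.
by rewrite ler_norml; apply/andP; split; lra.
Qed.

Lemma measurable_sgd_move :
  measurable_fun setT (fun p : borel_rV R d * Z => (p.1 : 'rV[R]_d) - eta *: G p.1 p.2 : borel_rV R d).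
Proof.
apply: measurable_rVP => i.
have -> : (fun p : borel_rV R d * Z => ((p.1 : 'rV[R]_d) - eta *: G p.1 p.2) 0 i) =
   (fun p => (p.1 : 'rV[R]_d) 0 i - eta * G p.1 p.2 0 i).
  by apply/funext => p; rewrite !mxE.
apply: measurable_funB; first by apply: measurable_coord; exact: measurable_fst.
apply: measurable_funM => //.
exact: (measurable_coord i (oracle_measurable L_gt0 G_lip G_mean)).
Qed.

Lemma measurable_stopped_step : measurable_fun setT stopped_step.
Proof.
apply: measurable_fun_ifT; last exact: measurable_fst.
  by apply: (measurableT_comp measurable_in_ball); exact: measurable_fst.
exact: measurable_sgd_move.
Qed.

Definition ball_set : set (borel_rV R d) := [set x | in_ball x].

Lemma measurable_ball_set : measurable ball_set.
Proof.
have := measurable_in_ball measurableT (Y := [set true]) I.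
by rewrite setTI.
Qed.

Definition survival (n : nat) (x : borel_rV R d) : \bar R :=
  hitting D stopped_step ball_set n x.

Local Open Scope ereal_scope.

Lemma survival_ge0 n x : 0 <= survival n x.
Proof. exact: hitting_ge0. Qed.

Lemma survival_le1 n x : survival n x <= 1.
Proof. exact: (hitting_le1 D measurable_stopped_step n x measurable_ball_set). Qed.

Lemma measurable_survival n : measurable_fun setT (survival n).
Proof. exact: (measurable_hitting D measurable_stopped_step n measurable_ball_set). Qed.

Lemma survival0 x : in_ball x -> survival 0 x = 1.
Proof. by move=> xb; rewrite /survival /= indicE mem_set. Qed.

Lemma survival_out n x : ~~ in_ball x -> survival n x = 0.
Proof.
move=> xb; elim: n => [|n IH].
  by rewrite /survival /= indicE memNset //; exact/negP.
rewrite /survival /=; apply: integral0_eq => z _.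
by rewrite /stopped_step /= (negbTE xb).
Qed.

Lemma survivalS n x : in_ball x ->
  survival n.+1 x = \int[D]_z survival n (x - eta *: G x z)%R.
Proof.
by move=> xb; rewrite /survival /=; apply: eq_integral => z _; rewrite /stopped_step /= xb.
Qed.

Lemma measurable_survival_step n x :
  measurable_fun setT (fun z => survival n (x - eta *: G x z)%R).
Proof.
apply: (measurableT_comp (measurable_survival n)).
apply: (measurableT_comp measurable_sgd_move (g := pair (x : borel_rV R d))).
exact: pair1_measurable.
Qed.

Lemma survival_decr n x : survival n.+1 x <= survival n x.
Proof.
have [xb|xb] := boolP (in_ball x); last by rewrite !survival_out.
elim: n x xb => [|n IH] x xb; first by rewrite (survival0 xb) survival_le1.
rewrite !survivalS //; apply: ge0_le_integral => //.
- by move=> z _; exact: survival_ge0.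
- exact: measurable_survival_step.
- exact: measurable_survival_step.
- move=> z _; have [yb|yb] := boolP (in_ball (x - eta *: G x z)%R); first exact: IH.
  by rewrite !survival_out.
Qed.

Lemma survival_anti n k x : survival (n + k) x <= survival n x.
Proof.
elim: k => [|k IH]; first by rewrite addn0.
by rewrite addnS; apply: le_trans IH; exact: survival_decr.
Qed.

(** Markov property: after [k] steps in the ball, the next [j] steps cost a factor [c] from wherever
    the iterate is. *)
Lemma survival_mul (c : R) j : (0 <= c)%R ->
  (forall x, in_ball x -> survival j x <= c%:E) ->
  forall k x, survival (k + j) x <= c%:E * survival k x.
Proof.
move=> c0 jc; elim=> [|k IH] x.
  have [xb|xb] := boolP (in_ball x); last by rewrite !survival_out // mule0.
  by rewrite survival0 // mule1 add0n jc.
have [xb|xb] := boolP (in_ball x); last by rewrite !survival_out // mule0.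
rewrite addSn !survivalS // -ge0_integralZl //; last 2 first.
- exact: measurable_survival_step.
- by move=> z _; exact: survival_ge0.
apply: ge0_le_integral => //.
- by move=> z _; exact: survival_ge0.
- exact: measurable_survival_step.
- by apply: measurable_funeM; exact: measurable_survival_step.
Qed.

Lemma survival_iter (c : R) j : (0 <= c)%R ->
  (forall x, in_ball x -> survival j x <= c%:E) ->
  forall m x, survival (m * j) x <= (c ^+ m)%:E.
Proof.
move=> c0 jc; elim=> [|m IH] x; first by rewrite mul0n expr0 survival_le1.
rewrite mulSn addnC; apply: le_trans (survival_mul c0 jc _ _) _.
by rewrite exprS EFinM lee_wpmul2l // lee_fin.
Qed.

Section block.
Context (v : 'rV[R]_d) (lamb : R) (n : nat).
Hypotheses (lamb_ge0 : (0 <= lamb)%R) (v1 : enorm v = 1%R).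
Hypothesis vH : (v *m hessian f x0 = - lamb *: v)%R.
Hypothesis H_ge : forall w : 'rV[R]_d,
  (- lamb * dot w w <= dot (w *m hessian f x0) w)%R.

Let eps : R := (eta * (rho * B))%R.
Let iota : R := ((2 * eta * L) ^+ 2)%R.
Hypothesis small_drift :
  (n%:R * (1 + 16 * eps + iota) ^+ n * (eps / 16 + eps ^+ 2 + iota) <= 1 / 20)%R.

(** Two probabilities add up to at most 1 plus that of the joint event, and joint survival is
    bounded by four times the mean final potential. Once either run has left, the sum is at most
    1. *)
Lemma survival_pair mu k u u' : (0 < mu)%R -> (4 * B <= mu)%R ->
  in_ball u -> in_ball u' ->
  survival k u + survival k u' <=
  (1 + 4 * coupling_potential v eta rho L B lamb mu k (u - u'))%:E.
Proof.
move=> mu0 muB; elim: k u u' => [|k IH] u u' ub u'b.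
  (* Two points of the ball are at most [2 * B <= mu / 2] apart, so the potential is at least 1 / 4;
     this is where the factor 4 comes from. *)
  rewrite !survival0 // -EFinD lee_fin /coupling_potential expr0 mul0r mul0r mul0r addr0.
  rewrite expr0 !mul1r.
  have a2 : (dot v (u - u') <= 2 * B)%R.
    apply: le_trans (dot_le_enorm _ _) _; rewrite v1 mul1r.
    have := enormB (u - x0) (u' - x0); rewrite opprB addrA subrK.
    by move: ub u'b; rewrite /in_ball; lra.
  have q : (dot v (u - u') / mu <= 1 / 2)%R by rewrite ler_pdivrMr //; lra.
  have : ((1 / 2) ^+ 2 <= (1 - dot v (u - u') / mu) ^+ 2)%R.
    by rewrite ler_pXn2r ?nnegrE //; lra.
  by lra.
pose z := (u - u')%R; pose m := (grad f u - grad f u')%R.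
have mL : (enorm m <= L * enorm z)%R by exact: (mean_lip L_gt0 G_lip G_mean).
have mH : (enorm (m - z *m hessian f x0) <= rho * B * enorm z)%R.
  exact: (grad_secant dg hess_lip (ltW rho_gt0) u'b ub).
have [c cP] := coupling_step eta_gt0 rho_gt0 L_gt0 B_gt0 lamb_ge0 mu0
  (hessian_sym df dg hess_lip (ltW rho_gt0) x0) v1 vH H_ge k mL mH.
have [I1 E1] := dot_mean G_mean (4 *: c) u.
have [I2 E2] := dot_mean G_mean (- (4 *: c)) u'.
have [c0 c0E] : exists c0, c0 = (1 + 4 * coupling_potential v eta rho L B lamb mu k.+1 z)%R by eexists.
rewrite -/z -c0E.
have S01 y w : 0 <= survival k (y - eta *: G y w)%R <= 1.
  by rewrite survival_ge0 survival_le1.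
have J1 : D.-integrable setT (fun z => survival k (u - eta *: G u z)%R).
  by apply: bounded_integrable => //; exact: measurable_survival_step.
have J2 : D.-integrable setT (fun z => survival k (u' - eta *: G u' z)%R).
  by apply: bounded_integrable => //; exact: measurable_survival_step.
rewrite !survivalS // -integralD //.
have -> : c0%:E = \int[D]_z ((EFin \o cst c0) z +
  ((EFin \o (fun w => dot (4 *: c) (G u w - grad f u))) z +
   (EFin \o (fun w => dot (- (4 *: c)) (G u' w - grad f u'))) z)).
  rewrite integralD //; [|exact: finite_measure_integrable_cst|exact: integrableD].
  rewrite integralD // E1 E2 !adde0 -[LHS](integral_prob_cst D) //.
apply: le_integral => //.
- exact: integrableD.
- apply: integrableD => //; first exact: finite_measure_integrable_cst.
  exact: integrableD.
move=> w _ /=; rewrite -!EFinD.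
set u1 := (u - _)%R; set u2 := (u' - _)%R.
have mm : (m + ((G u w - G u' w) - m) = G u w - G u' w)%R by rewrite addrC subrK.
have zE : (u1 - u2 = z - eta *: (m + ((G u w - G u' w) - m)))%R.
  by rewrite mm /u1 /u2 /z; apply/rowP => i; rewrite !mxE; ring.
have := cP ((G u w - G u' w) - m)%R; rewrite -zE mm => /(_ (G_lip w u u')) step_le.
have dotE : (dot (4 *: c) (G u w - grad f u) + dot (- (4 *: c)) (G u' w - grad f u') =
    4 * dot c ((G u w - G u' w) - m))%R.
  by rewrite dotNl !dotZl /m !dotBr; ring.
apply: (@le_trans _ _ (1 + 4 * coupling_potential v eta rho L B lamb mu k (u1 - u2))%:E); last first.
  by rewrite lee_fin dotE c0E; lra.
have P0 : (0 <= coupling_potential v eta rho L B lamb mu k (u1 - u2))%R.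
  exact: coupling_potential_ge0.
have le1 : 1 <= (1 + 4 * coupling_potential v eta rho L B lamb mu k (u1 - u2))%:E.
  by rewrite lee_fin; lra.
have [b1|b1] := boolP (in_ball u1); last first.
  by rewrite (survival_out _ b1) add0e; apply: le_trans (survival_le1 _ _) le1.
have [b2|b2] := boolP (in_ball u2); last first.
  by rewrite (survival_out _ b2) adde0; apply: le_trans (survival_le1 _ _) le1.
exact: IH.
Qed.

Hypothesis growth_large :
  (4 * B <= (1 + eta * lamb) ^+ n * (eta * (sigma / (4 * Num.sqrt d%:R))))%R.

(** The first step supplies the dispersion, the following [n] steps amplify it. *)
Lemma survival_block x : dispersive sigma D v (G x) -> in_ball x ->
  survival n.+1 x <= (7 / 10)%:E.
Proof.
move=> disp xb.
pose A : set 'rV[R]_d := [set w | (6 / 10)%:E < survival n (x - eta *: w)%R].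
have mA : <<s open >> A.
  have mmove : measurable_fun setT (fun w : borel_rV R d => (x - eta *: (w : 'rV[R]_d))%R : borel_rV R d).
    apply: measurable_rVP => i.
    have -> : (fun t : borel_rV R d => (x - eta *: (t : 'rV[R]_d))%R 0%R i) =
       (fun t => x 0 i - eta * (t : 'rV[R]_d) 0 i)%R.
      by apply/funext => t; rewrite !mxE.
    apply: measurable_funB => //; apply: measurable_funM => //.
    exact: (measurable_coord i (@measurable_id _ (borel_rV R d) setT)).
  have := emeasurable_fun_o_infty measurableT (measurableT_comp (measurable_survival n) mmove) (6 / 10)%:E.
  by rewrite setTI.
have mxi : measurable_fun setT (fun z => G x z : borel_rV R d).
  by apply: measurable_rVP => i; exact: (oracle_measurable_coord G_mean).
have mA' : measurable (G x @^-1` A) by rewrite -[X in measurable X]setTI; exact: mxi.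
have sd0 : (0 < sigma / (4 * Num.sqrt d%:R))%R.
  by rewrite divr_gt0 // mulr_gt0 // sqrtr_gt0 ltr0n.
have narrowA : narrow (sigma / (4 * Num.sqrt d%:R)) v A.
  move=> w q Aw qge Aqw.
  have q0 : (0 < q)%R by exact: lt_le_trans qge.
  pose u := (x - eta *: w)%R; pose u' := (x - eta *: (w + q *: v))%R.
  have pos_in y : (6 / 10)%:E < survival n y -> in_ball y.
    move=> h; apply/negPn/negP => nb; move: h; rewrite survival_out // lte_fin.
    by rewrite ltNge divr_ge0.
  have ub := pos_in _ Aw; have u'b := pos_in _ Aqw.
  (* The starting points differ by [(eta * q) *: v], so this choice cancels the first term of the
     potential. The second one is at most 1 / 20, whereas two survival probabilities above 6 / 10
     would sum to more than 1 + 4 / 20. *)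
  pose mu := ((1 + eta * lamb) ^+ n * (eta * q))%R.
  have g0 : (0 < (1 + eta * lamb) ^+ n)%R.
    by rewrite exprn_gt0 // ltr_wpDr // mulr_ge0 // ltW.
  have mu0 : (0 < mu)%R by rewrite !mulr_gt0.
  have muB : (4 * B <= mu)%R.
    apply: le_trans growth_large _; rewrite ler_wpM2l ?(ltW g0) //.
    by rewrite ler_wpM2l // ltW.
  have := survival_pair n mu0 muB ub u'b.
  have uu : (x - eta *: w - (x - eta *: (w + q *: v)) = (eta * q) *: v)%R.
    by apply/rowP => i; rewrite !mxE; ring.
  have vv : dot v v = 1%R by rewrite -enorm_sqr v1 expr1n.
  rewrite uu /coupling_potential dotZr vv mulr1 enormZ v1 mulr1.
  rewrite (gtr0_norm (mulr_gt0 eta_gt0 q0)) divff ?gt_eqF // subrr expr0n /= mulr0 add0r.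
  rewrite expr1n mulr1 => le_sum.
  have : (6 / 10)%:E + (6 / 10)%:E < (1 + 4 * (1 / 20))%:E :> \bar R.
    apply: lt_le_trans (lteD Aw Aqw) (le_trans le_sum _).
    by rewrite lee_fin lerD2l ler_pM2l.
  by rewrite -EFinD lte_fin; lra.
have DA := disp A mA narrowA.
rewrite survivalS //.
(* Survival is at most 6 / 10 off [A] and 1 on [A], and 6 / 10 + 4 / 10 * 1 / 4 = 7 / 10. *)
apply: (@le_trans _ _ (\int[D]_z ((6 / 10)%:E + (4 / 10)%:E * (\1_(G x @^-1` A) z)%:E))).
  apply: ge0_le_integral => //.
  - by move=> z _; exact: survival_ge0.
  - exact: measurable_survival_step.
  - apply: emeasurable_funD => //; apply: measurable_funeM.
    by apply/measurable_EFinP; exact: measurable_indic.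
  move=> z _; rewrite indicE; case: (boolP (z \in _)) => [_|].
    by rewrite mule1 -EFinD (_ : 6 / 10 + 4 / 10 = 1)%R ?survival_le1 //; field.
  by rewrite notin_setE /= => /negP; rewrite -leNgt mule0 adde0.
rewrite ge0_integralD //; last first.
  by apply: measurable_funeM; apply/measurable_EFinP; exact: measurable_indic.
rewrite (integral_prob_cst D (6 / 10)%R) ge0_integralZl //; last first.
  by apply/measurable_EFinP; exact: measurable_indic.
rewrite integral_indic // setIT.
apply: (@le_trans _ _ ((6 / 10)%:E + (4 / 10)%:E * (1 / 4)%:E)).
  by rewrite leeD2l // lee_wpmul2l // lee_fin.
by rewrite -EFinM -EFinD lee_fin; lra.
Qed.

End block.

End escape.

(** * Supermartingales of an epoch *)

Section epoch_bounds.
Context (R : realType) (d : nat) (f : 'rV[R]_d -> R).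
Context (L sigma rho eta B delta p : R) (K : nat).
Hypotheses (L_gt0 : 0 < L) (sigma_gt0 : 0 < sigma) (rho_gt0 : 0 < rho).
Hypotheses (eta_gt0 : 0 < eta) (B_gt0 : 0 < B) (p_gt0 : 0 < p) (d_gt0 : (0 < d)%N).
Hypothesis df : forall x, differentiable f x.
Hypothesis dg : forall x, differentiable (grad f) x.
Hypothesis hess_lip : forall x x',
  spectral_norm (hessian f x - hessian f x') <= rho * enorm (x - x').
Hypothesis g_lip : forall x x', enorm (grad f x - grad f x') <= L * enorm (x - x').

Let l1 := ln (48 * K%:R / p).
Hypothesis K_large : 64 * 110 <= K%:R :> R.
Hypothesis horizon_ge : 1 <= rho * B * (eta * K%:R) * 16.
Hypothesis horizon_le : rho * B * (eta * K%:R) * 16 <= 1 + 1 / (64 * 110).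
Hypothesis eta_L : eta * L <= 1 / 64.
Hypothesis eta_sigma : eta * sigma * 100 <= B.
Hypothesis step_le : eta * sigma ^+ 2 * 64 * l1 * (3 + ln K%:R) <= rho * B ^+ 3.
Hypothesis l1_ge : 11 <= l1.
Hypothesis lnK_ge : 8 <= ln K%:R :> R.
Implicit Types (x h b r xi S : 'rV[R]_d).

Let K_gt0 : 0 < K%:R :> R. Proof. by apply: lt_le_trans K_large; rewrite mulr_gt0. Qed.

Let l1_ge0 : 0 <= l1. Proof. by apply: le_trans l1_ge. Qed.

(** Discretization of w' = - 2 * eta * w^2, the decrease that the energy estimate requires. Starting
    at [K] rather than 0 makes the weight lose only half of its value during an epoch, so that a
    penalty of about [4 * rho * B] is left at the end. *)
Definition weight (k : nat) : R := (2 * eta * (K + k)%:R)^-1.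
Definition remainder_bound : R := rho * B ^+ 2 / 2.
Definition noise_budget (n : nat) : R :=
  n%:R * (10 * eta * remainder_bound ^+ 2) +
  eta * sigma ^+ 2 * (\sum_(i < n) i.+1%:R^-1 + n%:R * (2 * K%:R)^-1).
Definition theta : R := (128 * eta * sigma ^+ 2)^-1.
(** The accumulated drift plus the deviation whose exponential weight is [expR (- l1)], that is
    [p / (48 * K%:R)]. *)
Definition threshold : R := noise_budget K + l1 / theta.

Lemma theta_gt0 : 0 < theta.
Proof. by rewrite invr_gt0 !mulr_gt0 ?exprn_gt0. Qed.

Lemma harmonic_le (n : nat) : (0 < n)%N -> \sum_(i < n) i.+1%:R^-1 <= 1 + ln n%:R :> R.
Proof.
elim: n => // -[|n] IH _; first by rewrite big_ord_recr big_ord0 /= add0r invr1 ln1 addr0.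
rewrite big_ord_recr /=.
have n1 : 0 < n.+1%:R :> R by rewrite ltr0n.
have n2 : 0 < n.+2%:R :> R by rewrite ltr0n.
have : ln (n.+1%:R / n.+2%:R) <= - n.+2%:R^-1 :> R.
  have -> : n.+1%:R / n.+2%:R = 1 + - n.+2%:R^-1 :> R.
    apply: (mulIf (lt0r_neq0 n2)); rewrite mulrDl mulNr mulVf ?mul1r ?divfK ?lt0r_neq0 //.
    by rewrite -(@natr1 _ n.+1) addrK.
  by apply: le_ln1Dx; rewrite ltrN2 invf_lt1 // ltr1n.
rewrite ln_div ?posrE // => h.
move: (IH isT) h; move: (\sum_(i < n.+1) _) (n.+2%:R^-1) (ln _) (ln _) => *; lra.
Qed.

Lemma threshold_le : threshold <= 35 / 100 * (rho * B ^+ 3).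
Proof.
have X0 : 0 < rho * B ^+ 3 by rewrite mulr_gt0 ?exprn_gt0.
have e0 : 0 <= eta * sigma ^+ 2 by rewrite mulr_ge0 ?sqr_ge0 // ltW.
have K0 : (0 < K)%N by rewrite -(ltr0n R).
have h1 : K%:R * (10 * eta * remainder_bound ^+ 2) <= 16 / 100 * (rho * B ^+ 3).
  have -> : K%:R * (10 * eta * remainder_bound ^+ 2) =
     10 / 64 * (rho * B * (eta * K%:R) * 16) * (rho * B ^+ 3).
    by rewrite /remainder_bound; field.
  by rewrite ler_pM2r //; have := horizon_le; lra.
have h2 : \sum_(i < K) i.+1%:R^-1 + K%:R * (2 * K%:R)^-1 <= 3 + ln K%:R :> R.
  have -> : K%:R * (2 * K%:R)^-1 = 1 / 2 :> R by field; rewrite gt_eqF.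
  by have := harmonic_le K0; lra.
(* Both logarithmic factors in [step_le] are at least 11. Dropping one or the other bounds
   [l1 / theta] by 128 / 704 and the harmonic part by 1 / 704 of [rho * B ^+ 3]; with 16 / 100 for
   the Taylor remainders the total is below 35 / 100. *)
have l20 : 11 <= 3 + ln K%:R :> R by have := lnK_ge; lra.
have h3 : eta * sigma ^+ 2 * l1 * (64 * 11) <= rho * B ^+ 3.
  apply: le_trans step_le.
  have -> : eta * sigma ^+ 2 * l1 * (64 * 11) = eta * sigma ^+ 2 * 64 * l1 * 11 by ring.
  have q0 : 0 <= eta * sigma ^+ 2 * 64 * l1 by do 2 (apply: mulr_ge0 => //).
  exact: (ler_wpM2l q0 l20).
have h4 : eta * sigma ^+ 2 * (3 + ln K%:R) * (64 * 11) <= rho * B ^+ 3.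
  apply: le_trans step_le.
  have -> : eta * sigma ^+ 2 * (3 + ln K%:R) * (64 * 11) = eta * sigma ^+ 2 * 64 * 11 * (3 + ln K%:R) by ring.
  apply: ler_wpM2r; first by lra.
  by apply: ler_wpM2l => //; rewrite mulr_ge0.
have h5 := ler_wpM2l e0 h2.
rewrite /threshold /noise_budget /theta invrK; lra.
Qed.

Lemma weight_gt0 k : 0 < weight k.
Proof. by rewrite invr_gt0 !mulr_gt0 // ltr0n addn_gt0 -(ltr0n R) K_gt0. Qed.

Lemma weight_step k : weight k.+1 + 2 * eta * weight k.+1 ^+ 2 <= weight k.
Proof.
have m0 : 0 < (K + k)%:R :> R by rewrite ltr0n addn_gt0 -(ltr0n R) K_gt0.
rewrite /weight addnS -(@natr1 _ (K + k)); move: ((K + k)%:R) m0 => m m0.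
have m1 : 0 < m + 1 by rewrite addr_gt0.
rewrite -subr_ge0.
have -> : (2 * eta * m)^-1 - ((2 * eta * (m + 1))^-1 + 2 * eta * (2 * eta * (m + 1))^-1 ^+ 2) =
   (2 * eta * m * (m + 1) ^+ 2)^-1 by field; rewrite !gt_eqF.
by rewrite invr_ge0 !mulr_ge0 ?exprn_ge0 // ltW.
Qed.

Lemma eta_weight k : eta * weight k <= (2 * K%:R)^-1.
Proof.
have m0 : 0 < (K + k)%:R :> R by rewrite ltr0n addn_gt0 -(ltr0n R) K_gt0.
have -> : eta * weight k = (2 * (K + k)%:R)^-1.
  by rewrite /weight; move: ((K + k)%:R) m0 => m m0; field; rewrite !gt_eqF.
by rewrite lef_pV2 ?posrE ?mulr_gt0 // ler_pM2l // ler_nat leq_addr.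
Qed.

Lemma eta_weight_small k : 0 <= eta * weight k <= 1 / 64.
Proof.
rewrite mulr_ge0 ?(ltW eta_gt0) ?(ltW (weight_gt0 k)) //=.
apply: le_trans (eta_weight k) _.
rewrite div1r lef_pV2 ?posrE ?mulr_gt0 //.
by have := K_large; lra.
Qed.

Section anchor.
Context (x0 : 'rV[R]_d) (Q : 'M[R]_d) (lam : 'I_d -> R).
Let H := hessian f x0.
Let b := grad f x0.
Hypothesis QQ : Q *m Q^T = 1%:M.
Hypothesis HQ : forall (x : 'rV[R]_d) i, (x *m H *m Q) 0 i = lam i * (x *m Q) 0 i.

Lemma eigenvalue_bound i : - L <= lam i <= L.
Proof.
have Q'Q : Q^T *m Q = 1%:M by exact: mulmx1C.
pose e : 'rV[R]_d := delta_mx 0 i *m Q^T.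
have eQ : e *m Q = delta_mx 0 i by rewrite -mulmxA Q'Q mulmx1.
have e1 : enorm e = 1.
  by rewrite -(enorm_orthogonal QQ) eQ enormE dot_delta mxE !eqxx sqrtr1.
have := hessian_enorm_le g_lip x0 e (ltW rho_gt0) dg hess_lip.
rewrite e1 mulr1 -(enorm_orthogonal QQ) => /(le_trans (normr_coord _ i)).
by rewrite HQ eQ mxE !eqxx mulr1 ler_norml.
Qed.

Lemma eta_eigenvalue i : - (1 / 64) <= eta * lam i <= 1 / 64.
Proof.
have /andP[l0 l2] := eigenvalue_bound i.
have := ler_wpM2l (ltW eta_gt0) l0; have := ler_wpM2l (ltW eta_gt0) l2.
by have := eta_L => *; apply/andP; split; lra.
Qed.

(* Exponential supermartingale bounding the probability that the potential
   exceeds the threshold [l - k] steps later, at time [l]. *)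
Definition descent_term (k l : nat) h : R :=
  if (k <= l)%N then
    expR (theta * (potential Q lam eta b (weight k) (l - k) h +
      noise_budget (l - k) - threshold))
  else 0.

(** The coefficient of [enorm S ^+ 2] decreases as the cross terms require, down to
    [(16 * sigma ^+ 2 * K%:R)^-1] at the end; the next summand pays in advance at most
    [(8 * K%:R)^-1] for each remaining step. *)
Definition noise_term (k : nat) S : R :=
  expR ((8 * sigma ^+ 2 * (K + k)%:R)^-1 * enorm S ^+ 2 +
        (K%:R - k%:R) * (8 * K%:R)^-1 - l1).

(** A union bound over times, one supermartingale for each: the prediction is tuned to a horizon
    [l], so no single potential controls all times. *)
Definition failure_bound (k : nat) h S : R :=
  \sum_(l < K.+1) descent_term k l h + noise_term k S.

Lemma descent_term_ge0 k l h : 0 <= descent_term k l h.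
Proof. by rewrite /descent_term; case: ifP => // _; exact: expR_ge0. Qed.

Lemma failure_bound_ge0 k h S : 0 <= failure_bound k h S.
Proof.
rewrite addr_ge0 ?expR_ge0 // sumr_ge0 // => l _; exact: descent_term_ge0.
Qed.

(** The horizon [l = k] has no steps left, so its potential is the penalized quadratic model
    itself. *)
Lemma failure_bound_descent k h S : (k <= K)%N ->
  threshold < dot b h + 1 / 2 * dot (h *m H) h + weight k * enorm h ^+ 2 ->
  1 <= failure_bound k h S.
Proof.
move=> kK big; rewrite /failure_bound (bigD1 (inord k)) //=.
rewrite /descent_term inordK // leqnn subnn (potential_end QQ HQ).
have -> : noise_budget 0 = 0 by rewrite /noise_budget big_ord0 !mul0r addr0 mulr0 addr0.
apply: le_trans (_ : expR 0 <= _); first by rewrite expR0.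
rewrite -[leLHS]addr0 -addrA lerD //.
  by rewrite ler_expR addr0 mulr_ge0 ?(ltW theta_gt0) // subr_ge0 ltW.
rewrite addr_ge0 ?expR_ge0 // sumr_ge0 // => l _.
exact: descent_term_ge0.
Qed.

Lemma failure_bound_noise h S :
  16 * sigma ^+ 2 * K%:R * l1 < enorm S ^+ 2 -> 1 <= failure_bound K h S.
Proof.
move=> big; rewrite -[leLHS]add0r lerD //.
  by rewrite sumr_ge0 // => l _; exact: descent_term_ge0.
rewrite -expR0 /noise_term ler_expR subrr mul0r addr0 subr_ge0.
have -> : 8 * sigma ^+ 2 * (K + K)%:R = 16 * sigma ^+ 2 * K%:R by rewrite natrD; ring.
by rewrite ler_pdivlMl ?ltW // !mulr_gt0 // exprn_gt0.
Qed.

Lemma descent_term_step k l h r : enorm r <= remainder_bound ->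
  exists c, forall xi, enorm xi <= sigma ->
    descent_term k.+1 l (h - eta *: (h *m H + b + r + xi)) <=
    descent_term k l h + dot c xi.
Proof.
move=> rR; have [kl|lk] := ltnP k l; last first.
  (* A horizon that has been reached contributes 0 from the next step on. *)
  exists 0 => xi _; rewrite /descent_term (ltnNge k l) lk /= dot0l addr0.
  exact: descent_term_ge0.
have [c cP] := potential_exp_step QQ HQ b h (l - k.+1) eta_gt0 sigma_gt0
  eta_eigenvalue (eta_weight_small k.+1) (weight_step k) rR.
pose W := expR (theta * (noise_budget (l - k.+1) - threshold)).
exists (W *: c) => xi xis; rewrite /descent_term kl (ltnW kl).
have nE : (l - k = (l - k.+1).+1)%N by rewrite subnSK.
have -> : theta * (potential Q lam eta b (weight k.+1) (l - k.+1)
   (h - eta *: (h *m H + b + r + xi)) + noise_budget (l - k.+1) - threshold) =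
   theta * (noise_budget (l - k.+1) - threshold) +
   theta * potential Q lam eta b (weight k.+1) (l - k.+1) (h - eta *: (h *m H + b + r + xi)).
  by ring.
rewrite expRD dotZl -/W; have W0 : 0 < W by exact: expR_gt0.
apply: le_trans (ler_wpM2l (ltW W0) (cP xi xis)) _.
rewrite mulrDr lerD2r /W -expRD ler_expR -mulrDr ler_pM2l ?theta_gt0 // nE.
have -> : noise_budget (l - k.+1).+1 = noise_budget (l - k.+1) +
   10 * eta * remainder_bound ^+ 2 +
   eta * sigma ^+ 2 * ((l - k.+1).+1%:R^-1 + (2 * K%:R)^-1).
  rewrite /noise_budget big_ord_recr /=.
  move: (\sum_(i < _) _) ((l - k.+1).+1%:R^-1) => s1 s2.
  rewrite -(@natr1 _ (l - k.+1)); ring.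
have := eta_weight k.+1.
have e0 : 0 <= eta * sigma ^+ 2 by rewrite mulr_ge0 ?sqr_ge0 // ltW.
move=> /(ler_wpM2l e0).
move: (potential _ _ _ _ _ _ _) (_.+1%:R^-1) (_^-1) => *; lra.
Qed.

Lemma noise_term_step k S :
  exists c, forall xi, enorm xi <= sigma ->
    noise_term k.+1 (S + xi) <= noise_term k S + dot c xi.
Proof.
have m0 : 0 < (K + k)%:R :> R by rewrite ltr0n addn_gt0 -(ltr0n R) K_gt0.
have s0 : 0 < sigma ^+ 2 by rewrite exprn_gt0.
pose al k := (8 * sigma ^+ 2 * (K + k)%:R)^-1.
have al0 : 0 <= al k.+1 by rewrite invr_ge0; do 2 apply: mulr_ge0 => //; exact: ltW.
have al_step : al k.+1 + 8 * sigma ^+ 2 * al k.+1 ^+ 2 <= al k.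
  rewrite /al addnS -(@natr1 _ (K + k)); move: ((K + k)%:R) m0 => m m0.
  have m1 : 0 < m + 1 by rewrite addr_gt0.
  rewrite -subr_ge0.
  have -> : (8 * sigma ^+ 2 * m)^-1 - ((8 * sigma ^+ 2 * (m + 1))^-1 +
      8 * sigma ^+ 2 * (8 * sigma ^+ 2 * (m + 1))^-1 ^+ 2) =
     (8 * sigma ^+ 2 * m * (m + 1) ^+ 2)^-1 by field; rewrite !gt_eqF.
  by rewrite invr_ge0 !mulr_ge0 ?exprn_ge0 // ltW.
have [c cP] := sqnorm_exp_step S al0 (ltW sigma_gt0) al_step.
pose W := expR ((K%:R - k.+1%:R) * (8 * K%:R)^-1 - l1).
have W0 : 0 < W by exact: expR_gt0.
exists (W *: c) => xi xis.
rewrite /noise_term -/(al _) -/(al _) -addrA expRD mulrC dotZl -/W.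
apply: le_trans (ler_wpM2l (ltW W0) (cP xi xis)) _.
rewrite mulrDr lerD2r /W -expRD ler_expR.
have : al k.+1 * sigma ^+ 2 <= (8 * K%:R)^-1.
  have m1 : 0 < (K + k.+1)%:R :> R by rewrite addnS ltr0n.
  have -> : al k.+1 * sigma ^+ 2 = (8 * (K + k.+1)%:R)^-1.
    by rewrite /al; move: ((K + k.+1)%:R) m1 => m m1; field; rewrite !gt_eqF.
  by rewrite lef_pV2 ?posrE ?mulr_gt0 // ler_pM2l // ler_nat leq_addr.
rewrite -[k.+1%:R]natr1; move: (al k * _) (al k.+1 * _) => t1 t2.
by move: ((8 * K%:R)^-1) => t3 h1; lra.
Qed.

Lemma failure_bound_step k x S : enorm (x - x0) <= B ->
  exists c, forall xi, enorm xi <= sigma ->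
    failure_bound k.+1 (x - eta *: (grad f x + xi) - x0) (S + xi) <=
    failure_bound k (x - x0) S + dot c xi.
Proof.
move=> xB.
pose h := x - x0.
pose r := grad f x - b - h *m H.
have rR : enorm r <= remainder_bound.
  have := grad_taylor dg hess_lip (ltW rho_gt0) x0 h.
  have -> : x0 + h = x by rewrite addrC subrK.
  move=> /le_trans; apply.
  rewrite /remainder_bound mulrAC ler_pM2r // ler_pM2l //.
  by rewrite ler_pXn2r ?nnegrE ?enorm_ge0 // ltW.
have [c cP] := fin_all_exists (fun l : 'I_K.+1 => descent_term_step k l h rR).
have [c' c'P] := noise_term_step k S.
exists (\sum_l c l + c') => xi xis.
have -> : x - eta *: (grad f x + xi) - x0 = h - eta *: (h *m H + b + r + xi).
  have -> : h *m H + b + r = grad f x by rewrite addrC /r addrA !subrK.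
  by rewrite addrAC.
rewrite /failure_bound dotDl [leRHS]addrACA; apply: lerD; last by apply: c'P.
have -> : dot (\sum_l c l) xi = \sum_l dot (c l) xi.
  by apply: (big_morph (fun u => dot u xi)) => [u v|]; rewrite ?dotDl ?dot0l.
rewrite -big_split /=; apply: ler_sum => l _; exact: cP.
Qed.

(** Each of the [K.+1] horizons contributes at most [p / (48 * K%:R)] and the noise at most twice
    that, with ample room below p / 3. *)
Lemma failure_bound_start : failure_bound 0 0 0 <= p / 3.
Proof.
have K0 : 0 < 48 * K%:R / p by rewrite divr_gt0 // mulr_gt0.
have el1 : expR (- l1) = p / (48 * K%:R).
  by rewrite expRN lnK ?posrE // invf_div.
have nt : noise_term 0 0 <= 2 * (p / (48 * K%:R)).
  rewrite /noise_term enorm0 expr0n /= mulr0 add0r subr0 expRD el1.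
  rewrite ler_pM2r ?divr_gt0 ?mulr_gt0 //.
  have -> : K%:R * (8 * K%:R)^-1 = 8^-1 :> R by field; rewrite gt_eqF.
  have := @expR_ge1Dx R (- 8^-1); rewrite expRN => h.
  have e0 := expR_gt0 (8^-1 : R).
  have : (1 + - 8^-1) * expR (8^-1) <= (1 : R) by rewrite -ler_pdivlMr // div1r.
  by lra.
have budget_mono n m : (n <= m)%N -> noise_budget n <= noise_budget m.
  move=> nm; apply: lerD.
    by rewrite ler_wpM2r ?ler_nat // !mulr_ge0 ?sqr_ge0 // ltW.
  apply: ler_wpM2l; first by rewrite mulr_ge0 ?sqr_ge0 // ltW.
  apply: lerD.
    rewrite -(big_mkord xpredT (fun i => i.+1%:R^-1)) -(big_mkord xpredT (fun i => i.+1%:R^-1)).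
    by rewrite (big_cat_nat (leq0n n) nm) /= lerDl sumr_ge0.
  by rewrite ler_wpM2r ?ler_nat // invr_ge0 mulr_ge0.
have dt (l : 'I_K.+1) : descent_term 0 l 0 <= p / (48 * K%:R).
  rewrite /descent_term leq0n subn0 -el1 ler_expR.
  have := theta_gt0 => th0.
  rewrite -ler_pdivlMl //.
  have : potential Q lam eta b (weight 0) l 0 <= 0.
    apply: potential_start => //.
    - by move=> i; have /andP[] := eta_eigenvalue i.
    - exact: ltW (weight_gt0 0).
    - rewrite /weight addn0; have -> : (2 * eta * K%:R)^-1 * eta * l%:R = l%:R / (2 * K%:R).
        by field; rewrite !gt_eqF.
      rewrite ler_pdivrMr ?mulr_gt0 // mul1r.
      have : l%:R <= K%:R :> R by rewrite ler_nat -ltnS.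
      by have := K_gt0; lra.
  have : noise_budget l <= noise_budget K by apply: budget_mono; rewrite -ltnS.
  have -> : theta^-1 * - l1 = - (l1 / theta) by rewrite mulrN mulrC.
  rewrite /threshold; move: (l1 / theta) => t1; lra.
apply: le_trans (lerD (ler_sum _ (fun l _ => dt l)) nt) _.
rewrite sumr_const card_ord -[_ *+ K.+1]mulr_natl -mulrDl.
rewrite mulrA ler_pdivrMr ?mulr_gt0 // mulrC.
have -> : p / 3 * (48 * K%:R) = p * (16 * K%:R) by field.
rewrite ler_pM2l // -natr1.
by have := K_large; lra.
Qed.

(** The gradient has no a priori bound, so the step that leaves the ball may be long. If it is at
    most [B / 10], the cubic Taylor error at [x'] is still small and the penalty gives the decrease.
    Otherwise noise, at most a tenth of the step, cannot account for it: the step is essentially a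
    gradient step and the descent lemma at [x] gives far more than needed. *)
Lemma exit_descent k x xi : (k < K)%N -> enorm (x - x0) <= B ->
  enorm xi <= sigma ->
  let x' := x - eta *: (grad f x + xi) in
  B < enorm (x' - x0) ->
  dot b (x - x0) + 1 / 2 * dot ((x - x0) *m H) (x - x0) +
    weight k * enorm (x - x0) ^+ 2 <= threshold ->
  dot b (x' - x0) + 1 / 2 * dot ((x' - x0) *m H) (x' - x0) +
    weight k.+1 * enorm (x' - x0) ^+ 2 <= threshold ->
  f x' <= f x0 - B ^+ 2 / (7 * eta * K%:R).
Proof.
move=> kK xB xis x' x'B Vk Vk1.
have X0 : 0 < rho * B ^+ 3 by rewrite mulr_gt0 ?exprn_gt0.
have thr := threshold_le.
have gam : B ^+ 2 / (7 * eta * K%:R) <= 16 / 7 * (rho * B ^+ 3).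
  rewrite ler_pdivrMr ?mulr_gt0 //.
  have -> : 16 / 7 * (rho * B ^+ 3) * (7 * eta * K%:R) =
     B ^+ 2 * (rho * B * (eta * K%:R) * 16) by field.
  by rewrite ler_peMr // exprn_ge0 // ltW.
have [small|big] := lerP (enorm (x' - x)) (B / 10).
  have hB : enorm (x' - x0) <= 11 / 10 * B.
    have := enormD (x' - x) (x - x0); rewrite addrA subrK; lra.
  have := taylor df dg hess_lip (ltW rho_gt0) x0 (x' - x0).
  rewrite (addrC x0) subrK => T.
  have c3 : rho / 6 * enorm (x' - x0) ^+ 3 <= 23 / 100 * (rho * B ^+ 3).
    have : enorm (x' - x0) ^+ 3 <= (11 / 10 * B) ^+ 3.
      by rewrite lerXn2r ?nnegrE ?enorm_ge0 // mulr_ge0 // ltW.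
    move=> /(ler_wpM2l (ltW rho_gt0)); lra.
  have w : 39 / 10 * (rho * B ^+ 3) <= weight k.+1 * enorm (x' - x0) ^+ 2.
    apply: le_trans (_ : weight k.+1 * B ^+ 2 <= _); last first.
      rewrite ler_wpM2l ?(ltW (weight_gt0 _)) // ler_pXn2r ?nnegrE ?enorm_ge0 ?(ltW B_gt0) //.
      exact: ltW.
    have -> : 39 / 10 * (rho * B ^+ 3) = (39 / 10 * (rho * B)) * B ^+ 2 by ring.
    rewrite ler_wpM2r ?sqr_ge0 // -[leRHS]div1r ler_pdivlMr; last first.
      by rewrite !mulr_gt0 // ltr0n addn_gt0 -(ltr0n R) K_gt0.
    have kk : (K + k.+1)%:R <= 2 * K%:R :> R.
      by rewrite natrD mulr_natl mulr2n lerD2l ler_nat.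
    have q0 : 0 <= 39 / 10 * (rho * B) * (2 * eta) by rewrite !mulr_ge0 // ltW.
    by have := ler_wpM2l q0 kk; have := horizon_le; lra.
  by move: (dot b _) (dot (_ *m H) _) Vk1 T => t1 t2; lra.
have fx : f x <= f x0 + 52 / 100 * (rho * B ^+ 3).
  have := taylor df dg hess_lip (ltW rho_gt0) x0 (x - x0).
  rewrite (addrC x0) subrK => T.
  have c3 : rho / 6 * enorm (x - x0) ^+ 3 <= 17 / 100 * (rho * B ^+ 3).
    have : enorm (x - x0) ^+ 3 <= B ^+ 3.
      by rewrite lerXn2r ?nnegrE ?enorm_ge0 // ltW.
    move=> /(ler_wpM2l (ltW rho_gt0)); lra.
  have w : 0 <= weight k * enorm (x - x0) ^+ 2.
    by rewrite mulr_ge0 ?sqr_ge0 // ltW // weight_gt0.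
  by move: (dot b _) (dot (_ *m H) _) Vk T => t1 t2; lra.
have DD := descent_lemma df g_lip x (x' - x).
rewrite (addrC x) subrK in DD.
set D := enorm (x' - x) in big DD.
have D0 : 0 < D by apply: lt_trans big; rewrite divr_gt0.
have x'x : x' - x = - (eta *: (grad f x + xi)) by rewrite /x' addrC addKr.
have gE : eta * dot (grad f x) (x' - x) <= - D ^+ 2 + eta * sigma * D.
  have -> : eta * dot (grad f x) (x' - x) = - dot (x' - x) (x' - x) - eta * dot xi (x' - x).
    rewrite {2}x'x dotNl dotZl dotDl; ring.
  rewrite -enorm_sqr -/D lerD2l -mulrN -mulrA ler_pM2l // -dotNl.
  apply: le_trans (dot_le_enorm _ _) _; rewrite enormN ler_wpM2r //.
  exact: ltW.
have es : eta * sigma * D <= D ^+ 2 / 10.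
  have : eta * sigma <= D / 10 by have := eta_sigma; lra.
  by move=> /(ler_wpM2r (ltW D0)); lra.
have eLD : eta * (L / 2 * D ^+ 2) <= D ^+ 2 / 128.
  by have := ler_wpM2r (sqr_ge0 D) eta_L; lra.
have drop : eta * (f x' - f x) <= - (8 / 10) * D ^+ 2.
  have : eta * (f x' - f x) <= eta * (dot (grad f x) (x' - x) + L / 2 * D ^+ 2).
    by rewrite ler_pM2l //; lra.
  have := sqr_ge0 D; lra.
have B2 : B ^+ 2 / 100 <= D ^+ 2.
  have -> : B ^+ 2 / 100 = (B / 10) ^+ 2 by field.
  by rewrite ler_pXn2r ?nnegrE ?divr_ge0 ?(ltW B_gt0) ?(ltW D0) // ltW.
have eX : eta * (rho * B ^+ 3) * (60 * 100) <= B ^+ 2.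
  have q0 : 0 <= rho * B * eta * 16 by rewrite !mulr_ge0 // ltW.
  have h := ler_wpM2l q0 K_large.
  have : rho * B * eta * (60 * 100) <= 1 by have := horizon_le; lra.
  move=> /(ler_wpM2r (sqr_ge0 B)); lra.
rewrite -(ler_pM2l eta_gt0).
have := ler_wpM2l (ltW eta_gt0) fx; have := ler_wpM2l (ltW eta_gt0) gam.
have : 0 < eta * (rho * B ^+ 3) by rewrite mulr_gt0.
lra.
Qed.

Hypothesis rhoB_delta : rho * B <= delta.

(** In units of [rho * B ^+ 2], the gradient at the average receives 16 from the displacement
    [B / (eta * K%:R)], 3 / 4 from the noise, and 1 / 2 each from the remainders along the epoch and
    at the average: less than 18. The Hessian moves by at most [rho * B <= delta], which turns 16
    into 17. *)
Lemma output_stationary x acc S :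
  enorm (x - x0) <= B ->
  enorm (acc - K%:R *: x0) <= K%:R * B ->
  enorm (eta^-1 *: (x0 - x) - (K%:R *: b + (acc - K%:R *: x0) *m H) - S) <=
    K%:R * remainder_bound ->
  enorm S ^+ 2 <= 16 * sigma ^+ 2 * K%:R * l1 ->
  - (16 * delta) <= lambda_min H ->
  forall y, y = K%:R^-1 *: acc ->
  enorm (grad f y) <= 18 * rho * B ^+ 2 /\ - (17 * delta) <= lambda_min (hessian f y).
Proof.
move=> xB accB inv Sle lmin y yE.
pose h := y - x0.
have hE : h = K%:R^-1 *: (acc - K%:R *: x0).
  by rewrite /h yE scalerBr scalerA mulVf ?scale1r // gt_eqF.
have Ki0 : 0 < K%:R^-1 :> R by rewrite invr_gt0.
have hB : enorm h <= B.
  by rewrite hE enormZ gtr0_norm // ler_pdivrMl.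
have T0 : 0 < eta * K%:R by rewrite mulr_gt0.
split; last first.
  have comb (a a' q r : R) : - (16 * delta) * q <= a -> a - a' <= r -> r <= delta * q ->
      - (17 * delta) * q <= a' by lra.
  have symH x1 := hessian_sym df dg hess_lip (ltW rho_gt0) x1.
  apply/(lambda_min_geP (symH _) d_gt0) => v.
  have h0 := (lambda_min_geP (symH x0) d_gt0 _).1 lmin v.
  have := hessian_dot_le hess_lip v v x0 y.
  have -> : dot v (v *m (hessian f x0 - hessian f y)) = dot (v *m H) v - dot (v *m hessian f y) v.
    rewrite mulmxBr dotBr.
    by congr (_ - _); apply: dotC.
  move=> h1.
  have h2 : rho * enorm (x0 - y) * enorm v * enorm v <= delta * enorm v ^+ 2.
    rewrite expr2 mulrA ler_wpM2r ?enorm_ge0 // ler_wpM2r ?enorm_ge0 //.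
    by apply: le_trans rhoB_delta; rewrite ler_pM2l // enorm_sub.
  rewrite enorm_sqr in h2; exact: comb h0 h1 h2.
have -> : y = x0 + h by rewrite /h addrC subrK.
pose m := b + h *m H.
have t1 : enorm (grad f (x0 + h)) <= enorm m + rho / 2 * B ^+ 2.
  have := grad_taylor dg hess_lip (ltW rho_gt0) x0 h; rewrite -/b -/H => t.
  have : enorm (grad f (x0 + h) - b - h *m H) <= rho / 2 * B ^+ 2.
    apply: le_trans t _; rewrite ler_wpM2l ?divr_ge0 ?(ltW rho_gt0) //.
    by rewrite ler_pXn2r ?nnegrE ?enorm_ge0 // ltW.
  have := enormD (grad f (x0 + h) - b - h *m H) m.
  have -> : grad f (x0 + h) - b - h *m H + m = grad f (x0 + h).
    by rewrite /m [b + _]addrC addrA !subrK.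
  by move=> h1 h2; apply: le_trans h1 _; rewrite addrC lerD2l.
have mE : K%:R *: m = K%:R *: b + (acc - K%:R *: x0) *m H.
  rewrite /m scalerDr scalemxAl hE scalerA divff ?scale1r // gt_eqF //.
have Km : K%:R * enorm m <= eta^-1 * B + enorm S + K%:R * remainder_bound.
  have -> : K%:R * enorm m = enorm (K%:R *: m) by rewrite enormZ gtr0_norm.
  have -> : K%:R *: m = eta^-1 *: (x0 - x) - S -
      (eta^-1 *: (x0 - x) - (K%:R *: b + (acc - K%:R *: x0) *m H) - S).
    by rewrite mE; apply/rowP => i; rewrite !mxE; ring.
  apply: le_trans (enormB _ _) (lerD _ inv).
  apply: le_trans (enormB _ _) _; rewrite lerD2r enormZ gtr0_norm ?invr_gt0 //.
  by rewrite ler_pM2l ?invr_gt0 // enorm_sub.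
(* The step size bound gives the ratio 16 * 16 / 704 of the two squares, which is below 1 / 2. *)
have etaS : (eta * enorm S) ^+ 2 * 2 <= (eta * K%:R * (rho * B ^+ 2)) ^+ 2.
  rewrite exprMn; have h1 := ler_wpM2l (sqr_ge0 eta) Sle.
  have h2 : eta * sigma ^+ 2 * l1 * (64 * 11) <= rho * B ^+ 3.
    apply: le_trans step_le.
    have -> : eta * sigma ^+ 2 * l1 * (64 * 11) = eta * sigma ^+ 2 * 64 * l1 * 11 by ring.
    have q0 : 0 <= eta * sigma ^+ 2 * 64 * l1.
      by do 2 (apply: mulr_ge0 => //); rewrite mulr_ge0 ?sqr_ge0 // ltW.
    by apply: ler_wpM2l => //; have := lnK_ge; lra.
  have h3 := ler_wpM2l (ltW T0) h2.
  have h4 : eta * K%:R * (rho * B ^+ 3) <= (eta * K%:R * (rho * B ^+ 2)) ^+ 2 * 16.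
    have q0 : 0 <= eta * K%:R * (rho * B ^+ 3).
      by rewrite mulr_ge0 ?(ltW T0) // mulr_ge0 ?exprn_ge0 // ltW.
    have -> : (eta * K%:R * (rho * B ^+ 2)) ^+ 2 * 16 =
      eta * K%:R * (rho * B ^+ 3) * (rho * B * (eta * K%:R) * 16) by ring.
    by rewrite ler_peMr.
  have := sqr_ge0 (eta * K%:R * (rho * B ^+ 2)); lra.
have etaS1 : eta * enorm S <= 3 / 4 * (eta * K%:R * (rho * B ^+ 2)).
  have q0 : 0 <= eta * K%:R * (rho * B ^+ 2).
    by rewrite mulr_ge0 ?(ltW T0) // mulr_ge0 ?exprn_ge0 // ltW.
  have e0 : 0 <= eta * enorm S by rewrite mulr_ge0 ?enorm_ge0 // ltW.
  move: (eta * enorm S) (eta * K%:R * _) e0 q0 etaS => u q u0 q0 uq.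
  rewrite -(@ler_pXn2r _ 2) ?nnegrE //; last by rewrite mulr_ge0.
  by have := sqr_ge0 q; rewrite exprMn; lra.
have BT : B <= 16 * (eta * K%:R * (rho * B ^+ 2)).
  have -> : 16 * (eta * K%:R * (rho * B ^+ 2)) = B * (rho * B * (eta * K%:R) * 16) by ring.
  by rewrite ler_peMr // ltW.
apply: le_trans t1 _.
have : enorm m <= (16 + 3 / 4 + 1 / 2) * (rho * B ^+ 2).
  rewrite -(ler_pM2l T0) -mulrA; apply: le_trans (ler_wpM2l (ltW eta_gt0) Km) _.
  rewrite mulrDr mulrDr mulrA divff ?gt_eqF // mul1r /remainder_bound; lra.
have : 0 <= rho * B ^+ 2 by rewrite mulr_ge0 ?sqr_ge0 // ltW.
lra.
Qed.

End anchor.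

End epoch_bounds.

(** * States of the algorithm *)

Section sgd_chain.
Context (R : realType) (d : nat) (dZ : measure_display) (Z : measurableType dZ).
Local Notation V := (borel_rV R d).

Lemma measurable_rVD dT (T : measurableType dT) (u v : T -> 'rV[R]_d) :
  measurable_fun setT (u : T -> V) -> measurable_fun setT (v : T -> V) ->
  measurable_fun setT (fun t => u t + v t : V).
Proof.
move=> mu mv; apply: measurable_rVP => i.
have -> : (fun t => (u t + v t) 0 i) = (fun t => u t 0 i + v t 0 i).
  by apply/funext => t; rewrite mxE.
by apply: measurable_funD; exact: measurable_coord.
Qed.

Lemma measurable_rVN dT (T : measurableType dT) (u : T -> 'rV[R]_d) :
  measurable_fun setT (u : T -> V) -> measurable_fun setT (fun t => - u t : V).
Proof.
move=> mu; apply: measurable_rVP => i.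
have -> : (fun t => (- u t) 0 i) = (fun t => - (u t 0 i)).
  by apply/funext => t; rewrite mxE.
by apply: measurableT_comp => //; exact: measurable_coord.
Qed.

(** The record of states as a product, so that it carries the product sigma-algebra. *)
Definition sgd_space := (nat * (V * (V * V)))%type.

Definition encode (s : sgd_state R d) : sgd_space :=
  (counter s, (anchor s : V, (current s : V, acc s : V))).

Definition decode (s : sgd_space) : sgd_state R d :=
  SgdState s.1 (s.2.1 : 'rV[R]_d) (s.2.2.1 : 'rV[R]_d) (s.2.2.2 : 'rV[R]_d).

Context (D : probability Z R) (G : 'rV[R]_d -> Z -> 'rV[R]_d) (f : 'rV[R]_d -> R).
Context (L eta B : R) (K : nat).
Hypothesis L_gt0 : 0 < L.
Hypothesis G_lip : forall z x x', enorm (G x z - G x' z) <= L * enorm (x - x').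
Hypothesis G_mean : forall x (i : 'I_d),
    D.-integrable setT (EFin \o (fun z => G x z 0 i)) /\
    'E_D[fun z => (G x z 0 i)%R]%E = (grad f x 0 i)%:E.

Definition space_step (p : sgd_space * Z) : sgd_space :=
  encode (sgd_step G eta B K (decode p.1) p.2).

Lemma measurable_space_step : measurable_fun setT space_step.
Proof.
have mk : measurable_fun setT (fun p : sgd_space * Z => p.1.1).
  by apply: measurableT_comp measurable_fst measurable_fst.
have ma : measurable_fun setT (fun p : sgd_space * Z => p.1.2.1).
  apply: measurableT_comp; first exact: measurable_fst.
  by apply: measurableT_comp measurable_snd measurable_fst.
have mt : measurable_fun setT (fun p : sgd_space * Z => p.1.2.2).
  apply: measurableT_comp; first exact: measurable_snd.
  by apply: measurableT_comp measurable_snd measurable_fst.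
have mc : measurable_fun setT (fun p : sgd_space * Z => p.1.2.2.1).
  by apply: measurableT_comp measurable_fst mt.
have ms : measurable_fun setT (fun p : sgd_space * Z => p.1.2.2.2).
  by apply: measurableT_comp measurable_snd mt.
pose x (p : sgd_space * Z) : V :=
  ((p.1.2.2.1 : 'rV[R]_d) - eta *: G (p.1.2.2.1 : 'rV[R]_d) p.2)%R.
have mx : measurable_fun setT x.
  apply: (measurableT_comp (f := fun q : V * Z => (q.1 : 'rV[R]_d) - eta *: G q.1 q.2 : V)
    (g := fun p : sgd_space * Z => (p.1.2.2.1, p.2))).
    exact: (measurable_sgd_move eta L_gt0 G_lip G_mean).
  by apply: measurable_fun_pair.
have -> : space_step = fun p => if (p.1.1 < K)%N then
    if B < enorm ((x p : 'rV[R]_d) - (p.1.2.1 : 'rV[R]_d)) then (0%N, (x p, (x p, (0 : 'rV[R]_d) : V)))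
    else (p.1.1.+1, (p.1.2.1, (x p, ((p.1.2.2.2 : 'rV[R]_d) + (p.1.2.2.1 : 'rV[R]_d) : V))))
  else p.1.
  apply/funext => -[[k [a [c s]]] z]; rewrite /space_step /sgd_step /=.
  by case: ifP => // _; case: ifP.
apply: measurable_fun_ifT; last exact: measurable_fst.
  by apply: (measurableT_comp (f := fun k => (k < K)%N)).
apply: measurable_fun_ifT.
- apply: measurable_fun_ltr => //.
  apply: (measurableT_comp (f := fun y : V => enorm (y : 'rV[R]_d))).
    exact: measurable_cts_rV (@enorm_cts R d).
  by apply: measurable_rVD => //; exact: measurable_rVN.
- by do ![exact: mx|exact: measurable_cst|apply: measurable_fun_pair].
- apply: measurable_fun_pair; first by apply: (measurableT_comp (f := S)).
  do ![exact: mx|exact: ma|apply: measurable_fun_pair].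
  exact: measurable_rVD.
Qed.

Lemma chain_sgd_run x0 z t :
  chain space_step (encode (SgdState 0 x0 x0 0)) z t = encode (sgd_run G eta B K x0 z t).
Proof. by elim: t => //= t ->; case: (sgd_run _ _ _ _ _ _ _). Qed.

Lemma hitting_frozen (A : set sgd_space) n s : (K <= s.1)%N ->
  hitting D space_step A n s = (\1_A s)%:E.
Proof.
move=> Ks; elim: n => // n IH /=.
under eq_integral => z _.
  have -> : space_step (s, z) = s.
    rewrite /space_step /sgd_step /= ltnNge Ks /=.
    by case: s {IH Ks} => k [a [c s]].
  rewrite IH.
  over.
exact: integral_prob_cst.
Qed.

End sgd_chain.

(** * Measurability of the set of good outcomes *)

Section good_states.
Context (R : realType) (d : nat) (f : 'rV[R]_d -> R) (L rho delta c : R) (K : nat).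
Hypothesis d_gt0 : (0 < d)%N.
Hypothesis rho_gt0 : 0 < rho.
Hypothesis df : forall x, differentiable f x.
Hypothesis dg : forall x, differentiable (grad f) x.
Hypothesis hess_lip : forall x x',
  spectral_norm (hessian f x - hessian f x') <= rho * enorm (x - x').
Hypothesis g_lip : forall x x', enorm (grad f x - grad f x') <= L * enorm (x - x').

Definition good_state (s : sgd_space R d) : Prop :=
  [/\ (K <= s.1)%N, enorm (grad f (sgd_output K (decode s))) <= c
    & - (17 * delta) <= lambda_min (hessian f (sgd_output K (decode s)))].

Lemma measurable_good : measurable [set s | good_state s].
Proof.
have mout (A : set 'rV[R]_d) : closed A ->
    measurable [set s : sgd_space R d | A (sgd_output K (decode s))].
  move=> cA.
  have mo : measurable_fun setT
      (fun s : sgd_space R d => (sgd_output K (decode s) : borel_rV R d)).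
    apply: measurable_rVP => i.
    have -> : (fun s : sgd_space R d => sgd_output K (decode s) 0 i) =
        (fun s => K%:R^-1 * (s.2.2.2 : 'rV[R]_d) 0 i).
      by apply/funext => s; rewrite mxE.
    apply: measurable_funM => //; apply: measurable_coord.
    apply: measurableT_comp; first exact: measurable_snd.
    by apply: measurableT_comp measurable_snd measurable_snd.
  by rewrite -[X in measurable X]setTI; apply: mo => //; exact: closed_measurable_rV.
have -> : [set s | good_state s] =
  [set s : sgd_space R d | (K <= s.1)%N] `&`
  ([set s | [set y | enorm (grad f y) <= c] (sgd_output K (decode s))] `&`
   [set s | [set y | - (17 * delta) <= lambda_min (hessian f y)] (sgd_output K (decode s))]).
  by apply/seteqP; split => [s []|s [? []]].
apply: measurableI; last (apply: measurableI; apply: mout).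
- have m1 : measurable_fun setT (fst : sgd_space R d -> nat) by exact: measurable_fst.
  have := m1 measurableT [set k | (K <= k)%N] I.
  by rewrite setTI.
- have cg : continuous (fun y => enorm (grad f y)).
    apply: (lipschitz_cts (C := L)) => x y.
    have := g_lip x y; have := g_lip y x; rewrite (enorm_sub y x).
    have := enormD (grad f x - grad f y) (grad f y).
    have := enormD (grad f y - grad f x) (grad f x).
    rewrite !subrK => *; rewrite ler_norml; apply/andP; split; lra.
  have -> : [set y | enorm (grad f y) <= c] = (fun y => enorm (grad f y)) @^-1` [set r | r <= c].
    by [].
  by apply: (closed_comp (fun y _ => cg y)); exact: closed_le.
- have comb (a a' q : R) : a - a' <= q -> a' - a <= q -> `|a - a'| <= q.
    by rewrite ler_norml => ? ?; apply/andP; split; lra.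
  have symH x1 := hessian_sym df dg hess_lip (ltW rho_gt0) x1.
  (* The variational characterization writes the set as an intersection of closed conditions, one
     for each vector; continuity of the least eigenvalue itself is avoided. *)
  have -> : [set y | - (17 * delta) <= lambda_min (hessian f y)] =
     \bigcap_v ((fun y => dot (v *m hessian f y) v) @^-1` [set r | - (17 * delta) * dot v v <= r]).
    apply/seteqP; split => [y /(lambda_min_geP (symH y) d_gt0) H v _ /=|y H]; first exact: H.
    by apply/(lambda_min_geP (symH y) d_gt0) => v; exact: H.
  apply: closed_bigI => v _; apply: closed_comp; last exact: closed_ge.
  move=> x _; apply: (lipschitz_cts (C := rho * enorm v * enorm v)) => {x} x y.
  have quad (M N : 'M[R]_d) : dot v (v *m (M - N)) = dot (v *m M) v - dot (v *m N) v.
    by rewrite mulmxBr dotBr; congr (_ - _); apply: dotC.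
  have h1 := hessian_dot_le hess_lip v v x y; have h2 := hessian_dot_le hess_lip v v y x.
  rewrite quad in h1; rewrite quad (enorm_sub y) in h2.
  have E : rho * enorm v * enorm v * enorm (x - y) = rho * enorm (x - y) * enorm v * enorm v by ring.
  rewrite E; exact: comb h1 h2.
Qed.

End good_states.

(** * Failure probability over all epochs *)

Section restarts.
Context (R : realType) (d : nat) (dZ : measure_display) (Z : measurableType dZ).
Context (D : probability Z R) (G : 'rV[R]_d -> Z -> 'rV[R]_d) (f : 'rV[R]_d -> R).
Context (L sigma rho eta B delta p fstar : R) (K : nat).
Hypotheses (L_gt0 : 0 < L) (sigma_gt0 : 0 < sigma) (rho_gt0 : 0 < rho).
Hypotheses (eta_gt0 : 0 < eta) (B_gt0 : 0 < B) (p_gt0 : 0 < p) (d_gt0 : (0 < d)%N).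
Hypothesis df : forall x, differentiable f x.
Hypothesis dg : forall x, differentiable (grad f) x.
Hypothesis hess_lip : forall x x',
  spectral_norm (hessian f x - hessian f x') <= rho * enorm (x - x').
Hypothesis G_lip : forall z x x', enorm (G x z - G x' z) <= L * enorm (x - x').
Hypothesis G_mean : forall x (i : 'I_d),
    D.-integrable setT (EFin \o (fun z => G x z 0 i)) /\
    'E_D[fun z => (G x z 0 i)%R]%E = (grad f x 0 i)%:E.
Hypothesis noise : forall x, {ae D, forall z, enorm (G x z - grad f x) ^+ 2 <= sigma ^+ 2}.
Hypothesis disp : forall x v, enorm v = 1 -> dispersive sigma D v (G x).
Hypothesis fstar_le : forall x, fstar <= f x.

Let l1 := ln (48 * K%:R / p).
Hypothesis K_large : 64 * 110 <= K%:R :> R.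
Hypothesis horizon_ge : 1 <= rho * B * (eta * K%:R) * 16.
Hypothesis horizon_le : rho * B * (eta * K%:R) * 16 <= 1 + 1 / (64 * 110).
Hypothesis eta_L : eta * L <= 1 / 64.
Hypothesis eta_sigma : eta * sigma * 100 <= B.
Hypothesis step_le : eta * sigma ^+ 2 * 64 * l1 * (3 + ln K%:R) <= rho * B ^+ 3.
Hypothesis l1_ge : 11 <= l1.
Hypothesis lnK_ge : 8 <= ln K%:R :> R.
Hypothesis delta_gt0 : 0 < delta.
Hypothesis rhoB_delta : rho * B <= delta.
Context (M n0 : nat).
Hypothesis escape_rounds : (7 / 10) ^+ M <= p / 3.
Hypothesis escape_time : (M * n0.+1 <= K)%N.
Hypothesis small_drift : n0%:R *
  (1 + 16 * (eta * (rho * B)) + (2 * eta * L) ^+ 2) ^+ n0 *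
  (eta * (rho * B) / 16 + (eta * (rho * B)) ^+ 2 + (2 * eta * L) ^+ 2) <= 1 / 20.
Hypothesis growth_large : forall lamb, 16 * delta <= lamb -> lamb <= L ->
  4 * B <= (1 + eta * lamb) ^+ n0 * (eta * (sigma / (4 * Num.sqrt d%:R))).
Implicit Types (x acc S xi : 'rV[R]_d).

Let g_lip := mean_lip L_gt0 G_lip G_mean.
Let K_gt0 : 0 < K%:R :> R. Proof. by apply: lt_le_trans K_large; rewrite mulr_gt0. Qed.

Definition epoch_descent : R := B ^+ 2 / (7 * eta * K%:R).

Lemma epoch_descent_gt0 : 0 < epoch_descent.
Proof. by rewrite divr_gt0 ?exprn_gt0 // !mulr_gt0. Qed.

Definition bad_states : set (sgd_space R d) :=
  ~` [set s | good_state f delta (18 * rho * B ^+ 2) K s].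

Lemma measurable_bad : measurable bad_states.
Proof. by apply: measurableC; exact: (@measurable_good R d f L rho). Qed.

Definition bad_prob (n : nat) (k : nat) x0 x acc : \bar R :=
  hitting D (space_step G eta B K) bad_states n (encode (SgdState k x0 x acc)).

Let mstep := measurable_space_step eta B K L_gt0 G_lip G_mean.

Lemma bad_prob_le1 n k x0 x acc : (bad_prob n k x0 x acc <= 1)%E.
Proof. exact: (hitting_le1 D mstep n _ measurable_bad). Qed.

(** Staying in the ball is a failure only if the anchor is a strict saddle; elsewhere it leads to
    the output. *)
Definition escape_failure x0 (j : nat) x : \bar R :=
  if lambda_min (hessian f x0) < - (16 * delta) then survival D G eta B x0 j x else 0%E.

Lemma escape_failure_ge0 x0 j x : (0 <= escape_failure x0 j x)%E.
Proof. by rewrite /escape_failure; case: ifP => // _; exact: survival_ge0. Qed.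

Lemma escape_failure_le1 x0 j x : (escape_failure x0 j x <= 1)%E.
Proof.
rewrite /escape_failure; case: ifP => // _.
exact: (survival_le1 eta B x0 L_gt0 G_lip G_mean).
Qed.

Lemma escape_failureS x0 j x : enorm (x - x0) <= B ->
  escape_failure x0 j.+1 x = (\int[D]_z escape_failure x0 j (x - eta *: G x z)%R)%E.
Proof.
move=> xB; rewrite /escape_failure; case: ifP => _; last by rewrite integral0.
exact: survivalS.
Qed.

Lemma escape_failure_start x : (escape_failure x K x <= (p / 3)%:E)%E.
Proof.
have p3 : 0 <= p / 3 by rewrite divr_ge0 // ltW.
rewrite /escape_failure; case: ifPn => [saddle|_]; last by rewrite lee_fin.
have symH := hessian_sym df dg hess_lip (ltW rho_gt0) x.
have [v [v1 vH vmin]] := lambda_min_attained symH d_gt0.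
pose lamb := - lambda_min (hessian f x).
have lamb_ge : 16 * delta <= lamb by rewrite lerNr ltW.
have lamb_ge0 : 0 <= lamb by apply: le_trans lamb_ge; rewrite mulr_ge0 // ltW.
have lamb_le : lamb <= L.
  have := hessian_enorm_le g_lip x v (ltW rho_gt0) dg hess_lip.
  by rewrite vH enormZ v1 !mulr1; apply: le_trans; rewrite -normrN ler_norm.
rewrite -[X in survival _ _ _ _ _ X _](subnKC escape_time).
apply: le_trans (survival_anti eta B x L_gt0 G_lip G_mean _ _ _) _.
apply: le_trans (_ : ((7 / 10) ^+ M)%:E <= _)%E; last by rewrite lee_fin.
apply: (survival_iter L_gt0 G_lip G_mean) => // y yB.
have vH' : v *m hessian f x = - lamb *: v by rewrite opprK.
have vmin' w : - lamb * dot w w <= dot (w *m hessian f x) w by rewrite opprK.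
exact: (survival_block L_gt0 sigma_gt0 rho_gt0 eta_gt0 B_gt0 d_gt0 df dg hess_lip
  G_lip G_mean lamb_ge0 v1 vH' vmin' small_drift (growth_large lamb_ge lamb_le) (disp y v1) yB).
Qed.

(* [S] is the sum of the noise vectors of the current epoch. *)
Definition invariant (k : nat) x0 x acc S : Prop :=
  [/\ (k <= K)%N, enorm (x - x0) <= B, enorm (acc - k%:R *: x0) <= k%:R * B
    & enorm (eta^-1 *: (x0 - x) -
        (k%:R *: grad f x0 + (acc - k%:R *: x0) *m hessian f x0) - S) <=
      k%:R * remainder_bound rho B].

Lemma invariant_start x : invariant 0 x x 0 0.
Proof.
split; rewrite ?subrr ?scale0r ?subr0 ?mul0r ?enorm0 ?(ltW B_gt0) //.
by rewrite mul0mx addr0 scaler0 !subr0 enorm0.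
Qed.

Lemma invariant_step k x0 x acc S xi : invariant k x0 x acc S -> (k < K)%N ->
  forall x', x' = x - eta *: (grad f x + xi) -> enorm (x' - x0) <= B ->
  invariant k.+1 x0 x' (acc + x) (S + xi).
Proof.
move=> [_ xB aB inv] kK x' x'E x'B.
have aE : acc + x - k.+1%:R *: x0 = (acc - k%:R *: x0) + (x - x0).
  by rewrite -(@natr1 _ k) scalerDl scale1r opprD addrACA.
split=> //.
  rewrite aE -(@natr1 _ k) mulrDl mul1r.
  by apply: le_trans (enormD _ _) _; exact: lerD.
have gt : enorm (grad f x - grad f x0 - (x - x0) *m hessian f x0) <= remainder_bound rho B.
  have := grad_taylor dg hess_lip (ltW rho_gt0) x0 (x - x0).
  have -> : x0 + (x - x0) = x by rewrite addrC subrK.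
  move=> /le_trans; apply.
  rewrite /remainder_bound mulrAC ler_pM2r // ler_pM2l //.
  by rewrite ler_pXn2r ?nnegrE ?enorm_ge0 // ltW.
rewrite aE mulmxDl -(@natr1 _ k) scalerDl scale1r mulrDl mul1r.
have -> : eta^-1 *: (x0 - x') = eta^-1 *: (x0 - x) + (grad f x + xi).
  rewrite x'E opprD opprK addrA scalerDr scalerA mulVf ?scale1r //.
  by rewrite gt_eqF.
move: (eta^-1 *: _) (grad f x) (grad f x0) ((acc - _) *m _) ((x - x0) *m _) gt inv
  => y gx b a h gt inv.
have -> : y + (gx + xi) - (k%:R *: b + b + (a + h)) - (S + xi) =
   (y - (k%:R *: b + a) - S) + (gx - b - h).
  by apply/rowP => i; rewrite !mxE; ring.
by apply: le_trans (enormD _ _) _; exact: lerD.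
Qed.

Lemma sgd_stepE k x0 x acc z : (k < K)%N ->
  space_step G eta B K (encode (SgdState k x0 x acc), z) =
  let x' := x - eta *: G x z in
  if B < enorm (x' - x0) then encode (SgdState 0 x' x' 0)
  else encode (SgdState k.+1 x0 x' (acc + x)).
Proof. by move=> kK; rewrite /space_step /sgd_step /= kK; case: ifP. Qed.

Section spectral_data.
Context (Q : 'rV[R]_d -> 'M[R]_d) (lam : 'rV[R]_d -> 'I_d -> R).
Hypothesis QQ : forall x0, Q x0 *m (Q x0)^T = 1%:M.
Hypothesis HQ : forall x0 (x : 'rV[R]_d) i,
  (x *m hessian f x0 *m Q x0) 0 i = lam x0 i * (x *m Q x0) 0 i.

Let failure x0 k x S := failure_bound f sigma rho eta B p K x0 (Q x0) (lam x0) k (x - x0) S.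
Let level x0 k x := dot (grad f x0) (x - x0) + 1 / 2 * dot ((x - x0) *m hessian f x0) (x - x0) +
   weight eta K k * enorm (x - x0) ^+ 2.

Let failure_ge0 x0 k x S : 0 <= failure x0 k x S.
Proof. exact: failure_bound_ge0. Qed.

(** At the end of an epoch either the noise sum is large and [failure] is at least 1, or the anchor
    is a saddle and [escape_failure] is 1, or the output is good. *)
Lemma bad_prob_ended n x0 x acc S N : invariant K x0 x acc S ->
  (bad_prob n K x0 x acc <=
   (failure x0 K x S + p * N%:R)%:E + escape_failure x0 0 x)%E.
Proof.
move=> [_ xB aB inv].
have pN : 0 <= p * N%:R by rewrite mulr_ge0 // ltW.
have [big|small] := ltP (16 * sigma ^+ 2 * K%:R * l1) (enorm S ^+ 2).
  apply: le_trans (bad_prob_le1 _ _ _ _ _) _; rewrite -[leLHS]adde0.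
  apply: leeD; last exact: escape_failure_ge0.
  rewrite lee_fin; apply: le_trans (_ : failure x0 K x S <= _); last by rewrite lerDl.
  exact: failure_bound_noise.
have [saddle|nsaddle] := ltP (lambda_min (hessian f x0)) (- (16 * delta)).
  apply: le_trans (bad_prob_le1 _ _ _ _ _) _; rewrite -[leLHS]add0e.
  apply: leeD; first by rewrite lee_fin addr_ge0.
  by rewrite /escape_failure saddle survival0.
have [gy ly] := output_stationary rho_gt0 eta_gt0 B_gt0 d_gt0 df dg hess_lip K_large
  horizon_ge step_le l1_ge lnK_ge rhoB_delta xB aB inv small nsaddle erefl.
rewrite /bad_prob hitting_frozen // indicE memNset.
  by rewrite adde_ge0 ?escape_failure_ge0 // lee_fin addr_ge0.
by apply; split.
Qed.

(** [N] counts the restarts that the remaining gap to [fstar] can still afford, and [p] is reserved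
    for each; the last hypothesis says that the [n] remaining steps suffice for this epoch and [N]
    further ones. A restart spends one unit of [N], whose [p] covers the p / 3 of [failure] and the
    p / 3 of [escape_failure] at the new anchor. *)
Lemma bad_prob_le n : forall k x0 x acc S N, invariant k x0 x acc S ->
  f x0 - fstar <= N%:R * epoch_descent -> (K - k + N * K <= n)%N ->
  (bad_prob n k x0 x acc <=
   (failure x0 k x S + p * N%:R)%:E + escape_failure x0 (K - k) x)%E.
Proof.
have pN N : 0 <= p * N%:R by rewrite mulr_ge0 // ltW.
elim: n => [|n IH] k x0 x acc S N inv budget time.
  have kK : k = K by case: inv => kK _ _ _; apply/eqP; rewrite eqn_leq kK; move: time; rewrite leqn0 addn_eq0 subn_eq0 => /andP[].
  by rewrite kK subnn in inv *; exact: bad_prob_ended.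
have [kK xB _ _] := inv.
have [/eqP kE|kN] := boolP (k == K).
  by rewrite kE subnn in inv *; exact: bad_prob_ended.
have {kN}kK : (k < K)%N by rewrite ltn_neqAle kN.
(* Above the threshold the claimed bound is already at least 1; below it, the level is available
   should the next step leave the ball. *)
have [high|low] := ltP (threshold sigma rho eta B p K) (level x0 k x).
  apply: le_trans (bad_prob_le1 _ _ _ _ _) _; rewrite -[leLHS]adde0.
  apply: leeD; last exact: escape_failure_ge0.
  rewrite lee_fin; apply: le_trans (_ : failure x0 k x S <= _); last by rewrite lerDl.
  exact: (failure_bound_descent sigma_gt0 eta_gt0 (QQ x0) (HQ x0) S (ltnW kK) high).
have [N0 [mN0 N00 noiseN]] := noise_null_set L_gt0 sigma_gt0 G_lip G_mean noise.
have [c cP] := failure_bound_step p sigma_gt0 rho_gt0 eta_gt0 B_gt0 dg hess_lip g_lip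
  K_large eta_L (QQ x0) (HQ x0) k S xB.
have jE : (K - k = (K - k.+1).+1)%N by rewrite subnSK.
rewrite jE escape_failureS //.
rewrite {1}/bad_prob /=.
apply: (integral_affine_le G_mean (c := c) (x := x) _ _ _ _ mN0 N00) => [||z|z|z Nz].
- exact: (measurable_hitting_step D mstep n _ measurable_bad).
- rewrite /escape_failure; case: (_ < _); last exact: measurable_cst.
  exact: (measurable_survival_step eta B x0 L_gt0 G_lip G_mean).
- by rewrite hitting_ge0 (hitting_le1 D mstep n _ measurable_bad).
- by rewrite escape_failure_ge0 escape_failure_le1.
rewrite sgd_stepE //=.
pose xi := G x z - grad f x.
have xis : enorm xi <= sigma by exact: noiseN.
have GE : G x z = grad f x + xi by rewrite addrC subrK.
rewrite -/xi GE; move: (cP _ xis); clear GE.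
have := @invariant_step _ _ _ _ _ xi inv kK _ erefl.
have := @exit_descent R d f L sigma rho eta B p K rho_gt0 eta_gt0 B_gt0 df dg hess_lip g_lip
  K_large horizon_ge horizon_le eta_L eta_sigma step_le l1_ge lnK_ge x0 k x xi kK xB xis.
move=> /=; move: (x - eta *: _) => x' exitP invP cP'.
have cE : failure x0 k.+1 x' (S + xi) + p * N%:R <= failure x0 k x S + p * N%:R + dot c xi.
  by rewrite [leRHS]addrAC lerD2r.
have [exit|noexit] := ltP B (enorm (x' - x0)); last first.
  apply: le_trans (IH _ _ _ _ _ N (invP noexit) budget _) _.
    by rewrite -ltnS; apply: leq_trans time; rewrite jE addSn.
  by apply: leeD => //; rewrite lee_fin.
rewrite -[leLHS]adde0; apply: leeD; last exact: escape_failure_ge0.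
have [high'|low'] := ltP (threshold sigma rho eta B p K) (level x0 k.+1 x').
  apply: le_trans (bad_prob_le1 _ _ _ _ _) _; rewrite lee_fin.
  apply: le_trans cE; apply: le_trans (_ : failure x0 k.+1 x' (S + xi) <= _).
    exact: (failure_bound_descent sigma_gt0 eta_gt0 (QQ x0) (HQ x0) _ kK high').
  by rewrite lerDl.
have fx' := exitP exit low low'.
(* With no restart left, a further decrease would bring [f] below [fstar]. *)
case: N budget time cE => [|N] budget time cE.
  have := fstar_le x'; have := epoch_descent_gt0; move: budget fx'.
  by rewrite mul0r -/epoch_descent => *; exfalso; lra.
have budget' : f x' - fstar <= N%:R * epoch_descent.
  move: budget; rewrite -(@natr1 _ N) mulrDl mul1r; move: fx'; rewrite -/epoch_descent.
  by move=> *; lra.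
apply: le_trans (IH _ _ _ _ _ N (invariant_start x') budget' _) _.
  by rewrite subn0 -mulSn -ltnS; apply: leq_trans time; rewrite jE addSn ltnS leq_addl.
rewrite subn0.
apply: le_trans (leeD (lexx _) (escape_failure_start x')) _.
rewrite -EFinD lee_fin; apply: le_trans cE.
have := failure_ge0 x0 k.+1 x' (S + xi).
have : failure x' 0 x' 0 <= p / 3.
  by rewrite /failure subrr; exact: (failure_bound_start sigma_gt0 rho_gt0 eta_gt0 B_gt0 p_gt0 dg
    hess_lip g_lip K_large eta_L (QQ x') (HQ x')).
rewrite -(@natr1 _ N); have := p_gt0.
move: (failure _ _ _ _) (failure _ _ _ _) => *; lra.
Qed.

End spectral_data.

Lemma bad_prob_run x0 N : f x0 - fstar <= N%:R * epoch_descent ->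
  (bad_prob (N.+1 * K) 0 x0 x0 0 <= (p * N.+1%:R)%:E)%E.
Proof.
move=> budget.
have [Q /choice[lam /all_and2[QQ HQ]]] := choice (fun x =>
  spectral_theorem (hessian_sym df dg hess_lip (ltW rho_gt0) x)).
have time : (K - 0 + N * K <= N.+1 * K)%N by rewrite subn0 mulSn.
apply: le_trans (bad_prob_le QQ HQ (invariant_start x0) budget time) _.
rewrite subn0; apply: le_trans (leeD (lexx _) (escape_failure_start x0)) _.
rewrite -EFinD lee_fin subrr.
have := failure_bound_start sigma_gt0 rho_gt0 eta_gt0 B_gt0 p_gt0 dg hess_lip g_lip
  K_large eta_L (QQ x0) (HQ x0).
rewrite -(@natr1 _ N); have := p_gt0.
move: (failure_bound _ _ _ _ _ _ _ _ _ _ _ _ _) => *; lra.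
Qed.

End restarts.

(** * Consequences of the parameter setting *)

Section numeric_parameters.
Context (R : realType).
Implicit Types (x : R).

(** From [expR 6^-1 <= 6 / 5] and (6 / 5)^6 < 3. *)
Lemma expR1_le3 : expR 1 <= 3 :> R.
Proof.
have e6 : expR (6^-1) <= 6 / 5 :> R.
  have := @expR_ge1Dx R (- 6^-1); rewrite expRN => h.
  have e0 := expR_gt0 (6^-1 : R).
  have : (1 + - 6^-1) * expR (6^-1) <= (1 : R).
    by rewrite -ler_pdivlMr // div1r.
  by lra.
have -> : (1 : R) = 6%:R * 6^-1 by rewrite mulfV.
rewrite expRM_natl; apply: le_trans (_ : (6 / 5) ^+ 6 <= _).
  by rewrite lerXn2r ?nnegrE ?expR_ge0 //; lra.
by lra.
Qed.

Lemma ln_ge_nat (n : nat) x : 3 ^+ n <= x -> n%:R <= ln x.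
Proof.
move=> nx; have x0 : 0 < x by apply: lt_le_trans nx; rewrite exprn_gt0.
rewrite -ler_expR lnK ?posrE // -[n%:R]mulr1 expRM_natl.
apply: le_trans nx; rewrite lerXn2r ?nnegrE ?expR_ge0 //.
exact: expR1_le3.
Qed.

Lemma growth_lower_bound x (n : nat) : 0 <= x ->
  expR (n%:R * (x * (1 - x))) <= (1 + x) ^+ n.
Proof.
move=> x0; rewrite expRM_natl lerXn2r ?nnegrE ?expR_ge0 ?addr_ge0 //.
have x1 : 0 < 1 + x by rewrite ltr_wpDr.
have h : x * (1 - x) <= x / (1 + x).
  by rewrite ler_pdivlMr //; have := mulr_ge0 x0 (sqr_ge0 x); lra.
apply: le_trans (_ : expR (x / (1 + x)) <= _); first by rewrite ler_expR.
have := expR_ge1Dx (- (x / (1 + x))).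
have -> : 1 + - (x / (1 + x)) = (1 + x)^-1 by field; rewrite gt_eqF.
by rewrite expRN lef_pV2 ?posrE ?expR_gt0.
Qed.

Lemma pow_le_expR x (n : nat) : 0 <= x -> (1 + x) ^+ n <= expR (n%:R * x).
Proof.
move=> x0; rewrite expRM_natl lerXn2r ?nnegrE ?expR_ge0 ?addr_ge0 //.
exact: expR_ge1Dx.
Qed.

End numeric_parameters.

Section parameter_facts.
Context (R : realType) (d : nat) (L rho sigma eps eta p : R).
Hypotheses (d_gt0 : (0 < d)%N) (L_gt0 : 0 < L) (rho_gt0 : 0 < rho).
Hypotheses (sigma_gt0 : 0 < sigma) (p_gt0 : 0 < p) (p_lt1 : p < 1).
Hypothesis setting : parameter_setting d L rho sigma eps eta p.

Let C1 := sgd_C1 d eta p.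
Let delta := sgd_delta rho eps.
Let B := sgd_radius d rho eps eta p.
Let K := sgd_K0 d rho eps eta p.
Let epoch := epoch_length d rho eps eta p.
Let Q := 24 * Num.sqrt d%:R / eta.
Let l1 := ln (48 * K%:R / p).
Let mx := Num.max (sigma ^+ 2) 1.

Lemma eps_gt0 : 0 < eps. Proof. by case: setting => -[]. Qed.
Lemma eta_gt0 : 0 < eta. Proof. by case: setting => -[]. Qed.
Lemma epoch_ge1 : 1 <= epoch. Proof. by case: setting => -[]. Qed.

Lemma delta_gt0 : 0 < delta.
Proof. by rewrite sqrtr_gt0 mulr_gt0 // eps_gt0. Qed.

Lemma delta_le1 : delta <= 1. Proof. by case: setting => _ []. Qed.

Lemma epochE : epoch * (16 * eta * delta) = C1.
Proof.
have := eta_gt0; have := delta_gt0 => d0 e0.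
by rewrite /epoch /epoch_length -/C1 /sgd_delta2 -/delta; field; rewrite !gt_eqF.
Qed.

Lemma C1_gt0 : 0 < C1.
Proof.
rewrite -epochE; apply: mulr_gt0; first exact: lt_le_trans ltr01 epoch_ge1.
by rewrite !mulr_gt0 ?eta_gt0 ?delta_gt0.
Qed.

(** [M] is the floor inside [sgd_C1], the number of escape blocks: enough factors 7 / 10 to fall
    below p / 3. *)
Lemma epochs_exist : exists M : nat, [/\ (0 < M)%N, C1 = 2 * M%:R * ln Q &
  (7 / 10) ^+ M <= p / 3].
Proof.
pose a := ln (3 * p^-1) / ln ((7 / 10)^-1 : R).
have l7 : 0 < ln ((7 / 10)^-1 : R).
  by rewrite ln_gt0 // invf_gt1 //; lra.
have p3 : 1 <= 3 * p^-1.
  by rewrite ler_pdivlMr // mul1r (le_trans (ltW p_lt1)) // ler1n.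
have a0 : 0 <= a by apply: divr_ge0; [exact: ln_ge0|exact: ltW].
have [m mE] : exists m : nat, Num.floor (a + 1) = m :> int.
  exists `|Num.floor (a + 1)|%N; rewrite gez0_abs // floor_ge0; lra.
have /andP[_] := floor_itv (a + 1); rewrite mE => am.
have {}am : a < m%:R by move: am; rewrite intrD -pmulrn; lra.
exists m; split.
- by rewrite -(ltr0n R); apply: le_lt_trans am.
- by rewrite /C1 /sgd_C1 -/a mE -pmulrn.
rewrite -lef_pV2 ?posrE ?exprn_gt0 ?divr_gt0 //.
rewrite -exprVn -ler_ln ?posrE ?exprn_gt0 ?invr_gt0 ?divr_gt0 //.
have aE : a * ln ((7 / 10)^-1) = ln (3 / p) by rewrite divfK // gt_eqF.
rewrite lnXn ?invr_gt0 ?divr_gt0 // invf_div -[leRHS]mulr_natl -aE.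
by rewrite ler_pM2r // ltW.
Qed.

Lemma lnQ_gt0 : 0 < ln Q.
Proof.
have [M [M0 CE _]] := epochs_exist.
by have := C1_gt0; rewrite CE pmulr_rgt0 // mulr_gt0 // ltr0n.
Qed.

Lemma K_bounds : epoch <= K%:R < epoch + 1.
Proof.
have e1 := epoch_ge1.
have c0 : 0 <= Num.ceil epoch by rewrite ceil_ge0; lra.
have /andP[] := ceil_itv epoch.
rewrite -(gez0_abs c0) -/K -[(`|_|%N%:Z)%:~R]pmulrn => H1 H2.
rewrite H2 /=; move: H1; rewrite intrD -pmulrn => H1.
move: H1; rewrite /K /sgd_K0 -/epoch; lra.
Qed.

Lemma K_ge1 : 1 <= K%:R :> R.
Proof. by have /andP[+ _] := K_bounds; apply: le_trans epoch_ge1. Qed.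

Lemma lnK_ge0 : 0 <= ln K%:R :> R.
Proof. by rewrite ln_ge0 // K_ge1. Qed.

Lemma mx_ge1 : 1 <= mx. Proof. by rewrite le_max lexx orbT. Qed.
Lemma mx_ges : sigma ^+ 2 <= mx. Proof. by rewrite le_max lexx. Qed.

Lemma radiusE : B * (rho * C1) = delta.
Proof.
by rewrite /B /sgd_radius -/delta -/C1 divfK // mulf_neq0 // gt_eqF // C1_gt0.
Qed.

Lemma B_gt0 : 0 < B.
Proof. by rewrite divr_gt0 ?delta_gt0 // mulr_gt0 // C1_gt0. Qed.

Lemma B_le1 : B <= 1.
Proof. by case: setting => _ [+ _]; rewrite le_min => /andP[]. Qed.

Lemma B_le_sigma : B * L <= sigma.
Proof.
case: setting => _ [+ _]; rewrite !le_min => /and3P[_ + _].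
by rewrite ler_pdivlMr.
Qed.

Lemma B_le_L : B * L <= 1.
Proof.
case: setting => _ [+ _]; rewrite !le_min => /and3P[_ _].
by rewrite ler_pdivlMr.
Qed.

Lemma step_bound : 3 <= l1 ->
  eta * (64 * mx * C1 * l1 * (3 + ln K%:R)) <= B ^+ 2 * delta.
Proof.
move=> l13; case: setting => -[_ _ _ +] _.
rewrite /step_size_bound -/C1 -/mx -/K -/l1 -/B -/delta => le_eta.
have l20 : 0 < 3 + ln K%:R :> R by have := lnK_ge0; lra.
have l10 : 0 < l1 by lra.
have m0 : 0 < mx by have := mx_ge1; lra.
have c0 := C1_gt0.
have D0 : 0 < 64 * mx * C1 * l1 * (3 + ln K%:R) by do 4 apply: mulr_gt0 => //.
rewrite -ler_pdivlMr //; apply: le_trans le_eta _.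
rewrite le_eqVlt; apply/orP; left; apply/eqP; field.
by rewrite !gt_eqF.
Qed.

(** The step size bound involves [K], which itself depends on the step size, so the estimates are
    bootstrapped: [1 <= K] gives [3 <= l1], hence a small step size and a large [K], hence
    [11 <= l1]. *)
Lemma pow3_le_l1 n : 3 ^+ n <= K%:R :> R -> n.+3%:R <= l1.
Proof.
move=> nK; apply: ln_ge_nat; rewrite ler_pdivlMr //.
have -> : 3 ^+ n.+3 = 3 ^+ n * 27 :> R by rewrite !exprSr; ring.
apply: le_trans (_ : K%:R * 27 * 1 <= _); last by have := K_ge1; lra.
apply: ler_pM; rewrite ?(ltW p_gt0) ?(ltW p_lt1) ?mulr_ge0 ?exprn_ge0 //.
by rewrite ler_wpM2r.
Qed.

Lemma eta_C1_le : eta * C1 * (9 * 64) <= delta.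
Proof.
have l13 : 3 <= l1 by have := @pow3_le_l1 0; rewrite expr0 => ->; rewrite ?K_ge1.
apply: le_trans (_ : B ^+ 2 * delta <= _); last first.
  rewrite ler_piMl ?(ltW delta_gt0) // expr_le1 ?B_le1 //; exact: ltW B_gt0.
apply: le_trans (step_bound l13).
have l23 : 3 <= 3 + ln K%:R :> R by have := lnK_ge0; lra.
have e0 := eta_gt0; have c0 := C1_gt0.
have -> : eta * C1 * (9 * 64) = eta * (64 * 1 * C1 * 3 * 3) by ring.
rewrite ler_pM2l //; apply: ler_pM => //.
  by do ![by []|exact: ltW|apply: mulr_ge0].
apply: ler_pM => //; first by do ![by []|exact: ltW|apply: mulr_ge0].
by rewrite ler_pM2r // ler_pM2l // mx_ge1.
Qed.

Lemma eta_le96 : eta <= 1 / 96.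
Proof.
have e0 := eta_gt0; have d0 := delta_gt0; have d1 := delta_le1.
have := eta_C1_le; rewrite -epochE => h.
have : eta * (16 * eta * delta) * (9 * 64) <= delta.
  have X0 : 0 <= 16 * eta * delta by do ![by []|exact: ltW|apply: mulr_ge0].
  by have := ler_wpM2l (ltW e0) (ler_peMl X0 epoch_ge1); lra.
have -> : eta * (16 * eta * delta) * (9 * 64) = (96 * eta) ^+ 2 * delta by ring.
rewrite -ler_pdivlMr // divff ?gt_eqF // expr_le1 ?mulr_ge0 ?(ltW e0) //.
by lra.
Qed.

Lemma sqrtd_ge1 : 1 <= Num.sqrt d%:R :> R.
Proof. by rewrite -[leLHS]sqrtr1 ler_wsqrtr // ler1n. Qed.

Lemma Q_gt0 : 0 < Q.
Proof. by rewrite divr_gt0 ?eta_gt0 // mulr_gt0 // (lt_le_trans _ sqrtd_ge1). Qed.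

Lemma lnQ_ge7 : 7 <= ln Q.
Proof.
have e0 := eta_gt0.
apply: (@ln_ge_nat R 7); rewrite ler_pdivlMr //.
by have := eta_le96; have := sqrtd_ge1; lra.
Qed.

Lemma C1_ge : 2 * ln Q <= C1.
Proof.
have [M [M0 -> _]] := epochs_exist.
rewrite ler_pM2r ?lnQ_gt0 // ler_peMr // ler1n //.
Qed.

Lemma C1_ge14 : 14 <= C1.
Proof. by have := C1_ge; have := lnQ_ge7; lra. Qed.

Lemma eta_le_delta : eta * (126 * 64) <= delta.
Proof.
have := ler_wpM2l (ltW eta_gt0) C1_ge14; have := eta_C1_le; lra.
Qed.

Lemma epoch_large : 64 * 110 <= epoch.
Proof.
have e0 := eta_gt0; have d0 := delta_gt0; have d1 := delta_le1.
have ed0 : 0 < 16 * eta * delta by do ![by []|apply: mulr_gt0].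
rewrite -(ler_pM2r ed0) epochE; apply: le_trans C1_ge14.
(* The constant 64 * 110 is what 14 / (16 * eta) with [eta <= 1 / (126 * 64)] allows. *)
have : eta * delta <= eta by rewrite ler_piMr // ltW.
by have := eta_le_delta; lra.
Qed.

Lemma K_large : 64 * 110 <= K%:R :> R.
Proof. by have /andP[+ _] := K_bounds; apply: le_trans epoch_large. Qed.

Lemma lnK_ge8 : 8 <= ln K%:R :> R.
Proof. by apply: (@ln_ge_nat R 8); have := K_large; lra. Qed.

Lemma l1_ge11 : 11 <= l1.
Proof. by apply: (@pow3_le_l1 8); have := K_large; lra. Qed.

Lemma step_size_le : eta * mx * 64 * l1 * (3 + ln K%:R) <= rho * B ^+ 3.
Proof.
have l13 : 3 <= l1 by have := l1_ge11; lra.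
have := step_bound l13; rewrite -radiusE => h.
rewrite -(ler_pM2r C1_gt0); move: h.
by congr (_ <= _); ring.
Qed.

(** With the real number [epoch] in place of [K] the product is exactly 1; rounding up adds at most
    one part in 64 * 110. *)
Lemma horizon : rho * B * (eta * K%:R) * 16 >= 1 /\
  rho * B * (eta * K%:R) * 16 <= 1 + 1 / (64 * 110).
Proof.
have e0 := eta_gt0; have b0 := B_gt0; have c0 := C1_gt0.
have rb0 : 0 < rho * B * eta * 16 by do ![by []|apply: mulr_gt0].
have E : rho * B * (eta * epoch) * 16 = 1.
  apply: (mulIf (lt0r_neq0 c0)); rewrite mul1r -{2}epochE -radiusE; ring.
have /andP[K1 K2] := K_bounds; have e7 := epoch_large.
split.
  by have := ler_wpM2l (ltW rb0) K1; have := E; lra.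
have h : rho * B * eta * 16 * 64 * 110 <= 1.
  by have := ler_wpM2l (ltW rb0) e7; have := E; lra.
by have := ler_wpM2l (ltW rb0) (ltW K2); have := E; lra.
Qed.

Lemma etaL_le : eta * L <= 1 / 64.
Proof.
have e0 := eta_gt0; have b0 := B_gt0.
have m1 := mx_ge1; have l1g := l1_ge11; have l2g := lnK_ge8.
have h : eta * 64 * 14 <= B.
  have l13 : 3 <= l1 by lra.
  apply: le_trans (_ : B ^+ 2 * delta <= _); last first.
    rewrite expr2 -mulrA ler_piMr ?(ltW b0) // mulr_ile1 ?B_le1 ?delta_le1 ?(ltW b0) //.
    exact: ltW delta_gt0.
  apply: le_trans (step_bound l13); rewrite -[leLHS]mulrA ler_pM2l //.
  have c := C1_ge14; have -> : 64 * 14 = 64 * 1 * 14 * 1 * 1 :> R by ring.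
  by do !apply: ler_pM => //; rewrite ?mulr_ge0 //; lra.
have := ler_wpM2r (ltW L_gt0) h; have := B_le_L; lra.
Qed.

Lemma eta_sigma_le : eta * sigma * 100 <= B.
Proof.
have e0 := eta_gt0; have b0 := B_gt0; have d0 := delta_gt0.
have smx : sigma <= mx.
  have [s1|s1] := lerP sigma 1; first exact: le_trans mx_ge1.
  by apply: le_trans mx_ges; rewrite expr2 ler_peMr // ltW // (lt_trans ltr01).
have m1 := mx_ge1; have l1g := l1_ge11; have l2g := lnK_ge8; have c := C1_ge14.
have l13 : 3 <= l1 by lra.
apply: le_trans (_ : B ^+ 2 * delta <= _); last first.
  rewrite expr2 -mulrA ler_piMr ?(ltW b0) // mulr_ile1 ?B_le1 ?delta_le1 ?(ltW b0) //.
  exact: ltW.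
apply: le_trans (step_bound l13); rewrite -[leLHS]mulrA ler_pM2l //.
apply: le_trans (_ : 64 * mx * 14 * 1 * 1 <= _); first by lra.
by do !apply: ler_pM => //; rewrite ?mulr_ge0 //; lra.
Qed.

(** An epoch splits into [M] blocks of real length [Ko], in which growth at rate [16 * eta * delta]
    multiplies a difference by about [Q ^+ 2]. *)
Lemma escape_parameters : exists M n : nat, [/\ (7 / 10) ^+ M <= p / 3,
   (M * n.+1 <= K)%N,
   n%:R * (1 + 16 * (eta * (rho * B)) + (2 * eta * L) ^+ 2) ^+ n *
     (eta * (rho * B) / 16 + (eta * (rho * B)) ^+ 2 + (2 * eta * L) ^+ 2) <= 1 / 20 &
   forall lamb, 16 * delta <= lamb -> lamb <= L ->
    4 * B <= (1 + eta * lamb) ^+ n * (eta * (sigma / (4 * Num.sqrt d%:R)))].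
Proof.
have e0 := eta_gt0; have b0 := B_gt0; have d0 := delta_gt0; have d1 := delta_le1.
have lQ7 := lnQ_ge7; have lQ0 := lnQ_gt0; have c14 := C1_ge14.
have [M [M0 CE M7]] := epochs_exist.
have M1 : 1 <= M%:R :> R by rewrite ler1n.
pose x := 16 * eta * delta.
have x0 : 0 < x by do ![by []|apply: mulr_gt0].
pose Ko := 2 * ln Q / x.
have KoE : Ko * x = 2 * ln Q by rewrite divfK // gt_eqF.
have epE : epoch = M%:R * Ko.
  apply: (mulIf (lt0r_neq0 x0)); rewrite epochE -mulrA KoE CE; ring.
have xlQ : x * ln Q <= 1 / 72.
  have h1 : eta * (2 * ln Q) <= eta * C1 by rewrite ler_pM2l // C1_ge.
  have h2 : eta * ln Q <= delta / 1152 by have := eta_C1_le; lra.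
  have : eta * ln Q * delta <= delta / 1152 * 1.
    by rewrite ler_pM // ?mulr_ge0 ?divr_ge0 // ltW.
  by rewrite /x; lra.
have x1 : x <= 1 / 504.
  by have := ler_wpM2l (ltW x0) lQ7; lra.
have Ko2 : 2 <= Ko by rewrite ler_pdivlMr //; lra.
(* One step of each block is the dispersing first step, and rounding loses at most one more. *)
have [n [n1 n2]] : exists n : nat, n.+1%:R <= Ko /\ Ko < n.+2%:R.
  have f2 : 2 <= Num.floor Ko by rewrite floor_ge_int.
  have [m mE] : exists m : nat, Num.floor Ko = m.+2 :> int.
    case: (Num.floor Ko) f2 => [[|[|m]]|m] // _; by exists m.
  have /andP[] := floor_itv Ko; rewrite mE intrD -pmulrn => h1 h2.
  by exists m.+1; split => //; rewrite -natr1.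
exists M, n; split => //.
- rewrite -(ler_nat R) natrM; apply: le_trans (_ : epoch <= _).
    by rewrite epE ler_wpM2l.
  by have /andP[] := K_bounds.
- set e := eta * (rho * B); set i := (2 * eta * L) ^+ 2.
  have eP : 0 < e by do ![by []|apply: mulr_gt0].
  have iP : 0 <= i by exact: sqr_ge0.
  have n0 : 0 <= n%:R :> R by exact: ler0n.
  have nKo : n%:R <= Ko by apply: le_trans n1; rewrite ler_nat.
  have eKo : Ko * e * (16 * M%:R) = 1.
    have [h _] := conj (horizon).1 I.
    apply: (mulIf (lt0r_neq0 C1_gt0)).
    have -> : Ko * e * (16 * M%:R) * C1 = (M%:R * Ko) * (16 * eta * (B * (rho * C1))).
      by rewrite /e; ring.
    by rewrite -epE radiusE epochE mul1r.
  have ne : n%:R * e <= 1 / 16.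
    apply: le_trans (_ : Ko * e <= _); first by rewrite ler_wpM2r // ltW.
    have Ke0 : 0 <= Ko * e by apply: mulr_ge0; [lra|exact: ltW].
    by have := ler_wpM2l Ke0 M1; have := eKo; lra.
  (* Noise is negligible against the Hessian variation: the step size bound and [B * L <= 1] give
     [eta * 64 * 11 * 11 * L ^+ 2 <= rho * B]. *)
  have ie : i <= e / 1000.
    have h : eta * 64 * 11 * 11 <= rho * B ^+ 3.
      apply: le_trans step_size_le.
      have m1 := mx_ge1; have l1g := l1_ge11; have l2g := lnK_ge8.
      have -> : eta * 64 * 11 * 11 = eta * 1 * 64 * 11 * 11 by ring.
      apply: ler_pM => //; [by do ![by []|exact: ltW|apply: mulr_ge0]| |by lra].
      apply: ler_pM => //; first by do ![by []|exact: ltW|apply: mulr_ge0].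
      by rewrite ler_pM2r // ler_pM2l.
    have BL2 : (B * L) ^+ 2 <= 1.
      by rewrite expr_le1 ?B_le_L // mulr_ge0 ?ltW.
    have : eta * 64 * 11 * 11 * L ^+ 2 <= rho * B.
      apply: le_trans (ler_wpM2r (sqr_ge0 L) h) _.
      have -> : rho * B ^+ 3 * L ^+ 2 = rho * B * (B * L) ^+ 2 by ring.
      by rewrite ler_piMr // mulr_ge0 // ltW.
    have L20 := sqr_ge0 L => hh.
    have := ler_wpM2l (ltW e0) hh; rewrite -/e /i.
    have : 0 <= eta ^+ 2 * L ^+ 2 by rewrite mulr_ge0 ?sqr_ge0.
    by lra.
  have kn : (1 + 16 * e + i) ^+ n <= 9.
    rewrite -addrA; apply: le_trans (pow_le_expR n _) _.
      by rewrite addr_ge0 // mulr_ge0 // ltW.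
    have : n%:R * (16 * e + i) <= 2.
      by have := ler_wpM2l n0 ie; lra.
    rewrite -ler_expR => /le_trans; apply.
    have -> : (2 : R) = 2%:R * 1 by ring.
    rewrite expRM_natl; apply: le_trans (_ : 3 ^+ 2 <= _).
      by rewrite lerXn2r ?nnegrE ?expR_ge0 ?expR1_le3.
    by lra.
  have e_small : e <= 1 / 1000.
    have : (64 * 110) * e * 16 <= epoch * e * 16.
      by rewrite ler_pM2r // ler_pM2r // epoch_large.
    have -> : epoch * e * 16 = Ko * e * (16 * M%:R) by rewrite epE; ring.
    by rewrite eKo; lra.
  have no : n%:R * (e / 16 + e ^+ 2 + i) <= 1 / 200.
    have h1 := ler_wpM2l n0 ie.
    have ne0 : 0 <= n%:R * e by apply: mulr_ge0 => //; exact: ltW.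
    by have := ler_pM ne0 (ltW eP) ne e_small; lra.
  rewrite mulrAC; apply: le_trans (_ : 1 / 200 * 9 <= _); last by lra.
  apply: ler_pM => //.
    apply: mulr_ge0 => //; apply: addr_ge0 => //; apply: addr_ge0; last exact: sqr_ge0.
    by apply: divr_ge0 => //; exact: ltW.
  apply: exprn_ge0; apply: addr_ge0 => //; apply: addr_ge0 => //.
  by apply: mulr_ge0 => //; exact: ltW.
move=> lamb lamb_ge lambL.
have s1 := sqrtd_ge1; have s0 : 0 < Num.sqrt d%:R :> R by exact: lt_le_trans s1.
have xl : x <= eta * lamb by rewrite /x; have := ler_wpM2l (ltW e0) lamb_ge; lra.
(* The two lost steps and the second-order term of the logarithm cost at most 1 in the exponent,
   hence a factor 3. *)
have grow : Q ^+ 2 / 3 <= (1 + eta * lamb) ^+ n.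
  apply: le_trans (_ : (1 + x) ^+ n <= _); last first.
    by rewrite lerXn2r ?nnegrE ?addr_ge0 ?lerD2l // ?(ltW x0) // (le_trans (ltW x0)).
  apply: le_trans (growth_lower_bound n (ltW x0)).
  have -> : Q ^+ 2 / 3 = expR (2%:R * ln Q) / 3 by rewrite expRM_natl lnK ?posrE ?Q_gt0.
  rewrite ler_pdivrMr //.
  apply: le_trans (_ : expR (n%:R * (x * (1 - x))) * expR 1 <= _); last first.
    by rewrite ler_wpM2l ?expR_ge0 ?expR1_le3.
  rewrite -expRD ler_expR.
  have h1 : (Ko - 2) * (x * (1 - x)) <= n%:R * (x * (1 - x)).
    apply: ler_wpM2r; first by apply: mulr_ge0; [exact: ltW|lra].
    by move: n2; rewrite -!(@natr1 R); lra.
  have h2 : (Ko - 2) * (x * (1 - x)) = (Ko * x - 2 * x) * (1 - x) by ring.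
  move: h1; rewrite h2 KoE.
  have := sqr_ge0 x; lra.
have Qe : Q * eta = 24 * Num.sqrt d%:R by rewrite divfK // gt_eqF.
apply: le_trans (_ : Q ^+ 2 / 3 * (eta * (sigma / (4 * Num.sqrt d%:R))) <= _); last first.
  by rewrite ler_wpM2r // !mulr_ge0 ?invr_ge0 ?mulr_ge0 // ltW.
have -> : Q ^+ 2 / 3 * (eta * (sigma / (4 * Num.sqrt d%:R))) = 48 * Num.sqrt d%:R * sigma / eta.
  have -> : Q = 24 * Num.sqrt d%:R / eta by [].
  by field; rewrite !gt_eqF.
rewrite ler_pdivlMr //.
(* The chain [16 * delta <= lamb <= L] is what makes [delta * B] at most [L * B / 16]. *)
have h1 : eta * B <= sigma / 16.
  apply: le_trans (_ : delta * B <= _).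
    by rewrite ler_pM2r //; have := eta_le_delta; lra.
  have : 16 * delta * B <= L * B by rewrite ler_pM2r // (le_trans lamb_ge).
  by have := B_le_sigma; lra.
have := ler_wpM2r (ltW sigma_gt0) s1.
have := sigma_gt0; lra.
Qed.

End parameter_facts.

Lemma le_absz_ceil (R : realType) (x : R) : 0 <= x -> x <= `|Num.ceil x|%N%:R.
Proof.
move=> x0; rewrite natr_absz ger0_norm ?ceil_ge // ceil_ge0.
by apply: lt_le_trans x0; rewrite ltrN10.
Qed.

Lemma sgd_guarantee (R : realType) (L rho sigma Delta p : R)
    (L_gt0 : 0 < L) (rho_gt0 : 0 < rho) (sigma_gt0 : 0 < sigma)
    (p_gt0 : 0 < p) (p_lt1 : p < 1) (d : nat) (eps eta : R) :
  (0 < d)%N ->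
  parameter_setting d L rho sigma eps eta p ->
  forall (dZ : measure_display) (Z : measurableType dZ) (D : probability Z R)
         (F : 'rV[R]_d -> Z -> R) (f : 'rV[R]_d -> R) (xtilde : 'rV[R]_d),
  differentiability F f ->
  unbiased_gradient D F f ->
  smoothness L rho F f ->
  has_lbound (range f) -> Delta = f xtilde - inf (range f) ->
  bounded_noise sigma D F f ->
  dispersive_noise sigma D F ->
  forall (dO : measure_display) (Omega : measurableType dO)
         (P : probability Omega R) (zeta : nat -> {RV P >-> Z}),
  iid D zeta ->
  let B := sgd_radius d rho eps eta p in
  let K := sgd_K0 d rho eps eta p in
  let final := fun w : Omega =>
    sgd_run (sgrad F) eta B K xtilde (fun t => zeta t w)
      (sgd_T0 d rho eps eta p Delta) in
  ((1 - (sgd_T1 d rho eps eta p Delta)%:R * p)%:E <=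
   P [set w | [/\ sgd_ended K (final w),
        (enorm (grad f (sgd_output K (final w))) <= 18 * rho * B ^+ 2)%R
      & (- (17 * sgd_delta rho eps) <=
          lambda_min (hessian f (sgd_output K (final w))))%R]])%E.
Proof.
move=> d_gt0 setting dZ Z D F f xt [_ df dg] G_mean [G_lip hess_lip] lbf DeltaE.
move=> bnoise disp dO Omega P zeta zeta_iid.
cbv zeta; set B := sgd_radius d rho eps eta p; set K := sgd_K0 d rho eps eta p.
have noise := bounded_noise_ae sigma_gt0 G_mean bnoise.
have fstar_le x : inf (range f) <= f x by apply: ge_inf => //; exists x.
have [h1 h2] := horizon d_gt0 rho_gt0 p_gt0 p_lt1 setting.
have K64 := K_large d_gt0 rho_gt0 p_gt0 p_lt1 setting.
have eta0 := eta_gt0 setting.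
have B0 := B_gt0 rho_gt0 setting.
have l11 := l1_ge11 d_gt0 rho_gt0 p_gt0 p_lt1 setting.
have lnK8 := lnK_ge8 d_gt0 rho_gt0 p_gt0 p_lt1 setting.
have step_le : eta * sigma ^+ 2 * 64 * ln (48 * K%:R / p) * (3 + ln K%:R) <= rho * B ^+ 3.
  apply: le_trans (step_size_le d_gt0 rho_gt0 p_gt0 p_lt1 setting).
  apply: ler_wpM2r; first by lra.
  apply: ler_wpM2r; first by lra.
  by rewrite ler_pM2r // ler_pM2l // mx_ges.
have rhoBd : rho * B <= sgd_delta rho eps.
  rewrite -(radiusE rho_gt0 setting) -/B.
  have -> : B * (rho * sgd_C1 d eta p) = rho * B * sgd_C1 d eta p by ring.
  have rB0 : 0 <= rho * B by rewrite ltW // mulr_gt0.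
  rewrite ler_peMr //; apply: le_trans (C1_ge14 d_gt0 rho_gt0 p_gt0 p_lt1 setting).
  by rewrite ler1n.
have [M [n0 [rounds time drift growth]]] :=
  escape_parameters d_gt0 L_gt0 rho_gt0 sigma_gt0 p_gt0 p_lt1 setting.
have etaL := etaL_le d_gt0 L_gt0 rho_gt0 p_gt0 p_lt1 setting.
have etas := eta_sigma_le d_gt0 rho_gt0 sigma_gt0 p_gt0 p_lt1 setting.
have delta0 := delta_gt0 rho_gt0 setting.
have bad := @bad_prob_run R d dZ Z D (sgrad F) f L sigma rho eta B (sgd_delta rho eps) p
  (inf (range f)) K L_gt0 sigma_gt0 rho_gt0 eta0 B0 p_gt0 d_gt0 df dg hess_lip G_lip G_mean
  noise disp fstar_le K64 h1 h2 etaL etas step_le l11 lnK8 delta0 rhoBd M n0 rounds time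
  drift growth.
pose N := `|Num.ceil (7 * Delta * eta * K%:R / B ^+ 2)|%N.
have K0 : 0 < K%:R :> R by apply: lt_le_trans K64; rewrite mulr_gt0.
have budget : f xt - inf (range f) <= N%:R * epoch_descent eta B K.
  rewrite -DeltaE /epoch_descent mulrA ler_pdivlMr ?mulr_gt0 //.
  have Delta0 : 0 <= Delta by rewrite DeltaE subr_ge0.
  have x0 : 0 <= 7 * Delta * eta * K%:R / B ^+ 2.
    by rewrite divr_ge0 ?exprn_ge0 ?(ltW B0) // !mulr_ge0 // ltW.
  have : 7 * Delta * eta * K%:R / B ^+ 2 <= N%:R.
    exact: le_absz_ceil.
  by rewrite ler_pdivrMr ?exprn_gt0 //; lra.
have {bad budget} := bad xt N budget.
have g_lip := mean_lip L_gt0 G_lip G_mean.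
have mgood := measurable_good (sgd_delta rho eps) (18 * rho * B ^+ 2) K d_gt0 rho_gt0 df dg hess_lip g_lip.
have mstep := measurable_space_step eta B K L_gt0 G_lip G_mean.
rewrite /bad_prob -(chain_hitting mstep zeta_iid); last exact: measurableC.
set E := [set w | _]; set bad := _ @^-1` _.
have -> : E = ~` bad.
  rewrite /bad /bad_states preimage_setC setCK; apply/seteqP; split => w /=;
  by rewrite chain_sgd_run /good_state /encode /=; rewrite /E /sgd_T0 /sgd_T1 -/N /=; case: (sgd_run _ _ _ _ _ _ _).
have mbad : measurable bad.
  rewrite -[X in measurable X]setTI.
  by apply: (measurable_chain mstep zeta) => //; exact: measurableC.
move=> bad_le; rewrite probability_setC // EFinB mulrC.
by apply: leeB.
Qed.

(** * Orders of magnitude *)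

Section scales.
Context (R : realType) (d : nat) (L rho sigma eps eta p Delta : R).
Hypotheses (d_gt0 : (0 < d)%N) (rho_gt0 : 0 < rho).
Hypotheses (p_gt0 : 0 < p) (p_lt1 : p < 1) (Delta_ge0 : 0 <= Delta).
Hypothesis setting : parameter_setting d L rho sigma eps eta p.

Let C1 := sgd_C1 d eta p.
Let B := sgd_radius d rho eps eta p.
Let K := sgd_K0 d rho eps eta p.
Let T1 := sgd_T1 d rho eps eta p Delta.
(** Square roots of [eps] and [rho] as units turn every half-integer power into a natural one. *)
Let s := Num.sqrt eps.
Let r := Num.sqrt rho.

Lemma polylog_ge1 : 1 <= polylog d eps.
Proof.
rewrite /polylog -addrA lerDl addr_ge0 // ln_ge0 //.
by rewrite ler1n.
Qed.

Let s_gt0 : 0 < s. Proof. by rewrite sqrtr_gt0 (eps_gt0 setting). Qed.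
Let r_gt0 : 0 < r. Proof. by rewrite sqrtr_gt0. Qed.
Let eta0 : 0 < eta := eta_gt0 setting.
Let B0 : 0 < B := B_gt0 rho_gt0 setting.
Let C0 : 0 < C1 := C1_gt0 rho_gt0 setting.
Let C14 : 14 <= C1 := C1_ge14 d_gt0 rho_gt0 p_gt0 p_lt1 setting.

Lemma sgd_deltaE : sgd_delta rho eps = r * s.
Proof. by rewrite /sgd_delta sqrtrM // ltW. Qed.

Let r2 : r ^+ 2 = rho. Proof. by rewrite sqr_sqrtr // ltW. Qed.

Lemma sqr_radiusE : B ^+ 2 * (rho * C1 ^+ 2) = s ^+ 2.
Proof.
have := radiusE rho_gt0 setting; rewrite -/B -/C1 sgd_deltaE => h.
apply: (mulfI (lt0r_neq0 rho_gt0)); rewrite -{3}r2 -exprMn -h; ring.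
Qed.

Lemma sgd_K0_le : K%:R * (8 * eta * (r * s)) <= C1.
Proof.
have /andP[_ K1] := K_bounds setting; have e1 := epoch_ge1 setting.
have q0 : 0 <= 8 * eta * (r * s) by apply: ltW; do ![by []|apply: mulr_gt0].
have : K%:R <= 2 * epoch_length d rho eps eta p by rewrite /K; lra.
move=> /(ler_wpM2r q0) /le_trans; apply.
by have := epochE rho_gt0 setting; rewrite sgd_deltaE -/C1; lra.
Qed.

Lemma sgd_K0_ge : C1 <= K%:R * (16 * eta * (r * s)).
Proof.
have /andP[K1 _] := K_bounds setting.
have q0 : 0 <= 16 * eta * (r * s) by apply: ltW; do ![by []|apply: mulr_gt0].
by have := ler_wpM2r q0 K1; rewrite -sgd_deltaE (epochE rho_gt0 setting).
Qed.

Let x := 7 * Delta * eta * K%:R / B ^+ 2.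

Let x_ge0 : 0 <= x.
Proof.
by rewrite divr_ge0 ?exprn_ge0 ?(ltW B0) // !mulr_ge0 // ltW.
Qed.

Let xE : x * s ^+ 3 * 8 = 7 * Delta * r * C1 ^+ 2 * (K%:R * (8 * eta * (r * s))).
Proof.
have Bn : B ^+ 2 != 0 by rewrite expf_neq0 // gt_eqF.
have -> : x * s ^+ 3 * 8 = x * s * 8 * s ^+ 2 by ring.
rewrite -sqr_radiusE -r2 /x; field; exact: lt0r_neq0.
Qed.

Lemma sgd_T1_ge : Delta * r <= T1%:R * s ^+ 3.
Proof.
have c2 : 14 ^+ 2 <= C1 ^+ 2 by rewrite ler_pXn2r ?nnegrE // ltW.
have xT : x <= T1%:R.
  by apply: le_trans (le_absz_ceil x_ge0) _; rewrite ler_nat leqnSn.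
have s3 : 0 <= s ^+ 3 by rewrite exprn_ge0 // ltW.
apply: le_trans (ler_wpM2r s3 xT).
rewrite -(ler_pM2r (x := 8)) // xE.
have Dr : 0 <= Delta * r by rewrite mulr_ge0 // ltW.
have := sgd_K0_ge; move: C14 c2; move: (K%:R) (C1) => k c c14 c2 kc.
have q : 7 <= k * (8 * eta * (r * s)) by lra.
have : 14 ^+ 2 * 7 <= c ^+ 2 * (k * (8 * eta * (r * s))) by apply: ler_pM.
move=> /(ler_wpM2l Dr).
have -> : 7 * Delta * r * c ^+ 2 * (k * (8 * eta * (r * s))) =
  7 * (Delta * r * (c ^+ 2 * (k * (8 * eta * (r * s))))) by ring.
by move: (Delta * r) (c ^+ 2 * _) Dr => u y; lra.
Qed.

Lemma sgd_T1_le (a : R) : C1 <= a ->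
  T1%:R * s ^+ 3 <= Delta * r * a ^+ 3 + 2 * (r ^+ 3)^-1.
Proof.
move=> Ca; have a0 : 0 < a by apply: lt_le_trans Ca.
have Tx : T1%:R <= x + 2.
  have /andP[h _] := ceil_itv x.
  rewrite /T1 /sgd_T1 -/K -/B -/x -natr1 natr_absz ger0_norm; last first.
    by rewrite ceil_ge0; apply: lt_le_trans x_ge0; rewrite ltrN10.
  by move: h; rewrite intrD; lra.
have s3 : 0 <= s ^+ 3 by rewrite exprn_ge0 // ltW.
apply: le_trans (ler_wpM2r s3 Tx) _; rewrite mulrDl; apply: lerD.
  rewrite -(ler_pM2r (x := 8)) // xE.
  have Dr : 0 <= Delta * r by rewrite mulr_ge0 // ltW.
  have c2 : C1 ^+ 2 <= a ^+ 2 by rewrite ler_pXn2r ?nnegrE // ltW.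
  have K0 : 0 <= K%:R * (8 * eta * (r * s)).
    by apply: mulr_ge0 => //; apply: ltW; do ![by []|apply: mulr_gt0].
  have := ler_pM (sqr_ge0 C1) K0 c2 (le_trans sgd_K0_le Ca).
  move=> /(ler_wpM2l Dr).
  have a3 : 0 <= Delta * r * a ^+ 3 by rewrite mulr_ge0 ?exprn_ge0 // ltW.
  have -> : 7 * Delta * r * C1 ^+ 2 * (K%:R * (8 * eta * (r * s))) =
    7 * (Delta * r * (C1 ^+ 2 * (K%:R * (8 * eta * (r * s))))) by ring.
  have -> : Delta * r * (a ^+ 2 * a) = Delta * r * a ^+ 3 by ring.
  by move: (Delta * r * a ^+ 3) (Delta * r * (C1 ^+ 2 * _)) a3 => *; lra.
(* The additive 2 from rounding and from the extra epoch is harmless because [delta = r * s] is at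
   most 1. *)
rewrite ler_pM2l // -[leRHS]mul1r ler_pdivlMr ?exprn_gt0 // -exprMn mulrC.
by rewrite -sgd_deltaE exprn_ile1 ?(delta_le1 setting) // ltW // (delta_gt0 rho_gt0 setting).
Qed.

Lemma sqr_radius_le : 18 * rho * B ^+ 2 <= s ^+ 2.
Proof.
have c2 : 14 ^+ 2 <= C1 ^+ 2 by rewrite ler_pXn2r ?nnegrE // ltW.
have b2 : 0 <= B ^+ 2 * rho by rewrite mulr_ge0 ?sqr_ge0 // ltW.
rewrite -sqr_radiusE; have := ler_wpM2l b2 c2.
by move: (C1 ^+ 2) => *; lra.
Qed.

Lemma sqr_radius_ge (a : R) : C1 <= a -> s ^+ 2 <= a ^+ 2 * (18 * rho * B ^+ 2).
Proof.
move=> Ca.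
have c2 : C1 ^+ 2 <= a ^+ 2 by rewrite ler_pXn2r ?nnegrE // ltW // (lt_le_trans C0).
have b2 : 0 <= B ^+ 2 * rho by rewrite mulr_ge0 ?sqr_ge0 // ltW.
have := mulr_ge0 (sqr_ge0 a) b2.
by rewrite -sqr_radiusE; have := ler_wpM2l b2 c2; lra.
Qed.

Context (c : R) (m : nat).
Hypothesis c_ge1 : 1 <= c.
Let q := c * polylog d eps ^+ m.

Lemma sgd_K0_upper (a : R) : C1 <= a -> s ^+ 3 <= q * eta ->
  K%:R * s ^+ 4 <= a * q / r.
Proof.
move=> Ca sq; rewrite ler_pdivlMr //.
have q0 : 0 < q by rewrite mulr_gt0 ?exprn_gt0 // ?(lt_le_trans _ polylog_ge1) // (lt_le_trans _ c_ge1).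
have Ks : 0 <= K%:R * s * r by rewrite !mulr_ge0 // ltW.
apply: le_trans (_ : K%:R * s * r * (q * eta) <= _).
  by apply: le_trans (ler_wpM2l Ks sq); rewrite le_eqVlt; apply/orP; left; apply/eqP; ring.
have := le_trans sgd_K0_le Ca; rewrite -(ler_pM2r q0) => h.
apply: le_trans h; have := mulr_ge0 Ks (mulr_ge0 (ltW q0) (ltW eta0)); lra.
Qed.

Lemma sgd_K0_lower : eta <= q * s ^+ 3 -> 1 <= 2 * r * q * (K%:R * s ^+ 4).
Proof.
move=> es.
have q0 : 0 < q by rewrite mulr_gt0 ?exprn_gt0 // ?(lt_le_trans _ polylog_ge1) // (lt_le_trans _ c_ge1).
have Ks : 0 <= K%:R * s * r by rewrite !mulr_ge0 // ltW.
have := ler_wpM2l Ks es; have := sgd_K0_ge; have := C14; lra.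
Qed.

(** [C1] depends on [d] and [eta] only through one logarithm, and the lower bound on [eta] makes
    that logarithm at most a constant times [polylog]. *)
Lemma sgd_C1_le : s ^+ 3 <= q * eta ->
  C1 <= 2 * `|(Num.floor (ln (3 * p^-1) / ln ((7 / 10)^-1) + 1))%:~R| *
    (ln 24 + ln c + m%:R + 3) * polylog d eps.
Proof.
move=> sq.
have pl1 := polylog_ge1; have e0 := eps_gt0 setting.
have pl0 : 0 < polylog d eps by apply: lt_le_trans pl1.
have c0 : 0 < c by apply: lt_le_trans c_ge1.
have q0 : 0 < q by rewrite mulr_gt0 ?exprn_gt0.
have d0 : 0 < d%:R :> R by rewrite ltr0n.
have lnd : 0 <= ln d%:R :> R by rewrite ln_ge0 // ler1n.
have lns : ln s = ln eps / 2.
  by rewrite /s -powR12_sqrt ?(ltW e0) // ln_powR mulrC.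
have lnsd : ln (Num.sqrt d%:R) = ln d%:R / 2 :> R.
  by rewrite -powR12_sqrt // ln_powR mulrC.
have lneta : - ln eta <= ln c + m%:R * ln (polylog d eps) - 3 * ln s.
  have : ln (s ^+ 3) <= ln (q * eta) by rewrite ler_ln ?posrE ?exprn_gt0 // mulr_gt0.
  rewrite lnXn // lnM ?posrE // /q lnM ?posrE ?exprn_gt0 // lnXn //.
  by rewrite -(mulr_natl _ m) -(mulr_natl _ 3); lra.
have lnpl : ln (polylog d eps) <= polylog d eps.
  have := @le_ln1Dx R (polylog d eps - 1); have -> : 1 + (polylog d eps - 1) = polylog d eps by rewrite addrC subrK.
  by move=> h; apply: le_trans (h _) _; lra.
have lnQ : ln (24 * Num.sqrt d%:R / eta) <= (ln 24 + ln c + m%:R + 3) * polylog d eps.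
  have sd0 : 0 < Num.sqrt d%:R :> R by rewrite sqrtr_gt0.
  rewrite ln_div ?posrE ?mulr_gt0 // lnM ?posrE // lnsd.
  have := lneta; rewrite lns.
  have : m%:R * ln (polylog d eps) <= m%:R * polylog d eps by rewrite ler_wpM2l.
  have l24 : 0 <= ln (24 : R) by rewrite ln_ge0 // ler1n.
  have lc : 0 <= ln c by rewrite ln_ge0.
  have := ler_wpM2l l24 pl1; have := ler_wpM2l lc pl1.
  have le1 : - ln eps <= `|ln eps| by rewrite -normrN ler_norm.
  have : ln d%:R + `|ln eps| <= polylog d eps by rewrite /polylog; lra.
  move: (ln (24 : R)) (ln c) (`|ln eps|) (normr_ge0 (ln eps)) le1 => *; lra.
have lnQ0 := lnQ_gt0 rho_gt0 p_gt0 p_lt1 setting.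
rewrite /C1 /sgd_C1 -mulrA -[leRHS]mulrA -[leRHS]mulrA ler_pM2l //; move: (_%:~R) => fl.
apply: le_trans (_ : `|fl| * ln (24 * Num.sqrt d%:R / eta) <= _).
  by rewrite ler_wpM2r ?(ltW lnQ0) // ler_norm.
by rewrite ler_wpM2l.
Qed.

End scales.

Lemma powR_half (R : realType) (x : R) (n : nat) : 0 < x -> x `^ (n%:R / 2) = Num.sqrt x ^+ n.
Proof. by move=> x0; rewrite mulrC powRrM powR12_sqrt ?(ltW x0) // powR_mulrn // sqrtr_ge0. Qed.

Section large_constants.
Context (R : realType).

(** Validity for all sufficiently large constants is stable under conjunction, so one pair of
    constants serves all the estimates. *)
Definition large (Q : R -> nat -> Prop) : Prop :=
  exists C m, 0 < C /\ forall C' m', C <= C' -> (m <= m')%N -> Q C' m'.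

Lemma large_and (Q Q' : R -> nat -> Prop) : large Q -> large Q' ->
  large (fun C m => Q C m /\ Q' C m).
Proof.
move=> [C [m [C0 QC]]] [C' [m' [C'0 QC']]]; exists (C + C'), (m + m')%N.
split=> [|C'' m'' CC mm]; first exact: addr_gt0.
split.
  by apply: QC; [apply: le_trans CC; rewrite lerDl ltW|apply: leq_trans mm; exact: leq_addr].
by apply: QC'; [apply: le_trans CC; rewrite lerDr ltW|apply: leq_trans mm; exact: leq_addl].
Qed.

Lemma large_bigO (T : Type) (hyp : T -> Prop) (dim : T -> nat) (eps a b : T -> R) (C : R) (m : nat) :
  (forall t, hyp t -> (0 < dim t)%N) -> (forall t, hyp t -> 0 <= b t) -> 0 <= C ->
  (forall t, hyp t -> bigO_polylog C m (dim t) (eps t) (a t) (b t)) ->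
  large (fun C m => forall t, hyp t -> bigO_polylog C m (dim t) (eps t) (a t) (b t)).
Proof.
move=> d0 b0 C0 ab; exists (C + 1), m; split=> [|C' m' CC mm t ht]; first by rewrite ltr_wpDl.
apply: le_trans (ab t ht) _; have pl1 := polylog_ge1 (eps t) (d0 t ht).
apply: ler_wpM2r; first exact: b0.
apply: ler_pM => //; first by rewrite exprn_ge0 // (le_trans _ pl1).
  by apply: le_trans CC; rewrite lerDl.
by apply: ler_weXn2l.
Qed.

End large_constants.

Section asymptotics.
Context (R : realType) (L rho sigma Delta p : R).
Hypotheses (L_gt0 : 0 < L) (rho_gt0 : 0 < rho) (sigma_gt0 : 0 < sigma).
Hypotheses (p_gt0 : 0 < p) (p_lt1 : p < 1) (Delta_ge0 : 0 <= Delta).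
Context (Ceta : R) (meta : nat).

Let hyp (t : nat * R * R) : Prop :=
  [/\ (0 < t.1.1)%N, parameter_setting t.1.1 L rho sigma t.1.2 t.2 p
    & asymp_polylog Ceta meta t.1.1 t.1.2 t.2 (t.1.2 `^ (3 / 2))].

Let order (a b : nat -> R -> R -> R) (C : R) (m : nat) : Prop :=
  forall t, hyp t ->
    bigO_polylog C m t.1.1 t.1.2 (a t.1.1 t.1.2 t.2) (b t.1.1 t.1.2 t.2).

Let r := Num.sqrt rho.
Let r_gt0 : 0 < r. Proof. by rewrite sqrtr_gt0. Qed.
(** A constant at least 1, so that its logarithm is nonnegative. *)
Let c := `|Ceta| + 1.
Let c_ge1 : 1 <= c. Proof. by rewrite lerDr. Qed.
Let c_gt0 : 0 < c. Proof. exact: lt_le_trans c_ge1. Qed.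
Let A := 2 * `|(Num.floor (ln (3 * p^-1) / ln ((7 / 10)^-1) + 1))%:~R| *
    (ln 24 + ln c + meta%:R + 3).

Let A_ge0 : 0 <= A.
Proof.
rewrite mulr_ge0 ?mulr_ge0 // !addr_ge0 // ln_ge0 //.
by rewrite ler1n.
Qed.

Let order_large a b C m : 0 <= C ->
  (forall d eps eta, hyp (d, eps, eta) -> 0 <= b d eps eta) ->
  (forall d eps eta, hyp (d, eps, eta) ->
     a d eps eta <= C * polylog d eps ^+ m * b d eps eta) ->
  large (order a b).
Proof.
move=> C0 b0 ab.
apply: (@large_bigO R _ hyp (fun t => t.1.1) (fun t => t.1.2)
  (fun t => a t.1.1 t.1.2 t.2) (fun t => b t.1.1 t.1.2 t.2) C m) => // [t []|t ht|t ht] //.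
- by apply: b0; case: t ht => -[].
- by apply: ab; case: t ht => -[].
Qed.

Let eps_gt0' d eps eta : hyp (d, eps, eta) -> 0 < eps.
Proof. by case=> _ /= h _; exact: eps_gt0 h. Qed.

Let sqrt_eps_gt0 d eps eta : hyp (d, eps, eta) -> 0 < Num.sqrt eps.
Proof. by move=> h; rewrite sqrtr_gt0 (eps_gt0' h). Qed.

Let eta_order d eps eta : hyp (d, eps, eta) ->
  Num.sqrt eps ^+ 3 <= c * polylog d eps ^+ meta * eta /\
  eta <= c * polylog d eps ^+ meta * Num.sqrt eps ^+ 3.
Proof.
move=> h; have e0 := eps_gt0' h; have [/= d0 setting [h1 h2]] := h.
have s0 := sqrt_eps_gt0 h; have eta0 := eta_gt0 setting.
rewrite /bigO_polylog (powR_half 3 e0) in h1 h2.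
have pl0 : 0 <= polylog d eps ^+ meta.
  by rewrite exprn_ge0 // (le_trans _ (polylog_ge1 eps d0)).
have Cc : Ceta <= c by apply: le_trans (ler_norm _) _; rewrite lerDl.
split; [apply: le_trans h2 _|apply: le_trans h1 _].
  by apply: ler_wpM2r; [exact: ltW|exact: ler_wpM2r].
by apply: ler_wpM2r; [rewrite exprn_ge0 // ltW|exact: ler_wpM2r].
Qed.

Let C1_order d eps eta : hyp (d, eps, eta) -> sgd_C1 d eta p <= A * polylog d eps.
Proof.
move=> h; have [s3 _] := eta_order h; have [/= d0 setting _] := h.
exact: (sgd_C1_le d0 rho_gt0 p_gt0 p_lt1 setting c_ge1 s3).
Qed.

Let polylog_ge1' d eps eta : hyp (d, eps, eta) -> 1 <= polylog d eps.
Proof. by case=> /= d0 _ _; exact: polylog_ge1. Qed.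

Lemma radius_order_le :
  large (order (fun d eps eta => 18 * rho * sgd_radius d rho eps eta p ^+ 2) (fun _ eps _ => eps)).
Proof.
apply: (order_large (C := 1) (m := 0)) => [//|d eps eta h|d eps eta h]; first exact: ltW (eps_gt0' h).
have [/= d0 setting _] := h; rewrite expr0 !mul1r.
have := sqr_radius_le d0 rho_gt0 p_gt0 p_lt1 setting.
by rewrite sqr_sqrtr // ltW // (eps_gt0' h).
Qed.

Lemma radius_order_ge :
  large (order (fun _ eps _ => eps) (fun d eps eta => 18 * rho * sgd_radius d rho eps eta p ^+ 2)).
Proof.
apply: (order_large (C := A ^+ 2) (m := 2)) => [|d eps eta h|d eps eta h]; first exact: sqr_ge0.
  by rewrite mulr_ge0 ?sqr_ge0 // mulr_ge0 // ltW.
have [/= d0 setting _] := h.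
have := sqr_radius_ge rho_gt0 setting (C1_order h).
by rewrite sqr_sqrtr ?exprMn // ltW // (eps_gt0' h).
Qed.

Lemma delta_order : large (fun C m =>
  order (fun _ eps _ => 17 * sgd_delta rho eps) (fun _ eps _ => Num.sqrt (rho * eps)) C m /\
  order (fun _ eps _ => Num.sqrt (rho * eps)) (fun _ eps _ => 17 * sgd_delta rho eps) C m).
Proof.
apply: large_and.
  apply: (order_large (C := 17) (m := 0)) => [//|d eps eta h|d eps eta h]; first exact: sqrtr_ge0.
  by rewrite expr0 mulr1.
apply: (order_large (C := 1) (m := 0)) => [//|d eps eta h|d eps eta h]; first by rewrite mulr_ge0 ?sqrtr_ge0.
by rewrite expr0 !mul1r ler_peMl ?sqrtr_ge0 // ler1n.
Qed.

Let X1 := Delta * r * A ^+ 3 + 2 * (r ^+ 3)^-1.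

Let X1_ge0 : 0 <= X1.
Proof.
rewrite addr_ge0 //; last by rewrite mulr_ge0 // invr_ge0 exprn_ge0 // ltW.
by rewrite mulr_ge0 ?exprn_ge0 // mulr_ge0 // ltW.
Qed.

Let T1_bound d eps eta : hyp (d, eps, eta) ->
  (sgd_T1 d rho eps eta p Delta)%:R * Num.sqrt eps ^+ 3 <= X1 * polylog d eps ^+ 3.
Proof.
move=> h; have [/= d0 setting _] := h; have pl1 := polylog_ge1' h.
apply: le_trans (sgd_T1_le rho_gt0 Delta_ge0 setting (C1_order h)) _.
rewrite exprMn [leRHS]mulrDl; apply: lerD; first by rewrite mulrA.
by rewrite ler_peMr ?exprn_ege1 // mulr_ge0 // invr_ge0 exprn_ge0 // ltW.
Qed.

Let K0_bound d eps eta : hyp (d, eps, eta) ->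
  (sgd_K0 d rho eps eta p)%:R * Num.sqrt eps ^+ 4 <= A * c / r * polylog d eps ^+ meta.+1.
Proof.
move=> h; have [/= d0 setting _] := h; have [s3 _] := eta_order h.
apply: le_trans (sgd_K0_upper d0 rho_gt0 setting c_ge1 (C1_order h) s3) _.
by rewrite le_eqVlt exprS; apply/orP; left; apply/eqP; ring.
Qed.

Let powR_neg n (eps : R) : 0 < eps -> eps `^ (- (n%:R / 2)) = (Num.sqrt eps ^+ n)^-1.
Proof. by move=> e0; rewrite powRN powR_half. Qed.

Lemma total_order_le : large (order (fun d eps eta => (sgd_T0 d rho eps eta p Delta)%:R)
  (fun _ eps _ => eps `^ (- (7 / 2)))).
Proof.
apply: (order_large (C := X1 * (A * c / r)) (m := (meta.+1 + 3)%N)) => [|d eps eta h|d eps eta h].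
- by rewrite mulr_ge0 // mulr_ge0 ?invr_ge0 ?(ltW r_gt0) // mulr_ge0 // ltW.
- exact: powR_ge0.
have e0 := eps_gt0' h; have s0 := sqrt_eps_gt0 h.
rewrite (powR_neg 7 e0) ler_pdivlMr ?exprn_gt0 // /sgd_T0 natrM.
have TK := ler_pM (mulr_ge0 (ler0n _ _) (exprn_ge0 3 (ltW s0)))
  (mulr_ge0 (ler0n _ _) (exprn_ge0 4 (ltW s0))) (T1_bound h) (K0_bound h).
have -> : (sgd_T1 d rho eps eta p Delta)%:R * (sgd_K0 d rho eps eta p)%:R * Num.sqrt eps ^+ 7 =
  (sgd_T1 d rho eps eta p Delta)%:R * Num.sqrt eps ^+ 3 *
  ((sgd_K0 d rho eps eta p)%:R * Num.sqrt eps ^+ 4) by ring.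
by apply: le_trans TK _; rewrite [(meta.+1 + 3)%N]addnC exprD mulrACA.
Qed.

Section positive_gap.
Hypothesis Delta_gt0 : 0 < Delta.

Let Dr0 : 0 < Delta * r. Proof. exact: mulr_gt0. Qed.

Lemma restarts_order : large (fun C m =>
  order (fun d eps eta => (sgd_T1 d rho eps eta p Delta)%:R) (fun _ eps _ => eps `^ (- (3 / 2))) C m /\
  order (fun _ eps _ => eps `^ (- (3 / 2))) (fun d eps eta => (sgd_T1 d rho eps eta p Delta)%:R) C m).
Proof.
apply: large_and.
  apply: (order_large (C := X1) (m := 3)) => [//|d eps eta h|d eps eta h]; first exact: powR_ge0.
  rewrite (powR_neg 3 (eps_gt0' h)) ler_pdivlMr ?exprn_gt0 ?(sqrt_eps_gt0 h) //.
  exact: T1_bound.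
apply: (order_large (C := (Delta * r)^-1) (m := 0)) => [|d eps eta h|d eps eta h] //.
  by rewrite invr_ge0 ltW.
have [/= d0 setting _] := h.
rewrite (powR_neg 3 (eps_gt0' h)) expr0 mulr1 -[leLHS]mul1r.
rewrite ler_pdivrMr ?exprn_gt0 ?(sqrt_eps_gt0 h) // -mulrA ler_pdivlMl // mulr1.
exact: (sgd_T1_ge d0 rho_gt0 p_gt0 p_lt1 Delta_ge0 setting).
Qed.

Lemma total_order_ge : large (order (fun _ eps _ => eps `^ (- (7 / 2)))
  (fun d eps eta => (sgd_T0 d rho eps eta p Delta)%:R)).
Proof.
apply: (order_large (C := (Delta * r)^-1 * (2 * r * c)) (m := meta)) => [|d eps eta h|d eps eta h] //.
  by rewrite mulr_ge0 ?invr_ge0 ?(ltW Dr0) // !mulr_ge0 // ltW.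
have [/= d0 setting _] := h; have e0 := eps_gt0' h; have s0 := sqrt_eps_gt0 h.
have [_ es] := eta_order h.
rewrite (powR_neg 7 e0) -[leLHS]mul1r ler_pdivrMr ?exprn_gt0 // /sgd_T0 natrM.
have T := sgd_T1_ge d0 rho_gt0 p_gt0 p_lt1 Delta_ge0 setting.
have Kl := sgd_K0_lower d0 rho_gt0 p_gt0 p_lt1 setting c_ge1 es.
rewrite -!mulrA ler_pdivlMl // mulr1.
have := ler_pM (ltW Dr0) ler01 T Kl.
rewrite mulr1 => /le_trans; apply; rewrite le_eqVlt; apply/orP; left; apply/eqP.
rewrite /r; move: (sgd_T1 _ _ _ _ _ _)%:R (sgd_K0 _ _ _ _ _)%:R => *; ring.
Qed.

Let kappa := Delta * rho `^ (1 / 2) / Num.max (sigma ^+ 2) 1.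

Let kappa_gt0 : 0 < kappa.
Proof. by rewrite divr_gt0 ?mulr_gt0 ?powR_gt0 // lt_max ltr01 orbT. Qed.

Lemma total_order_kappa : large (fun C m =>
  order (fun d eps eta => (sgd_T0 d rho eps eta p Delta)%:R)
    (fun _ eps _ => Delta * rho `^ (1 / 2) / (Num.max (sigma ^+ 2) 1 * eps `^ (7 / 2))) C m /\
  order (fun _ eps _ => Delta * rho `^ (1 / 2) / (Num.max (sigma ^+ 2) 1 * eps `^ (7 / 2)))
    (fun d eps eta => (sgd_T0 d rho eps eta p Delta)%:R) C m).
Proof.
have kE eps : 0 < eps ->
    Delta * rho `^ (1 / 2) / (Num.max (sigma ^+ 2) 1 * eps `^ (7 / 2)) = kappa * eps `^ (- (7 / 2)).
  by move=> e0; rewrite powRN invfM mulrA.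
apply: large_and.
  have [C [m [C0 le1]]] := total_order_le.
  apply: (order_large (C := C / kappa) (m := m)) => [|d eps eta h|d eps eta h].
  - by rewrite divr_ge0 ?ltW.
  - by rewrite (kE _ (eps_gt0' h)) mulr_ge0 ?powR_ge0 // ltW.
  rewrite (kE _ (eps_gt0' h)); apply: le_trans (le1 C m (lexx _) (leqnn _) _ h) _ => /=.
  rewrite le_eqVlt; apply/orP; left; apply/eqP.
  move: (eps `^ _) (polylog _ _ ^+ _) kappa kappa_gt0 => u v k k0.
  by field; exact: lt0r_neq0.
have [C [m [C0 le1]]] := total_order_ge.
apply: (order_large (C := kappa * C) (m := m)) => [|d eps eta h|d eps eta h] //.
  by rewrite mulr_ge0 ?ltW.
rewrite (kE _ (eps_gt0' h)).
have := ler_wpM2l (ltW kappa_gt0) (le1 C m (lexx _) (leqnn _) _ h).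
by rewrite /= !mulrA.
Qed.

End positive_gap.

Lemma sgd_asymptotics : exists (C : R) (m : nat), 0 < C /\
  forall (d : nat) (eps eta : R),
    (0 < d)%N ->
    parameter_setting d L rho sigma eps eta p ->
    asymp_polylog Ceta meta d eps eta (eps `^ (3 / 2)) ->
    [/\ asymp_polylog C m d eps
          (18 * rho * sgd_radius d rho eps eta p ^+ 2) eps,
        asymp_polylog C m d eps (17 * sgd_delta rho eps) (Num.sqrt (rho * eps)),
        bigO_polylog C m d eps
          (sgd_T0 d rho eps eta p Delta)%:R (eps `^ (- (7 / 2)))
      & 0 < Delta ->
        [/\ asymp_polylog C m d eps
              (sgd_T1 d rho eps eta p Delta)%:R (eps `^ (- (3 / 2))),
            asymp_polylog C m d eps (sgd_T0 d rho eps eta p Delta)%:R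
              (Delta * rho `^ (1 / 2) /
               (Num.max (sigma ^+ 2) 1 * eps `^ (7 / 2)))
          & asymp_polylog C m d eps
              (sgd_T0 d rho eps eta p Delta)%:R (eps `^ (- (7 / 2)))]].
Proof.
have base := large_and (large_and radius_order_le radius_order_ge)
  (large_and delta_order total_order_le).
(* The constants may depend on [Delta], so the case is decided first; for [Delta = 0] there is a
   single epoch, and only the first three estimates are claimed. *)
have [D0|D0] := ltP 0 Delta; last first.
  have [C [m [C0 H]]] := base; exists C, m; split=> // d eps eta d0 setting eta_asymp.
  have [[b1 b2] [[b3 b4] b5]] := H C m (lexx _) (leqnn _).
  have h : hyp (d, eps, eta) by split.
  split; [by split; [exact: b1 h|exact: b2 h]|by split; [exact: b3 h|exact: b4 h]|exact: b5 h|by []].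
have [C [m [C0 H]]] := large_and base (large_and (restarts_order D0)
  (large_and (total_order_kappa D0) (total_order_ge D0))).
exists C, m; split=> // d eps eta d0 setting eta_asymp.
have [[[b1 b2] [[b3 b4] b5]] [[b6 b7] [[b8 b9] b10]]] := H C m (lexx _) (leqnn _).
have h : hyp (d, eps, eta) by split.
split; [by split; [exact: b1 h|exact: b2 h]|by split; [exact: b3 h|exact: b4 h]|exact: b5 h|].
move=> _; split; [by split; [exact: b6 h|exact: b7 h]|by split; [exact: b8 h|exact: b9 h]|].
by split; [exact: b5 h|exact: b10 h].
Qed.

End asymptotics.

Theorem theorem1 (R : realType) (L rho sigma Delta p : R)
    (L_gt0 : 0 < L) (rho_gt0 : 0 < rho) (sigma_gt0 : 0 < sigma)
    (p_gt0 : 0 < p) (p_lt1 : p < 1) :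
  (forall (d : nat) (eps eta : R),
     (0 < d)%N ->
     parameter_setting d L rho sigma eps eta p ->
   forall (dZ : measure_display) (Z : measurableType dZ) (D : probability Z R)
          (F : 'rV[R]_d -> Z -> R) (f : 'rV[R]_d -> R) (xtilde : 'rV[R]_d),
     is_mean D F f ->
     differentiability F f ->
     unbiased_gradient D F f ->
     smoothness L rho F f ->
     has_lbound (range f) -> Delta = f xtilde - inf (range f) ->
     bounded_noise sigma D F f ->
     dispersive_noise sigma D F ->
   forall (dO : measure_display) (Omega : measurableType dO)
          (P : probability Omega R) (zeta : nat -> {RV P >-> Z}),
     iid D zeta ->
     let B := sgd_radius d rho eps eta p in
     let K := sgd_K0 d rho eps eta p in
     let final := fun w : Omega =>
       sgd_run (sgrad F) eta B K xtilde (fun t => zeta t w)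
         (sgd_T0 d rho eps eta p Delta) in
     ((1 - ((sgd_T1 d rho eps eta p Delta)%:R + 1) * p)%:E <=
      P [set w | [/\ sgd_ended K (final w),
           (enorm (grad f (sgd_output K (final w))) <= 18 * rho * B ^+ 2)%R
         & (- (17 * sgd_delta rho eps) <=
             lambda_min (hessian f (sgd_output K (final w))))%R]])%E)
  /\
  (0 <= Delta ->
   forall (Ceta : R) (meta : nat), exists (C : R) (m : nat), 0 < C /\
   forall (d : nat) (eps eta : R),
     (0 < d)%N ->
     parameter_setting d L rho sigma eps eta p ->
     asymp_polylog Ceta meta d eps eta (eps `^ (3 / 2)) ->
     [/\ asymp_polylog C m d eps
           (18 * rho * sgd_radius d rho eps eta p ^+ 2) eps,
         asymp_polylog C m d eps (17 * sgd_delta rho eps) (Num.sqrt (rho * eps)),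
         bigO_polylog C m d eps
           (sgd_T0 d rho eps eta p Delta)%:R (eps `^ (- (7 / 2)))
       & 0 < Delta ->
         [/\ asymp_polylog C m d eps
               (sgd_T1 d rho eps eta p Delta)%:R (eps `^ (- (3 / 2))),
             asymp_polylog C m d eps (sgd_T0 d rho eps eta p Delta)%:R
               (Delta * rho `^ (1 / 2) /
                (Num.max (sigma ^+ 2) 1 * eps `^ (7 / 2)))
           & asymp_polylog C m d eps
               (sgd_T0 d rho eps eta p Delta)%:R (eps `^ (- (7 / 2)))]]).
Proof.
split=> [d eps eta d0 setting dZ Z D F f xt _ diff unbiased smooth lbf DeltaE noise disp dO Omega P
  zeta zeta_iid|Delta0 Ceta meta]; last exact: sgd_asymptotics.
(* The guarantee already holds with total error probability T1 times p. *)
cbv zeta; apply: le_trans (sgd_guarantee L_gt0 rho_gt0 sigma_gt0 p_gt0 p_lt1 d0 setting diff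
  unbiased smooth lbf DeltaE noise disp zeta_iid).
by rewrite lee_fin lerD2l lerN2 ler_pM2r // lerDl.
Qed.
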